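(* Let $0<\alpha,\beta\le 1$. The subordination kernel $\psi_{\alpha,\beta}$ is given by $$\psi_{\alpha,\beta}(t,\tau)=t^{-\beta/\alpha}K_{\alpha,\beta}(\tau t^{-\beta/\alpha}),\qquad t,\tau>0,$$ where the function $K_{\alpha,\beta}(r)=\psi_{\alpha,\beta}(1,r)$, $r>0$, admits the following representations: $$K_{\alpha,\beta}(r)=\int_0^\infty \sigma^{-1/\alpha}L_\alpha(r\sigma^{-1/\alpha})M_\beta(\sigma)\,d\sigma,$$ $$K_{\alpha,\beta}(r)=\int_0^\infty \sigma^{\beta/\alpha}L_\alpha(r\sigma^{\beta/\alpha})L_\beta(\sigma)\,d\sigma,$$ $$K_{\alpha,\beta}(r)=\alpha r^{\alpha-1}\int_0^\infty \sigma M_\alpha(\sigma)M_\beta(\sigma r^\alpha)\,d\sigma.$$ Moreover, in the particular case $\alpha=\beta<1$, $$K_{\alpha,\alpha}(r)=\frac1\pi\,\frac{r^{\alpha-1}\sin\alpha\pi}{r^{2\alpha}+2r^\alpha\cos\alpha\pi+1},$$ and if $0<\alpha\le\beta\le 1$ then $$K_{\alpha,\beta}(r)=\int_0^\infty \sigma^{-\beta/\alpha}L_{\alpha/\beta}(r\sigma^{-\beta/\alpha})K_{\beta,\beta}(\sigma)\,d\sigma.$$ Here $L_\alpha(r)$ is the Lévy extremal stable density and $M_\beta(r)$ is the Mainardi function.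
   Context: Kernels (principal branches of powers, $t,\tau>0$, any $c>0$): for $0<\alpha<1$, $f_\alpha(t,\tau)=\frac{1}{2\pi i}\int_{c-i\infty}^{c+i\infty}e^{z\tau-tz^\alpha}\,dz$; for $0<\beta<1$, $\varphi_\beta(t,\tau)=\frac{1}{2\pi i}\int_{c-i\infty}^{c+i\infty}z^{\beta-1}e^{zt-\tau z^\beta}\,dz$; and the subordination kernel is $\psi_{\alpha,\beta}(t,\tau)=\int_0^\infty\varphi_\beta(t,\sigma)f_\alpha(\sigma,\tau)\,d\sigma$. In the limiting cases $f_1(t,\tau)=\varphi_1(t,\tau)=\psi_{1,1}(t,\tau)=\delta(t-\tau)$ (Dirac delta), so that $\psi_{\alpha,1}=f_\alpha$ and $\psi_{1,\beta}=\varphi_\beta$. The Mittag-Leffler function is $E_\beta(z)=\sum_{k=0}^\infty\frac{z^k}{\Gamma(\beta k+1)}$. The functions $L_\alpha(r)=f_\alpha(1,r)$ (Lévy extremal stable density) and $M_\beta(r)=\varphi_\beta(1,r)$ (Mainardi function) are equivalently defined by the Laplace transform pairs $\int_0^\infty e^{-\lambda r}L_\alpha(r)\,dr=\exp(-\lambda^\alpha)$ and $\int_0^\infty e^{-\lambda r}M_\beta(r)\,dr=E_\beta(-\lambda)$, $\lambda>0$. For parameter $1$: $L_1(r)=M_1(r)=K_{1,1}(r)=\delta(r-1)$, and formulas containing these are understood by the usual rules for the Dirac delta (i.e. as identities of measures where necessary). *)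

(* Defs.v *)
From HB Require Import structures.
From mathcomp Require Import all_boot all_order all_algebra.
From mathcomp Require Import complex.
From mathcomp Require Import all_classical all_reals all_analysis.

Set Implicit Arguments.
Unset Strict Implicit.
Unset Printing Implicit Defensive.

Import Order.TTheory GRing.Theory Num.Theory.
Import numFieldNormedType.Exports.

Local Open Scope classical_set_scope.
Local Open Scope ring_scope.
Local Open Scope complex_scope.

(* The principal argument, with values in ]-pi, pi]. *)
Definition carg (R : realType) (z : R[i]) : R :=
  let x := complex.Re z in let y := complex.Im z in
  let a := acos (x / Num.sqrt (x ^+ 2 + y ^+ 2)) in
  if 0 <= y then a else - a.

Definition clog (R : realType) (z : R[i]) : R[i] :=
  ln (Num.sqrt (complex.Re z ^+ 2 + complex.Im z ^+ 2)) +i* carg z.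

Definition cexp (R : realType) (z : R[i]) : R[i] :=
  (expR (complex.Re z))%:C * (cos (complex.Im z) +i* sin (complex.Im z)).

Definition cpow (R : realType) (z : R[i]) (a : R) : R[i] :=
  cexp (a%:C * clog z).

Definition cintegral (R : realType) (F : R -> R[i]) : R[i] :=
  (\int[lebesgue_measure]_(y in [set: R]) complex.Re (F y)) +i*
  (\int[lebesgue_measure]_(y in [set: R]) complex.Im (F y)).

(* (2 pi i)^-1 times the integral of F over the line Re z = c, parametrized by
   z = c + i y, dz = i dy. *)
Definition bromwich (R : realType) (c : R) (F : R[i] -> R[i]) : R[i] :=
  (0 +i* (2 * pi))^-1 * cintegral (fun y : R => F (c +i* y) * (0 +i* 1)).

(* In both kernels F (z^* ) = (F z)^* on Re z > 0, so the contour integral is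
   real; taking the real part only changes its type from R[i] to R. *)
Definition levy_kernel (R : realType) (c alpha t tau : R) : R :=
  complex.Re (bromwich c (fun z =>
    cexp (z * tau%:C - t%:C * cpow z alpha))).

Definition mainardi_kernel (R : realType) (c beta t tau : R) : R :=
  complex.Re (bromwich c (fun z =>
    cpow z (beta - 1) * cexp (z * t%:C - tau%:C * cpow z beta))).

(* Kernels on the half-line are either functions or, in the limiting cases, of
   the form r |-> delta(r - p). *)
Inductive gfun (R : realType) : Type :=
| Regular of R -> R
| Dirac of R.

Definition halfline (R : realType) : set R := `]0, +oo[%classic.
Arguments halfline {R}.

(* f_alpha(t, .) *)
Definition fker (R : realType) (c alpha t : R) : gfun R :=
  if alpha == 1 then Dirac t else Regular (levy_kernel c alpha t).

(* phi_beta(t, .) *)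
Definition phiker (R : realType) (c beta t : R) : gfun R :=
  if beta == 1 then Dirac t else Regular (mainardi_kernel c beta t).

(* psi_{alpha,beta}(t, .); c and d are the abscissae of the contours defining
   f_alpha and phi_beta. The first two branches are the values of the
   superposition integral when phi_1(t,sigma) = delta(t - sigma), resp.
   f_1(sigma,tau) = delta(sigma - tau). *)
Definition psiker (R : realType) (c d alpha beta t : R) : gfun R :=
  if beta == 1 then fker c alpha t
  else if alpha == 1 then phiker d beta t
  else Regular (fun tau =>
    \int[lebesgue_measure]_(sigma in @halfline R)
      (mainardi_kernel d beta t sigma * levy_kernel c alpha sigma tau)).

Definition levyL (R : realType) (c alpha : R) : gfun R := fker c alpha 1.

Definition mainardiM (R : realType) (d beta : R) : gfun R := phiker d beta 1.

Definition subordK (R : realType) (c d alpha beta : R) : gfun R :=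
  psiker c d alpha beta 1.

(* The usual rule for the integral of w(s) delta(a(s) - p) over s in A, where
   the zeros of a - p are simple. *)
Definition dirac_int (R : realType) (A : set R) (w a : R -> R) (p : R) : R :=
  \sum_(s \in A `&` [set s | a s = p]) w s / `|derive1 a s|.

(* The integral of w(s) k(a(s)) over s in A; it is extended-real valued, so
   that a finite value entails convergence. *)
Definition gint (R : realType) (A : set R) (w : R -> R) (k : gfun R)
    (a : R -> R) : \bar R :=
  match k with
  | Regular f => (\int[lebesgue_measure]_(s in A) (w s * f (a s))%:E)%E
  | Dirac p => (dirac_int A w a p)%:E
  end.

(* k is a function, equal to F at every point of the half-line. *)
Definition pointwise (R : realType) (k : gfun R) (F : R -> \bar R) : Prop :=
  match k with
  | Regular f => forall r, 0 < r -> (f r)%:E = F r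
  | Dirac _ => False
  end.

(* k(r) dr and mu coincide as measures on the half-line. *)
Definition as_measure (R : realType) (k : gfun R) (mu : set R -> \bar R) :
    Prop :=
  forall A : set R, measurable A -> A `<=` halfline ->
    gint A (fun=> 1) k id = mu A.

(* k1(r) = w k2(r w) *)
Definition rescaling (R : realType) (k1 : gfun R) (w : R) (k2 : gfun R) :
    Prop :=
  match k2 with
  | Regular g => pointwise k1 (fun r => (w * g (r * w))%:E)
  | Dirac _ => as_measure k1 (fun A => gint A (fun=> w) k2 (fun r => r * w))
  end.

(* k(r) is the integral of w(r,s) k1(a(r,s)) k2(s) over s > 0. If at most one
   of k1, k2 is a Dirac delta, the right-hand side is a function of r and the
   identity holds at every r > 0; if both are, it holds between measures, the
   right-hand side giving to A the value obtained by integrating in r over A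
   and then in s. *)
Definition superposition (R : realType) (k : gfun R) (w : R -> R -> R)
    (k1 : gfun R) (a : R -> R -> R) (k2 : gfun R) : Prop :=
  match k1, k2 with
  | Dirac p, Dirac q =>
      as_measure k (fun A =>
        gint halfline (fun s => dirac_int A (w ^~ s) (a ^~ s) p) k2 id)
  | _, Regular g =>
      pointwise k (fun r => gint halfline (fun s => w r s * g s) k1 (a r))
  | Regular f, Dirac _ =>
      pointwise k (fun r => gint halfline (fun s => w r s * f (a r s)) k2 id)
  end.

(* Main.v *)
(** Integration by parts along the contour links the two kernels by
    tau f_a(t, tau) = a t phi_a(tau, t), and both are homogeneous; hence the first three
    representations of K are power substitutions in psi(1, r).

    The other two identities compare Laplace transforms. On the imaginary axis f_a(t, .) is bounded
    and vanishes on the negative half-line, so it is a cosine transform, and Abel summation with the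
    Poisson kernel gives the transform exp(- t l^a). By Fubini that of K_{a,b} is the integral of
    M_b(s) exp(- s l^a), where M_b is evaluated on a contour opened beyond the imaginary axis; this
    is also what makes M_b bounded and the integrals absolutely convergent. For a = b, closing the
    contour onto the negative axis turns the result into the transform of the jump of
    z^(a-1) / (z^a + 1) across the cut, which is the closed form. Replacing M_b by K_{b,b} and a by
    a / b leaves the transform unchanged, and Lerch's theorem concludes. *)

Require Import Defs.
From HB Require Import structures.
From mathcomp Require Import all_boot all_order all_algebra.
From mathcomp Require Import all_classical all_reals all_analysis.
From mathcomp Require Import measurable_realfun complex zify ring lra.

Import Order.TTheory GRing.Theory Num.Theory.
Import numFieldNormedType.Exports.

Local Open Scope classical_set_scope.
Local Open Scope ring_scope.

Set Implicit Arguments.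
Unset Strict Implicit.
Unset Printing Implicit Defensive.

(** * Integration on the half-line *)

Section analysis.
Context {R : realType}.
Notation mu := (@lebesgue_measure R).
Notation H := (@halfline R).
Implicit Types (f g h F G : R -> R).

(** Conjugation symmetry reduces every line integral to y > 0, so all integrals live on the open
    half-line, and contours move by differentiating a real part in the abscissa or an imaginary part
    in the angle.

    The obstacle is absolute convergence. As t tends to 0, exp (- t z^a) gives no uniform decay on a
    vertical line, so the bound on M_a comes from a ray where exp z decays by itself. The link
    between the two kernels and homogeneity carry it over to |f_a(t, s)| <= C t^(-e) s^(a e - 1) for
    all -1 <= e <= 1/a. The freedom in e is essential: e = 0 makes the superposition converge, but
    leaves a factor 1/r that is not integrable at 0, so the Laplace transform in r needs some e > 0.

    The parameters alpha = 1 and beta = 1 are not reached as limits: each delta is evaluated at its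
    only zero, and what remains is an identity between f and M. *)

Definition hL1 f := mu.-integrable H (EFin \o f).

Lemma halflineE x : H x = (0 < x) :> Prop.
Proof. by rewrite /halfline /= in_itv/= andbT. Qed.

Lemma halflineP x : x \in H = (0 < x).
Proof. by apply/idP/idP; rewrite inE halflineE. Qed.

Lemma measurable_halfline : measurable H.
Proof. exact: measurable_itv. Qed.
Hint Resolve measurable_halfline : core.

Lemma open_halfline : open H.
Proof. exact: interval_open. Qed.

Lemma near_halfline (x : R) : 0 < x -> \forall y \near x, 0 < y.
Proof.
move=> x0; have /open_nbhs_nbhs : open_nbhs x H.
  by split; [exact: open_halfline|rewrite halflineE].
by apply: filterS => y; rewrite halflineE.
Qed.

Lemma continuous_hmeas f : (forall x : R, 0 < x -> {for x, continuous f}) ->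
  measurable_fun H f.
Proof.
move=> cf; apply: open_continuous_measurable_fun; first exact: open_halfline.
by move=> x; rewrite halflineP; exact: cf.
Qed.

Lemma hL1_le f g : measurable_fun H f -> (forall x : R, 0 < x -> `|f x| <= g x) ->
  hL1 g -> hL1 f.
Proof.
move=> mf fg; apply: le_integrable => //; first exact/measurable_EFinP.
move=> x; rewrite halflineE => /fg; rewrite lee_fin => /le_trans; apply.
by rewrite ler_norm.
Qed.

Lemma hL1_meas f : hL1 f -> measurable_fun H f.
Proof. by move=> /integrableP[/measurable_EFinP]. Qed.

Lemma hL1Z k f : hL1 f -> hL1 (fun x => k * f x).
Proof.
by move=> If; rewrite /hL1 (_ : _ \o _ = fun x => (k%:E * (EFin \o f) x)%E)//;
  exact: integrableZl.
Qed.

Lemma hL1D f g : hL1 f -> hL1 g -> hL1 (fun x => f x + g x).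
Proof.
move=> If Ig; rewrite /hL1 (_ : _ \o _ = (EFin \o f) \+ (EFin \o g))%E//.
exact: integrableD.
Qed.

Lemma hL1B f g : hL1 f -> hL1 g -> hL1 (fun x => f x - g x).
Proof.
move=> If Ig; rewrite /hL1 (_ : _ \o _ = (EFin \o f) \- (EFin \o g))%E//.
exact: integrableB.
Qed.

Lemma hL1_norm f : hL1 f -> hL1 (fun x => `|f x|).
Proof. by move=> /integrable_norm. Qed.

Lemma eq_hL1 f g : (forall x : R, 0 < x -> f x = g x) -> hL1 f -> hL1 g.
Proof.
move=> fg; apply: eq_integrable => // x; rewrite halflineP => /fg /= ->//.
Qed.

Lemma eq_hint f g : (forall x : R, 0 < x -> f x = g x) ->
  \int[mu]_(x in H) f x = \int[mu]_(x in H) g x.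
Proof. by move=> fg; apply: eq_Rintegral => x; rewrite halflineP => /fg. Qed.

Lemma hintE f : hL1 f ->
  (\int[mu]_(x in H) (f x)%:E)%E = (\int[mu]_(x in H) f x)%:E.
Proof.
by move=> If; rewrite /Rintegral fineK//; apply: integrable_fin_num.
Qed.

Lemma hintZ k f : hL1 f -> \int[mu]_(x in H) (k * f x) = k * \int[mu]_(x in H) f x.
Proof. by move=> If; rewrite RintegralZl. Qed.

Lemma hintD f g : hL1 f -> hL1 g ->
  \int[mu]_(x in H) (f x + g x) = \int[mu]_(x in H) f x + \int[mu]_(x in H) g x.
Proof. by move=> If Ig; rewrite RintegralD. Qed.

Lemma hintB f g : hL1 f -> hL1 g ->
  \int[mu]_(x in H) (f x - g x) = \int[mu]_(x in H) f x - \int[mu]_(x in H) g x.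
Proof. by move=> If Ig; rewrite RintegralB. Qed.

Lemma le_hint f g : hL1 f -> hL1 g -> (forall x : R, 0 < x -> f x <= g x) ->
  \int[mu]_(x in H) f x <= \int[mu]_(x in H) g x.
Proof. by move=> If Ig fg; apply: le_Rintegral => // x; rewrite halflineE => /fg. Qed.

Lemma norm_hint f : hL1 f ->
  `|\int[mu]_(x in H) f x| <= \int[mu]_(x in H) `|f x|.
Proof. by move=> If; apply: le_normr_Rintegral. Qed.

Lemma norm_hint_le f g : hL1 f -> hL1 g -> (forall x : R, 0 < x -> `|f x| <= g x) ->
  `|\int[mu]_(x in H) f x| <= \int[mu]_(x in H) g x.
Proof.
move=> If Ig fg; apply: (le_trans (norm_hint If)).
by apply: le_hint => //; exact: hL1_norm.
Qed.

(** Compact exhaustion of the half-line. The offset 2 keeps the end points distinct already at n =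
    0, as the fundamental theorem on a closed interval requires. *)
Let Hn (n : nat) : set R := `[n.+2%:R^-1, n.+2%:R].

Lemma nat2_lt1 n : (n.+2%:R)^-1 < (1 : R).
Proof. by rewrite invf_lt1// ltr1n. Qed.

Lemma Hn_lt n : (n.+2%:R^-1 : R) < n.+2%:R.
Proof. by apply: lt_trans (nat2_lt1 n) _; rewrite ltr1n. Qed.

Lemma nd_Hn : nondecreasing_seq Hn.
Proof.
move=> m n mn; apply/subsetPset => x; rewrite /Hn /= !in_itv/= => /andP[mx xm].
apply/andP; split.
  by apply: le_trans mx; rewrite lef_pV2 ?posrE// ler_nat !ltnS.
by apply: le_trans xm _; rewrite ler_nat !ltnS.
Qed.

Lemma bigcup_Hn : \bigcup_n Hn n = H.
Proof.
apply/seteqP; split => [x [n _]|x].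
  rewrite halflineE /Hn/= in_itv/= => /andP[+ _]; apply: lt_le_trans.
  by rewrite invr_gt0.
rewrite halflineE => x0.
exists (maxn (Num.truncn x) (Num.truncn x^-1)) => //.
rewrite /Hn /= in_itv/=; apply/andP; split.
  rewrite invf_ple ?posrE//; apply: ltW.
  apply: lt_le_trans (truncnS_gt _) _; rewrite ler_nat ltnS.
  by rewrite leqW// leq_maxr.
apply: ltW; apply: lt_le_trans (truncnS_gt _) _; rewrite ler_nat ltnS.
by rewrite leqW// leq_maxl.
Qed.

Lemma cvg_nat2y : (fun n => n.+2%:R : R) @ \oo --> +oo.
Proof.
apply/cvgryPge => M; near=> n.
apply: (@le_trans _ _ n%:R); last by rewrite ler_nat; lia.
by near: n; exact: nbhs_infty_ger.
Unshelve. all: by end_near. Qed.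

Lemma cvg_nat2V : (fun n => n.+2%:R^-1 : R) @ \oo --> (0 : R).
Proof.
apply: (proj2 (@gtr0_cvgV0 R nat \oo _ (fun n => n.+2%:R) _)).
  by apply: nearW => n; rewrite ltr0n.
exact: cvg_nat2y.
Qed.

Lemma FTC_pos f F (a b : R) : 0 < a -> a < b ->
  (forall x : R, 0 < x -> is_derive x 1 F (f x)) ->
  (forall x : R, 0 < x -> {for x, continuous f}) ->
  (\int[mu]_(x in `[a, b]) (f x)%:E)%E = (F b - F a)%:E.
Proof.
move=> a0 ab dF cf.
have cF (x : R) : 0 < x -> {for x, continuous F}.
  move=> x0; apply: differentiable_continuous; apply/derivable1_diffP.
  by case: (dF x x0).
have b0 : 0 < b by exact: lt_trans ab.
rewrite (continuous_FTC2 (F := F))//.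
- apply: continuous_in_subspaceT => x; rewrite inE/= in_itv/= => /andP[ax _].
  by apply: cf; exact: lt_le_trans ax.
- split.
  + move=> x; rewrite in_itv/= => /andP[ax _].
    by case: (dF x (lt_trans a0 ax)).
  + by apply: cvg_at_right_filter; exact: cF.
  + by apply: cvg_at_left_filter; exact: cF.
- move=> x; rewrite in_itv/= => /andP[ax _].
  by rewrite derive1E; case: (dF x (lt_trans a0 ax)).
Qed.

Lemma cvg_FTC F (l0 l1 : R) : F x @[x --> 0^'+] --> l0 -> F x @[x --> +oo] --> l1 ->
  F n.+2%:R - F n.+2%:R^-1 @[n --> \oo] --> l1 - l0.
Proof.
move=> F0 F1; apply: cvgB.
  by move/cvg_pinftyP : F1 => /(_ _ cvg_nat2y).
move/cvg_at_rightP : F0; apply; split; last exact: cvg_nat2V.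
by move=> n; rewrite invr_gt0 ltr0n.
Qed.

(** Integrability is assumed because the integrals over the exhaustion pass to the limit by
    dominated convergence, with the absolute value of [f] as majorant. *)
Lemma hFTC f F (l0 l1 : R) : hL1 f ->
  (forall x : R, 0 < x -> is_derive x 1 F (f x)) ->
  (forall x : R, 0 < x -> {for x, continuous f}) ->
  F x @[x --> 0^'+] --> l0 -> F x @[x --> +oo] --> l1 ->
  \int[mu]_(x in H) f x = l1 - l0.
Proof.
move=> If dF cf F0 F1.
have mf := hL1_meas If.
have mHn n : measurable (Hn n) by exact: measurable_itv.
have HnS n : Hn n `<=` H by rewrite -bigcup_Hn; exact: bigcup_sup.
have [] := @dominated_convergence _ _ _ mu H measurable_halfline
  (fun n x => ((f \_ (Hn n)) x)%:E) (EFin \o f) (fun x => `|f x|%:E).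
- move=> n; apply/measurable_EFinP.
  apply/measurable_restrict => //; first exact: mHn.
  by apply: (measurable_funS _ _ mf) => // x [].
- exact/measurable_EFinP.
- apply: aeW => x Hx.
  have [N _ HN] : (\bigcup_n Hn n) x by rewrite bigcup_Hn.
  apply: cvg_near_cst; exists N => // n /= Nn.
  have /subsetPset/(_ x HN) Hnx := nd_Hn Nn.
  by rewrite patchE mem_set.
- exact: hL1_norm.
- apply: aeW => x n Hx; rewrite lee_fin patchE.
  by case: ifPn => //; rewrite normr0.
move=> _ _ cvgf.
suff : (\int[mu]_(x in H) ((f \_ (Hn n)) x)%:E)%E @[n --> \oo] --> (l1 - l0)%:E.
  move=> cvgF; have := cvg_unique (@ereal_hausdorff R) cvgf cvgF.
  by rewrite /Rintegral => ->.
have -> : (fun n => (\int[mu]_(x in H) ((f \_ (Hn n)) x)%:E)%E) =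
          (fun n => (F n.+2%:R - F n.+2%:R^-1)%:E).
  apply/funext => n.
  have n0 : 0 < n.+2%:R^-1 :> R by rewrite invr_gt0 ltr0n.
  rewrite -(FTC_pos n0 (Hn_lt n) dF cf).
  rewrite [RHS]integral_mkcond [LHS]integral_mkcond; apply: eq_integral => x _.
  rewrite !patchE; case: ifPn => //; case: ifPn => //.
  by move=> xHn /negP[]; apply/mem_set/(HnS n)/set_mem.
by apply: cvg_EFin; [exact: nearW|exact: cvg_FTC].
Qed.

(** A basic source of integrability: over the exhaustion the integrals of the nonnegative [f]
    increase, and as increments of [F] they never exceed 2 M. *)
Lemma hL1_FTC f F (M : R) : (forall x : R, 0 < x -> 0 <= f x) ->
  (forall x : R, 0 < x -> is_derive x 1 F (f x)) ->
  (forall x : R, 0 < x -> {for x, continuous f}) ->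
  (forall x : R, 0 < x -> `|F x| <= M) -> hL1 f.
Proof.
move=> f0 dF cf FM.
have mf := continuous_hmeas cf.
apply/integrableP; split; first exact/measurable_EFinP.
have mHn n : measurable (Hn n) by exact: measurable_itv.
have HnS n : Hn n `<=` H by rewrite -bigcup_Hn; exact: bigcup_sup.
rewrite (_ : integral _ _ _ = (\int[mu]_(x in \bigcup_n Hn n) (f x)%:E)%E); last first.
  rewrite bigcup_Hn; apply: eq_integral => x; rewrite halflineP => x0 /=.
  by rewrite ger0_norm// f0.
have cvgI : (\int[mu]_(x in Hn n) (f x)%:E)%E @[n --> \oo] -->
   (\int[mu]_(x in \bigcup_n Hn n) (f x)%:E)%E.
  apply: ge0_nondecreasing_set_cvg_integral => [||n|n]; [exact: nd_Hn|exact: mHn| |].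
    by apply/measurable_EFinP; exact: (measurable_funS _ (HnS n) mf).
  by move=> x /HnS; rewrite halflineE lee_fin => /f0.
apply: (@le_lt_trans _ _ (M + M)%:E); last exact: ltry.
apply: cvge_le cvgI.
apply: nearW => n.
have n0 : 0 < n.+2%:R^-1 :> R by rewrite invr_gt0 ltr0n.
rewrite (FTC_pos n0 (Hn_lt n) dF cf) lee_fin.
apply: le_trans (ler_norm _) _; apply: le_trans (ler_normB _ _) _.
by apply: lerD; apply: FM => //; rewrite ltr0n.
Qed.

End analysis.

(** * Derivative rules and an integrable envelope *)

Section calculus.
Context {R : realType}.
Notation mu := (@lebesgue_measure R).
Notation H := (@halfline R).
Implicit Types (f g h F G : R -> R) (a b x y : R).

Lemma dC x k : is_derive x (1 : R) (fun=> k : R) 0.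
Proof. exact: is_derive_cst. Qed.

Lemma dI x : is_derive x (1 : R) (fun y : R => y) 1.
Proof. exact: is_derive_id. Qed.

Lemma dD f g x a b : is_derive x (1 : R) f a -> is_derive x (1 : R) g b ->
  is_derive x (1 : R) (fun y => f y + g y) (a + b).
Proof. exact: is_deriveD. Qed.

Lemma dB f g x a b : is_derive x (1 : R) f a -> is_derive x (1 : R) g b ->
  is_derive x (1 : R) (fun y => f y - g y) (a - b).
Proof. exact: is_deriveB. Qed.

Lemma dN f x a : is_derive x (1 : R) f a -> is_derive x (1 : R) (fun y => - f y) (- a).
Proof. exact: is_deriveN. Qed.

Lemma dM f g x a b : is_derive x (1 : R) f a -> is_derive x (1 : R) g b ->
  is_derive x (1 : R) (fun y => f y * g y) (a * g x + f x * b).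
Proof.
move=> df dg; have d := is_deriveM df dg; apply: is_derive_eq d _.
by rewrite /GRing.scale/= addrC mulrC.
Qed.

Lemma dZ f x a k : is_derive x (1 : R) f a -> is_derive x (1 : R) (fun y => k * f y) (k * a).
Proof.
by move=> df; apply: is_derive_eq (dM (dC x k) df) _; rewrite mul0r add0r.
Qed.

Lemma dchain f g x a b : is_derive (g x) (1 : R) f a -> is_derive x (1 : R) g b ->
  is_derive x (1 : R) (fun y => f (g y)) (a * b).
Proof. exact: is_derive1_comp. Qed.

Lemma dexp f x a : is_derive x (1 : R) f a ->
  is_derive x (1 : R) (fun y => expR (f y)) (expR (f x) * a).
Proof. exact: dchain. Qed.

Lemma dcos f x a : is_derive x (1 : R) f a ->
  is_derive x (1 : R) (fun y => cos (f y)) (- sin (f x) * a).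
Proof. exact: dchain. Qed.

Lemma dsin f x a : is_derive x (1 : R) f a ->
  is_derive x (1 : R) (fun y => sin (f y)) (cos (f x) * a).
Proof. exact: dchain. Qed.

Lemma dln f x a : 0 < f x -> is_derive x (1 : R) f a ->
  is_derive x (1 : R) (fun y => ln (f y)) ((f x)^-1 * a).
Proof. by move=> fx0; apply: dchain; exact: is_derive1_ln. Qed.

Lemma dpow p x : 0 < x -> is_derive x (1 : R) (fun y : R => y `^ p) (p * x `^ (p - 1)).
Proof. exact: is_derive1_powR. Qed.

Lemma dV f x a : f x != 0 -> is_derive x (1 : R) f a ->
  is_derive x (1 : R) (fun y => (f y)^-1) (- a / (f x) ^+ 2).
Proof.
move=> fx0 df; have d := is_deriveV fx0 df; apply: is_derive_eq d _.
by rewrite /GRing.scale/= mulNr mulrC mulNr.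
Qed.

Lemma is_derive_continuous f x a : is_derive x (1 : R) f a -> {for x, continuous f}.
Proof.
by case=> dfx _; apply: differentiable_continuous; exact/derivable1_diffP.
Qed.

Lemma powR_le1 x p : 0 < x -> x <= 1 -> 0 <= p -> x `^ p <= 1.
Proof.
by move=> x0 x1 p0; rewrite -(powRr0 x) ger_powR// x0.
Qed.

Lemma powR_ge1 x p : 1 <= x -> 0 <= p -> 1 <= x `^ p.
Proof. by move=> x1 p0; rewrite -(powRr0 x) ler_powR. Qed.

Lemma powRDp x r s : 0 < x -> x `^ (r + s) = x `^ r * x `^ s.
Proof. by move=> x0; rewrite powRD//; apply/implyP => _; rewrite gt_eqF. Qed.

(* Comparable with min(x^(a-1), x^(-a-1)), and with an elementary primitive. *)
Definition env a x : R := x `^ (a - 1) / (1 + x `^ a) ^+ 2.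

Lemma env_ge0 a x : 0 <= env a x.
Proof. by rewrite divr_ge0 ?powR_ge0 ?sqr_ge0. Qed.

Lemma env_cont a x : 0 < x -> {for x, continuous (env a)}.
Proof.
move=> x0; have p0 : 0 < 1 + x `^ a by rewrite ltr_pwDl ?powR_ge0.
apply: is_derive_continuous.
apply: dM; first exact: dpow.
apply: dV; first by rewrite expf_neq0// gt_eqF.
by apply: (dM (f := fun y => 1 + y `^ a)); apply: dD; exact: dpow.
Qed.

Lemma env_hL1 a : 0 < a -> hL1 (env a).
Proof.
move=> a0.
apply: (@hL1_FTC _ (env a) (fun x => a^-1 * (- (1 + x `^ a)^-1)) a^-1).
- by move=> x _; exact: env_ge0.
- move=> x x0; have p0 : 0 < 1 + x `^ a by rewrite ltr_pwDl ?powR_ge0.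
  apply: is_derive_eq.
    apply: dZ; apply: dN; apply: dV; first by rewrite gt_eqF.
    by apply: dD; exact: dpow.
  by rewrite /env; field; rewrite !gt_eqF.
- by move=> x; exact: env_cont.
- move=> x x0; have p0 : 1 <= 1 + x `^ a by rewrite lerDl powR_ge0.
  have a0' : 0 <= a^-1 by rewrite invr_ge0 ltW.
  rewrite normrM normrN (ger0_norm a0') ler_piMr// ger0_norm ?invr_ge0 ?(le_trans _ p0)//.
  by rewrite invf_le1// (lt_le_trans _ p0).
Qed.

Lemma env_ge_left a x : 0 < a -> 0 < x -> x <= 1 -> x `^ (a - 1) <= 4 * env a x.
Proof.
move=> a0 x0 x1; rewrite /env mulrCA ler_peMr ?powR_ge0// ler_pdivlMr; last first.
  by rewrite exprn_gt0// ltr_pwDl ?powR_ge0.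
rewrite mul1r (_ : 4 = 2 ^+ 2); last by rewrite expr2 -natrM.
rewrite ler_sqr ?nnegrE ?addr_ge0 ?powR_ge0//.
by rewrite -[leRHS]/(1 + 1) lerD2l powR_le1// ltW.
Qed.

Lemma env_ge_right a x : 0 < a -> 1 <= x -> x `^ (- a - 1) <= 4 * env a x.
Proof.
move=> a0 x1; have x0 : 0 < x by exact: lt_le_trans x1.
have p0 : 0 < x `^ a by exact: powR_gt0.
have -> : x `^ (- a - 1) = x `^ (a - 1) / (x `^ a) ^+ 2.
  rewrite (_ : - a - 1 = a - 1 - (a + a)); last by ring.
  by rewrite powRDp// powRN (powRDp a a x0) expr2.
rewrite /env mulrCA ler_wpM2l ?powR_ge0//.
rewrite ler_pdivlMr ?exprn_gt0 ?ltr_pwDl ?powR_ge0//.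
rewrite mulrC ler_pdivrMr ?exprn_gt0//.
rewrite (_ : 4 = 2 ^+ 2); last by rewrite expr2 -natrM.
rewrite -exprMn ler_sqr ?nnegrE ?mulr_ge0 ?addr_ge0 ?powR_ge0//.
by have := powR_ge1 x1 (ltW a0); lra.
Qed.

(** Merges separate power bounds near 0 and near infinity into one integrable majorant. The constant
    4 bounds (1 + x^a)^2 for x <= 1 and (1 + x^(-a))^2 for x >= 1. *)
Lemma env_bound a (k x v : R) : 0 < a -> 0 <= k -> 0 < x ->
  (x <= 1 -> `|v| <= k * x `^ (a - 1)) ->
  (1 <= x -> `|v| <= k * x `^ (- a - 1)) -> `|v| <= k * 4 * env a x.
Proof.
move=> a0 k0 x0 vl vr; rewrite -mulrA; have [x1|x1] := leP x 1.
  by apply: le_trans (vl x1) _; rewrite ler_wpM2l// env_ge_left.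
apply: le_trans (vr (ltW x1)) _; rewrite ler_wpM2l// env_ge_right//.
exact: ltW.
Qed.

Lemma pow_expN_bounded m k s : 0 <= m -> 0 < k -> 0 < s ->
  exists2 K : R, 0 < K & forall x, 0 < x -> x `^ m * expR (- (k * x `^ s)) <= K.
Proof.
(* Since s (n + 1) >= m, for x > 1 the power x^m is at most (x^s)^(n+1), which the term of order n +
   1 of the exponential series absorbs. *)
move=> m0 k0 s0; pose n := Num.truncn (m / s).
have mn : m <= s * n.+1%:R by rewrite mulrC -ler_pdivrMr// ltW// truncnS_gt.
have K0 : 0 <= n.+1`!%:R / k ^+ n.+1 by rewrite divr_ge0// exprn_ge0// ltW.
exists (1 + n.+1`!%:R / k ^+ n.+1); first by rewrite ltr_pwDl.
move=> x x0; have p0 : 0 < x `^ s by exact: powR_gt0.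
have [x1|x1] := leP x 1.
  apply: (@le_trans _ _ 1); last by rewrite lerDl.
  rewrite mulr_ile1 ?powR_ge0 ?expR_ge0 ?powR_le1//.
  by rewrite expR_le1 lerNl oppr0 mulr_ge0 ?ltW.
apply: (@le_trans _ _ (n.+1`!%:R / k ^+ n.+1)); last by rewrite lerDr.
rewrite expRN ler_pdivrMr ?expR_gt0//.
apply: (@le_trans _ _ ((x `^ s) ^+ n.+1)).
  by rewrite -powR_mulrn ?powR_ge0// -powRrM ler_powR// ltW.
have kp0 : 0 <= k * x `^ s by rewrite mulr_ge0 ?ltW.
apply: le_trans (_ : n.+1`!%:R / k ^+ n.+1 * (1 + (k * x `^ s) ^+ n.+1 / n.+1`!%:R) <= _).
  rewrite mulrDr exprMn [X in _ <= _ + X](_ : _ = (x `^ s) ^+ n.+1).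
    by rewrite lerDr mulr1.
  field; rewrite pnatr_eq0 -lt0n fact_gt0 expf_neq0// gt_eqF//.
by rewrite ler_wpM2l// expR_ge1Dxn.
Qed.

Lemma gamma_env p k s : 0 < p -> 0 < k -> 0 < s ->
  exists2 K : R, 0 < K &
    forall x, 0 < x -> x `^ (p - 1) * expR (- (k * x `^ s)) <= K * env p x.
Proof.
move=> p0 k0 s0.
have p20 : 0 <= 2 * p by rewrite mulr_ge0// ltW.
(* At infinity x^(p-1) exceeds the envelope by the factor x^(2p), which the exponential absorbs. *)
have [K K0 HK] := pow_expN_bounded p20 k0 s0.
exists ((K + 1) * 4); first by rewrite mulr_gt0// addr_gt0.
move=> x x0; apply: le_trans (ler_norm _) _; apply: env_bound => // [|x1|x1].
- by rewrite addr_ge0// ltW.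
- rewrite ger0_norm ?mulr_ge0 ?powR_ge0 ?expR_ge0// [leRHS]mulrC.
  rewrite ler_wpM2l ?powR_ge0//; apply: (@le_trans _ _ 1); last first.
    by rewrite lerDr ltW.
  by rewrite expR_le1 lerNl oppr0 mulr_ge0 ?powR_ge0 ?ltW.
- rewrite ger0_norm ?mulr_ge0 ?powR_ge0 ?expR_ge0//.
  rewrite (_ : p - 1 = - p - 1 + 2 * p); last by ring.
  rewrite powRDp// -mulrA [leRHS]mulrC ler_wpM2l ?powR_ge0//.
  by apply: le_trans (HK x x0) _; rewrite lerDl.
Qed.

End calculus.

(** * Limits, continuity and derivatives under the integral sign *)

Section under_integral.
Context {R : realType}.
Notation mu := (@lebesgue_measure R).
Notation H := (@halfline R).

Lemma hDCT (f_ : nat -> R -> R) (f g : R -> R) :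
  (forall n, measurable_fun H (f_ n)) ->
  (forall x : R, 0 < x -> f_ n x @[n --> \oo] --> f x) ->
  (forall n (x : R), 0 < x -> `|f_ n x| <= g x) -> hL1 g ->
  \int[mu]_(x in H) f_ n x @[n --> \oo] --> \int[mu]_(x in H) f x.
Proof.
move=> mf_ f_f fg Ig.
have mf : measurable_fun H f.
  apply: (measurable_fun_cvg (h := f_)) => // x.
  by rewrite halflineE; exact: f_f.
have [] := @dominated_convergence _ _ _ mu H (@measurable_halfline R)
  (fun n x => (f_ n x)%:E) (EFin \o f) (fun x => (g x)%:E).
- by move=> n; apply/measurable_EFinP; exact: mf_.
- by apply/measurable_EFinP; exact: mf.
- apply: aeW => x; rewrite halflineE => x0.
  by apply: cvg_EFin; [exact: nearW|exact: f_f].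
- exact: Ig.
- by apply: aeW => x n; rewrite halflineE lee_fin; exact: fg.
move=> If _ cvgf.
by apply: fine_cvg; rewrite -(hintE If).
Qed.

Lemma hcont (f : R -> R -> R) (g : R -> R) (u s0 v : R) : u < s0 < v ->
  (forall s, u < s < v -> measurable_fun H (f s)) ->
  (forall s x, u < s < v -> 0 < x -> {for s, continuous (f ^~ x)}) ->
  (forall s x, u < s < v -> 0 < x -> `|f s x| <= g x) -> hL1 g ->
  {for s0, continuous (fun s => \int[mu]_(x in H) f s x)}.
Proof.
move=> us0v mf cf fg Ig.
apply: (@continuity_under_integral _ _ _ mu f H _ u v _ _ g) => //.
- exact: measurable_halfline.
- move=> s /=; rewrite in_itv/= => us; apply: hL1_le Ig; first exact: mf.
  by move=> x; exact: fg.
- apply: aeW => x; rewrite halflineE => x0 s; rewrite inE/= in_itv/= => us.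
  exact: cf.
- move=> s /=; rewrite in_itv/= => us; apply: aeW => x.
  by rewrite halflineE; exact: fg.
- by rewrite inE/= in_itv.
Qed.

(* Cauchy's theorem for a one-parameter family of contours, in real form:
   when d/ds U = d/dx V, the derivative in s of the integral of U is a boundary term. *)
Lemma contour_shift (U V D : R -> R -> R) (g : R -> R) (a b : R) : a < b ->
  (forall x s : R, 0 < x -> a <= s <= b -> is_derive s 1 (U x) (D x s)) ->
  (forall x s : R, 0 < x -> a < s < b -> is_derive x 1 (V ^~ s) (D x s)) ->
  (forall x s : R, 0 < x -> a < s < b -> {for x, continuous (D ^~ s)}) ->
  (forall s, a <= s <= b -> measurable_fun H (U ^~ s)) ->
  (forall x s : R, 0 < x -> a <= s <= b -> `|U x s| <= g x) ->
  (forall x s : R, 0 < x -> a < s < b -> `|D x s| <= g x) -> hL1 g ->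
  (forall s, a < s < b -> V x s @[x --> 0^'+] --> (0 : R)) ->
  (forall s, a < s < b -> V x s @[x --> +oo] --> (0 : R)) ->
  \int[mu]_(x in H) U x a = \int[mu]_(x in H) U x b.
Proof.
move=> ab dU dV cD mU bU bD Ig V0 V1.
pose F s := \int[mu]_(x in H) U x s.
(* The bounds hold on [a, b] only. Clamping the parameter extends the family continuously to all s,
   which gives continuity of the integral up to both end points, as the mean value theorem
   requires. *)
pose cl (s : R) := Num.max a (Num.min s b).
have clab s : a <= cl s <= b.
  by rewrite /cl le_max lexx/= ge_max ltW//= ge_min lexx orbT.
have clid s : a <= s <= b -> cl s = s.
  by move=> /andP[as_ sb]; rewrite /cl min_l// max_r.
have ccl : continuous cl.
  move=> s; apply: (@continuous_max R R (cst a) (id \min cst b) s).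
    exact: cst_continuous.
  by apply: (@continuous_min R R id (cst b) s); [exact: cvg_id|exact: cst_continuous].
have cUcl x s : 0 < x -> {for s, continuous (fun s => U x (cl s))}.
  move=> x0; apply: continuous_comp; first exact: ccl.
  exact: is_derive_continuous (dU x (cl s) x0 (clab s)).
have cF : {within `[a, b], continuous F}.
  apply: (@subspace_eq_continuous _ _ _ (fun s => F (cl s))).
    by move=> s; rewrite inE/= in_itv/= => /clid ->.
  apply: continuous_subspaceT => s.
  apply: (@hcont (fun s x => U x (cl s)) g (s - 1) s (s + 1)) => //.
  - by apply/andP; split; lra.
  - by move=> t _; exact: mU.
  - by move=> t x _ x0; exact: cUcl.
  - by move=> t x _ x0; exact: bU.
have D1 s x : a < s < b -> 0 < x -> partial1of2 (fun s x => U x s) s x = D x s.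
  move=> /andP[as_ sb] x0; rewrite partial1of2E.
  have sab : a <= s <= b by rewrite !ltW.
  by have [_ <-] := dU x s x0 sab.
have dF s : s \in `]a, b[ -> is_derive s 1 F 0.
  rewrite in_itv/= => sab; have /andP[as_ sb] := sab.
  have Is : `]a, b[%classic s by rewrite /= in_itv/=.
  have IU : forall x, `]a, b[%classic x -> mu.-integrable H (EFin \o U ^~ x).
    move=> t /=; rewrite in_itv/= => /andP[at_ tb]; apply: hL1_le Ig.
      by apply: mU; rewrite !ltW.
    by move=> x x0; apply: bU; rewrite // !ltW.
  have dU1 : forall t x, `]a, b[%classic t -> H x -> derivable (U x) t 1.
    move=> t x /=; rewrite in_itv/= halflineE => /andP[at_ tb] x0.
    have tab : a <= t <= b by rewrite !ltW.
    by have [] := dU x t x0 tab.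
  (* The sign of [g] is known for x > 0 only, hence the absolute value. *)
  have g0 : forall x, 0 <= `|g x| by move=> x; exact: normr_ge0.
  have bD1 t x : `]a, b[%classic t -> H x -> `|partial1of2 (fun s x => U x s) t x| <= `|g x|.
    rewrite /= in_itv/= halflineE => tab x0; rewrite D1//.
    by apply: le_trans (ler_norm _); exact: bD.
  have Ing : mu.-integrable H (EFin \o (fun x => `|g x|)) by exact: hL1_norm.
  have mH := @measurable_halfline R.
  have df := @derivable_under_integral _ _ _ mu (fun s x => U x s) H mH s a b Is IU dU1
    (fun x => `|g x|) g0 Ing bD1.
  have := @differentiation_under_integral _ _ _ mu (fun s x => U x s) H mH s a b Is IU dU1
    (fun x => `|g x|) g0 Ing bD1.
  rewrite (eq_hint (g := D ^~ s)); last by move=> x x0; rewrite D1.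
  have -> : \int[mu]_(x in H) D x s = 0 - 0.
    apply: (@hFTC _ (D ^~ s) (V ^~ s)).
    - apply: hL1_le Ig; last by move=> x x0; exact: bD.
      by apply: continuous_hmeas => x x0; exact: cD.
    - by move=> x x0; exact: dV.
    - by move=> x x0; exact: cD.
    - exact: V0.
    - exact: V1.
  by rewrite subrr derive1E => <-; split.
have [z _] := MVT ab dF cF.
by rewrite mul0r => /eqP; rewrite subr_eq0 => /eqP.
Qed.

End under_integral.

(** * Fubini with a product majorant *)

Section Fubini_halfline.
Context {R : realType}.
Notation mu := (@lebesgue_measure R).
Notation H := (@halfline R).

Lemma measurable_HH1 (f : R -> R) : measurable_fun H f ->
  measurable_fun (H `*` H) (fun z : R * R => f z.1).
Proof.
move=> mf; apply: (measurable_comp (F := H) _ _ mf).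
- exact: measurable_halfline.
- by move=> _ [z [? ?] <-].
- exact: measurable_funTS measurable_fst.
Qed.

Lemma measurable_HH2 (f : R -> R) : measurable_fun H f ->
  measurable_fun (H `*` H) (fun z : R * R => f z.2).
Proof.
move=> mf; apply: (measurable_comp (F := H) _ _ mf).
- exact: measurable_halfline.
- by move=> _ [z [? ?] <-].
- exact: measurable_funTS measurable_snd.
Qed.

(** The majorant g(x) h(y) bounds the iterated integral of the absolute value by a product of two
    finite integrals, so Tonelli's criterion applies. *)
Lemma hFubini (f : R -> R -> R) (g h : R -> R) :
  measurable_fun (H `*` H) (fun z : R * R => f z.1 z.2) ->
  hL1 g -> hL1 h ->
  (forall x y, 0 < x -> 0 < y -> `|f x y| <= g x * h y) ->
  \int[mu]_(x in H) (\int[mu]_(y in H) f x y) =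
  \int[mu]_(y in H) (\int[mu]_(x in H) f x y).
Proof.
move=> mf Ig Ih fgh.
have mH := @measurable_halfline R.
have mHH : measurable (H `*` H : set (R * R)) by exact: measurableX.
pose k (z : R * R) := f z.1 z.2.
(* Extension by zero to the plane, so that slices are total functions and the integrals over the
   plane restrict to the half-lines afterwards. *)
pose F : R * R -> \bar R := fun z => ((k \_ (H `*` H)) z)%:E.
have mF : measurable_fun setT F.
  by apply/measurable_EFinP/(measurable_restrictT _ _).1.
have HHP x y : ((x, y) \in (H `*` H)) = (0 < x) && (0 < y).
  by rewrite in_setX !halflineP.
have g0 x : 0 < x -> 0 <= g x * h 1.
  by move=> x0; apply: le_trans (fgh x 1 x0 ltr01).
have IFx x : 0 < x -> hL1 (f x).
  move=> x0; apply: (@hL1_le _ _ (fun y => g x * h y)); last exact: hL1Z.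
    have mFx : measurable_fun setT (fun y => F (x, y)).
      by apply: (measurableT_comp mF); exact: pair1_measurable.
    apply/measurable_EFinP; apply: (@eq_measurable_fun _ _ _ _ H (fun y => F (x, y))).
      move=> y; rewrite halflineP => y0.
      by rewrite /F patchE HHP x0 y0.
    exact: measurable_funTS.
  by move=> y y0; exact: fgh.
have IFy y : 0 < y -> hL1 (f ^~ y).
  move=> y0; apply: (@hL1_le _ _ (fun x => h y * g x)); last exact: hL1Z.
    have mFy : measurable_fun setT (fun x => F (x, y)).
      by apply: (measurableT_comp mF); exact: pair2_measurable.
    apply/measurable_EFinP; apply: (@eq_measurable_fun _ _ _ _ H (fun x => F (x, y))).
      move=> x; rewrite halflineP => x0.
      by rewrite /F patchE HHP x0 y0.
    exact: measurable_funTS.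
  by move=> x x0; rewrite mulrC; exact: fgh.
have F1 x : (\int[mu]_y F (x, y) = ((fun x => \int[mu]_(y in H) f x y) \_ H x)%:E)%E.
  rewrite patchE halflineP; case: ifPn => x0.
    rewrite -hintE; last exact: IFx.
    rewrite [RHS]integral_mkcond; apply: eq_integral => y _.
    by rewrite /F !patchE HHP halflineP x0/=; case: ifP.
  rewrite integral0_eq// => y _.
  by rewrite /F patchE HHP (negbTE x0).
have F2 y : (\int[mu]_x F (x, y) = ((fun y => \int[mu]_(x in H) f x y) \_ H y)%:E)%E.
  rewrite patchE halflineP; case: ifPn => y0.
    rewrite -(hintE (f := f ^~ y)); last exact: IFy.
    rewrite [RHS]integral_mkcond; apply: eq_integral => x _.
    by rewrite /F !patchE HHP halflineP y0 andbT/=; case: ifP.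
  rewrite integral0_eq// => x _.
  by rewrite /F patchE HHP (negbTE y0) andbF.
have IF : (mu \x mu)%E.-integrable setT F.
  apply/(integrable12ltyP mu mu mF).
  have Inh := hL1_norm Ih.
  set c := \int[mu]_(y in H) `|h y|.
  apply: (@le_lt_trans _ _ (\int[mu]_x (((fun x => c * `|g x|) \_ H) x)%:E)%E).
    apply: ge0_le_integral => //.
    - by move=> x _; exact: integral_ge0.
    - apply: (@measurable_fun_fubini_tonelli_F _ _ _ _ _ mu (fun z => `|F z|%E)) => //.
      exact: measurableT_comp.
    - apply/measurable_EFinP/(measurable_restrictT _ _).1 => //.
      exact: hL1_meas (hL1Z c (hL1_norm Ig)).
    - move=> x _; rewrite patchE halflineP; case: ifPn => x0; last first.
        rewrite integral0_eq// => y _.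
        by rewrite /F patchE HHP (negbTE x0) abse0.
      apply: (@le_trans _ _ (\int[mu]_(y in H) (`|g x| * `|h y|)%:E)%E).
        rewrite [leRHS]integral_mkcond; apply: ge0_le_integral => //.
        - by apply: measurableT_comp => //; apply: (measurableT_comp mF); exact: pair1_measurable.
        - apply/(measurable_restrictT _ _).1 => //; apply/measurable_EFinP.
          exact: hL1_meas (hL1Z `|g x| Inh).
        - move=> y _; rewrite /F !patchE HHP halflineP x0/=; case: ifPn => y0; last first.
            by rewrite /= normr0.
          rewrite lee_fin; apply: le_trans (fgh _ _ x0 y0) _.
          by rewrite -normrM ler_norm.
      rewrite (hintE (hL1Z `|g x| Inh)) RintegralZl//.
      by rewrite mulrC.
  have := hintE (hL1Z c (hL1_norm Ig)).
  rewrite integral_mkcond => /esym.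
  rewrite (_ : (fun x => (c * `|g x|)%:E) \_ H = fun x => (((fun x => c * `|g x|) \_ H) x)%:E).
    by move=> <-; exact: ltry.
  by apply/funext => x; rewrite !patchE; case: ifPn.
have := Fubini IF.
under eq_integral do rewrite F1.
under [in RHS]eq_integral do rewrite F2.
by move=> E; rewrite Rintegral_mkcond [RHS]Rintegral_mkcond; exact: (congr1 fine E).
Qed.

End Fubini_halfline.

(** * Power substitutions *)

Section substitution.
Context {R : realType}.
Notation mu := (@lebesgue_measure R).
Notation H := (@halfline R).

Definition prim (g : R -> R) (x : R) := \int[mu]_(t in `]0, x]) g t.

Lemma prim_hint (g : R -> R) (x : R) :
  prim g x = \int[mu]_(t in H) (g \_ `]0, x]) t.
Proof.
rewrite /prim -[RHS]Rintegral_mkcondr; congr Rintegral.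
by rewrite eqEsubset; split => t /=; rewrite !halflineE/= ?in_itv/=; [move=> /andP[->]|case].
Qed.

Lemma meas_patch_itv (g : R -> R) x : hL1 g -> measurable_fun H (g \_ `]0, x]).
Proof.
move=> Ig; apply/measurable_restrict; [exact: measurable_itv|exact: measurable_halfline|].
by apply: (measurable_funS _ _ (hL1_meas Ig)) => [|t []//]; exact: measurable_halfline.
Qed.

Lemma hL1_patch (g : R -> R) x : hL1 g -> hL1 (g \_ `]0, x]).
Proof.
move=> Ig; apply: (hL1_le (meas_patch_itv x Ig) _ (hL1_norm Ig)) => t t0.
by rewrite patchE; case: ifPn => // _; rewrite normr0.
Qed.

Lemma prim_bound (g : R -> R) x : hL1 g -> `|prim g x| <= \int[mu]_(t in H) `|g t|.
Proof.
move=> Ig; rewrite prim_hint; apply: (norm_hint_le (hL1_patch x Ig) (hL1_norm Ig)) => t t0.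
by rewrite patchE; case: ifPn => // _; rewrite normr0.
Qed.

Lemma is_derive_prim (g : R -> R) x : hL1 g -> 0 < x -> {for x, continuous g} ->
  is_derive x 1 (prim g) (g x).
Proof.
move=> Ig x0 cg.
have xx1 : x < x + 1 by rewrite ltrDl.
have Ig1 : mu.-integrable `]0, (x + 1)] (EFin \o g).
  apply: (integrableS _ _ _ Ig) => //; first exact: measurable_halfline.
  by move=> t /=; rewrite halflineE in_itv/= => /andP[].
have a0 : (BRight 0 < BRight x)%O by rewrite bnd_simp.
have [dF F'] := continuous_FTC1 xx1 Ig1 a0 cg.
by split; [exact: dF|rewrite -derive1E; exact: F'].
Qed.

Lemma prim_cvg0 (g : R -> R) : hL1 g -> prim g x @[x --> 0^'+] --> (0 : R).
Proof.
move=> Ig; apply/cvg_at_rightP => u [u0 cu].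
have -> : (0 : R) = \int[mu]_(t in H) (cst 0 t) by rewrite Rintegral_cst ?mul0r//; exact: measurable_halfline.
under eq_fun do rewrite prim_hint.
apply: (hDCT _ _ _ (hL1_norm Ig)) => [n|x x0|n x x0].
- exact: meas_patch_itv.
- apply: cvg_near_cst.
  near=> n; rewrite patchE ifF//; apply/negbTE/negP; rewrite inE/= in_itv/= x0/= leNgt.
  by apply/negP; rewrite negbK; near: n; exact: (cvgr_lt (0 : R)).
- by rewrite patchE; case: ifPn => // _; rewrite normr0.
Unshelve. all: by end_near. Qed.

Lemma prim_cvgy (g : R -> R) : hL1 g ->
  prim g x @[x --> +oo] --> \int[mu]_(t in H) g t.
Proof.
move=> Ig; apply/cvg_pinftyP => u cu.
under eq_fun do rewrite prim_hint.
apply: (hDCT _ _ _ (hL1_norm Ig)) => [n|x x0|n x x0].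
- exact: meas_patch_itv.
- apply: cvg_near_cst.
  near=> n; rewrite patchE ifT//; rewrite inE/= in_itv/= x0/=.
  by near: n; move/cvgryPge : cu; exact.
- by rewrite patchE; case: ifPn => // _; rewrite normr0.
Unshelve. all: by end_near. Qed.

Lemma powR_anti (p x y : R) : p < 0 -> 0 < x -> x <= y -> y `^ p <= x `^ p.
Proof.
move=> p0 x0 xy; have y0 : 0 < y by exact: lt_le_trans xy.
rewrite -[p]opprK (powRN y) (powRN x) lef_pV2 ?posrE ?powR_gt0//.
by rewrite ge0_ler_powR ?nnegrE ?(ltW x0) ?(ltW y0)// lerNr oppr0 ltW.
Qed.

Lemma powR_anti_lt (p x y : R) : p < 0 -> 0 < x -> x < y -> y `^ p < x `^ p.
Proof.
move=> p0 x0 xy; have y0 : 0 < y by exact: lt_trans xy.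
rewrite -[p]opprK (powRN y) (powRN x) ltf_pV2 ?posrE ?powR_gt0//.
by rewrite gt0_ltr_powR ?nnegrE ?(ltW x0) ?(ltW y0)// ltrNr oppr0.
Qed.

Lemma powRV (p x : R) : p != 0 -> 0 < x -> (x `^ p^-1) `^ p = x.
Proof. by move=> p0 x0; rewrite -powRrM mulVf// powRr1// ltW. Qed.

(** The target is the filter [0^'+] and not a neighbourhood of 0, so that the one-sided limit of
    [prim] at 0 can be composed with it. *)
Lemma pow_cvg00 (k p : R) : 0 < k -> 0 < p -> k * s `^ p @[s --> 0^'+] --> 0^'+.
Proof.
move=> k0 p0 P [e /= e0 He].
have ek0 : 0 < e / k by rewrite divr_gt0.
exists ((e / k) `^ p^-1) => /=; first exact: powR_gt0.
move=> s /=; rewrite sub0r normrN => + s0; rewrite gtr0_norm// => se.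
have sp0 : 0 < k * s `^ p by rewrite mulr_gt0// powR_gt0.
apply: He => //=; rewrite sub0r normrN gtr0_norm//.
rewrite mulrC -ltr_pdivlMr// -[ltRHS](@powRV p) ?gt_eqF//.
by rewrite gt0_ltr_powR ?nnegrE ?powR_ge0// ltW.
Qed.

Lemma pow_cvgyy (k p : R) : 0 < k -> 0 < p -> k * s `^ p @[s --> +oo] --> +oo.
Proof.
move=> k0 p0; apply/cvgryPge => M.
pose M' := Num.max M 1.
have M0 : 0 < M' by rewrite lt_max ltr01 orbT.
have ek0 : 0 < M' / k by rewrite divr_gt0.
near=> s.
apply: (@le_trans _ _ M'); first by rewrite le_max lexx.
rewrite mulrC -ler_pdivrMr// -[leLHS](@powRV p) ?gt_eqF//.
have h : (M' / k) `^ p^-1 <= s by near: s; apply: nbhs_pinfty_ge; rewrite num_real.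
by rewrite ge0_ler_powR ?nnegrE ?powR_ge0// ?ltW// (lt_le_trans _ h)// powR_gt0.
Unshelve. all: by end_near. Qed.

Lemma pow_cvg0y (k p : R) : 0 < k -> p < 0 -> k * s `^ p @[s --> 0^'+] --> +oo.
Proof.
move=> k0 p0; apply/cvgryPge => M.
pose M' := Num.max M 1.
have M0 : 0 < M' by rewrite lt_max ltr01 orbT.
have ek0 : 0 < M' / k by rewrite divr_gt0.
near=> s.
apply: (@le_trans _ _ M'); first by rewrite le_max lexx.
rewrite mulrC -ler_pdivrMr// -[leLHS](@powRV p) ?lt_eqF//.
apply: powR_anti => //.
near: s; apply: nbhs_right_le; exact: powR_gt0.
Unshelve. all: by end_near. Qed.

Lemma pow_cvgy0 (k p : R) : 0 < k -> p < 0 -> k * s `^ p @[s --> +oo] --> 0^'+.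
Proof.
move=> k0 p0 P [e /= e0 He].
have ek0 : 0 < e / k by rewrite divr_gt0.
exists ((e / k) `^ p^-1); split; first by rewrite num_real.
move=> s se; have s0 : 0 < s by apply: lt_trans se; exact: powR_gt0.
have sp0 : 0 < k * s `^ p by rewrite mulr_gt0// powR_gt0.
apply: He => //=; rewrite sub0r normrN gtr0_norm//.
rewrite mulrC -ltr_pdivlMr// -[ltRHS](@powRV p) ?lt_eqF//.
by apply: powR_anti_lt => //; exact: powR_gt0.
Qed.

Section subst.
Variables (g : R -> R) (k p : R).
Hypotheses (k0 : 0 < k) (p0 : p != 0).
Hypothesis cg : forall x : R, 0 < x -> {for x, continuous g}.
Hypothesis Ig : hL1 g.

Let kpow0 (x : R) : 0 < x -> 0 < k * x `^ p.
Proof. by move=> x0; rewrite mulr_gt0// powR_gt0. Qed.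

Lemma cont_subst : forall x : R, 0 < x -> {for x, continuous (fun s => g (k * s `^ p))}.
Proof.
move=> x x0; apply: continuous_comp; last exact/cg/kpow0.
by apply: is_derive_continuous; apply: dZ; exact: dpow.
Qed.

(** The absolute value of the substituted integrand has a bounded primitive, namely the primitive of
    |g| composed with k s^p, up to the sign of p. *)
Lemma hL1_subst : hL1 (fun s => `|p| * k * s `^ (p - 1) * g (k * s `^ p)).
Proof.
have cpw (x : R) : 0 < x -> {for x, continuous (fun s => `|p| * k * s `^ (p - 1))}.
  by move=> x0; apply: is_derive_continuous; apply: dZ; exact: dpow.
have Ia : hL1 (fun s => `|p| * k * s `^ (p - 1) * `|g (k * s `^ p)|).
  apply: (@hL1_FTC _ _ (fun s => Num.sg p * prim (fun x => `|g x|) (k * s `^ p))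
     (\int[mu]_(t in H) `|g t|)).
  - by move=> x x0; rewrite !mulr_ge0 ?powR_ge0// ltW.
  - move=> x x0.
    have d1 : is_derive x 1 (fun s => k * s `^ p) (k * (p * x `^ (p - 1))).
      by apply: dZ; exact: dpow.
    have cn : {for k * x `^ p, continuous (fun x => `|g x|)}.
      by apply: continuous_comp; [exact/cg/kpow0|exact: norm_continuous].
    have d2 := is_derive_prim (hL1_norm Ig) (kpow0 x0) cn.
    apply: is_derive_eq (dZ (Num.sg p) (dchain (g := fun s => k * s `^ p) d2 d1)) _.
    by rewrite (normrEsg p); ring.
  - move=> x x0; apply: continuousM; first exact: cpw.
    by apply: continuous_comp; [exact: cont_subst|exact: norm_continuous].
  - move=> x x0; rewrite normrM normr_sg p0 mul1r.
    apply: le_trans (prim_bound _ (hL1_norm Ig)) _.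
    by rewrite le_eqVlt; apply/orP; left; apply/eqP/eq_hint => t _; rewrite normr_id.
apply: (hL1_le _ _ Ia).
  by apply: continuous_hmeas => x x0; apply: continuousM; [exact: cpw|exact: cont_subst].
move=> x x0; rewrite normrM ger0_norm// !mulr_ge0 ?powR_ge0// ltW//.
Qed.

(** The left-hand side is the total increment of sg(p) prim g (k s^p). For p < 0 the substitution
    exchanges the two ends of the half-line, and the sign restores the orientation. *)
Lemma hint_subst :
  \int[mu]_(s in H) (`|p| * k * s `^ (p - 1) * g (k * s `^ p)) = \int[mu]_(s in H) g s.
Proof.
have cpw (x : R) : 0 < x -> {for x, continuous (fun s => `|p| * k * s `^ (p - 1))}.
  by move=> x0; apply: is_derive_continuous; apply: dZ; exact: dpow.
have dG (x : R) : 0 < x -> is_derive x 1 (fun s => Num.sg p * prim g (k * s `^ p))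
    (`|p| * k * x `^ (p - 1) * g (k * x `^ p)).
  move=> x0.
  have d1 : is_derive x 1 (fun s => k * s `^ p) (k * (p * x `^ (p - 1))).
    by apply: dZ; exact: dpow.
  have d2 := is_derive_prim Ig (kpow0 x0) (cg (kpow0 x0)).
  apply: is_derive_eq (dZ (Num.sg p) (dchain (g := fun s => k * s `^ p) d2 d1)) _.
  by rewrite (normrEsg p); ring.
have cG (x : R) : 0 < x -> {for x, continuous (fun x => `|p| * k * x `^ (p - 1) * g (k * x `^ p))}.
  by move=> x0; apply: continuousM; [exact: cpw|exact: cont_subst].
have [pp|pn|//] := ltgtP p 0; last by move=> pE; move: p0; rewrite pE eqxx.
- rewrite (@hFTC _ _ _ (-1 * \int[mu]_(s in H) g s) (-1 * 0) hL1_subst dG cG).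
  + by ring.
  + rewrite ltr0_sg//; apply: cvgM; first exact: cvg_cst.
    exact: (cvg_comp _ _ (pow_cvg0y k0 pp) (prim_cvgy Ig)).
  + rewrite ltr0_sg//; apply: cvgM; first exact: cvg_cst.
    exact: (cvg_comp _ _ (pow_cvgy0 k0 pp) (prim_cvg0 Ig)).
- rewrite (@hFTC _ _ _ (1 * 0) (1 * \int[mu]_(s in H) g s) hL1_subst dG cG).
  + by ring.
  + rewrite gtr0_sg//; apply: cvgM; first exact: cvg_cst.
    exact: (cvg_comp _ _ (pow_cvg00 k0 pn) (prim_cvg0 Ig)).
  + rewrite gtr0_sg//; apply: cvgM; first exact: cvg_cst.
    exact: (cvg_comp _ _ (pow_cvgyy k0 pn) (prim_cvgy Ig)).
Qed.

End subst.
End substitution.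

(** * Lerch's theorem *)

Section Lerch.
Context {R : realType}.
Notation mu := (@lebesgue_measure R).
Notation H := (@halfline R).

Section vanishing.
Variable g : R -> R.
Hypothesis cg : forall x : R, 0 < x -> {for x, continuous g}.
Hypothesis Ig : forall l : R, 0 < l -> hL1 (fun x => expR (- (l * x)) * g x).
Hypothesis I0 : forall l : R, 0 < l -> \int[mu]_(x in H) (expR (- (l * x)) * g x) = 0.

(** Subtracting the case l + 1 from the case l produces one more factor 1 - exp (- x); the induction
    replaces a binomial expansion. *)
Lemma lerch_bernstein n (l : R) : 0 < l ->
  hL1 (fun x => expR (- (l * x)) * (1 - expR (- x)) ^+ n * g x) /\
  \int[mu]_(x in H) (expR (- (l * x)) * (1 - expR (- x)) ^+ n * g x) = 0.
Proof.
elim: n l => [|n IH] l l0.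
  split.
    by apply: eq_hL1 (Ig l0) => x _; rewrite expr0 mulr1.
  by rewrite -[RHS](I0 l0); apply: eq_hint => x _; rewrite expr0 mulr1.
have l10 : 0 < l + 1 by rewrite addr_gt0.
have [I1 z1] := IH _ l0; have [I2 z2] := IH _ l10.
have E (x : R) : 0 < x ->
    expR (- (l * x)) * (1 - expR (- x)) ^+ n * g x -
    expR (- ((l + 1) * x)) * (1 - expR (- x)) ^+ n * g x =
    expR (- (l * x)) * (1 - expR (- x)) ^+ n.+1 * g x.
  move=> _; rewrite mulrDl mul1r opprD expRD exprS; ring.
split; first by apply: eq_hL1 E _; exact: hL1B.
by rewrite -(eq_hint E) (hintB I1 I2) z1 z2 subrr.
Qed.

(* Laplace's method: the weights (e^{-a x}(1 - e^{-x}))^n concentrate at x0. *)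
Lemma lerch_nonpos (x0 : R) : 0 < x0 -> g x0 <= 0.
Proof.
move=> x00; rewrite leNgt; apply/negP => gx0.
(* The exponent that places the only critical point of [q] at x0: the derivative of [q] vanishes
   where exp (- x) = a / (a + 1). *)
pose a := expR (- x0) / (1 - expR (- x0)).
have e1 : expR (- x0) < 1 by rewrite expR_lt1 oppr_lt0.
have a0 : 0 < a by rewrite divr_gt0 ?expR_gt0// subr_gt0.
pose q (x : R) := expR (- (a * x)) * (1 - expR (- x)).
pose q' (x : R) := expR (- (a * x)) * (- a + (a + 1) * expR (- x)).
have dq (x : R) : is_derive x 1 q (q' x).
  rewrite /q /q'; apply: is_derive_eq.
  by rewrite /GRing.scale/=; ring.
have cq (x : R) : {for x, continuous q} by exact: is_derive_continuous (dq x).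
have q'E (x : R) : q' x = expR (- (a * x)) * ((a + 1) * (expR (- x) - expR (- x0))).
  rewrite /q'; congr (_ * _); rewrite mulrBr addrC; congr (_ - _).
  by rewrite /a; field; rewrite subr_eq0 gt_eqF.
have q_lt (x y : R) : x < y -> exists2 c, x < c < y & q y - q x = q' c * (y - x).
  move=> xy.
  have [c] := @MVT R q q' _ _ xy (fun x _ => dq x) (continuous_subspaceT cq).
  by rewrite in_itv/=; exists c.
have q_inc (x y : R) : x < y -> y <= x0 -> q x < q y.
  move=> xy yx0; have [c /andP[_ cy] E] := q_lt _ _ xy.
  rewrite -subr_gt0 E mulr_gt0 ?subr_gt0// q'E mulr_gt0 ?expR_gt0// mulr_gt0 ?(addr_gt0 a0)//.
  by rewrite subr_gt0 ltr_expR ltrN2 (lt_le_trans cy).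
have q_dec (x y : R) : x < y -> x0 <= x -> q y < q x.
  move=> xy yx0; have [c /andP[cx _] E] := q_lt _ _ xy.
  rewrite -subr_lt0 E nmulr_rlt0 ?subr_gt0// q'E pmulr_rlt0 ?expR_gt0//.
  rewrite pmulr_rlt0 ?addr_gt0//.
  by rewrite subr_lt0 ltr_expR ltrN2 (le_lt_trans yx0).
have q_gt0 (x : R) : 0 < x -> 0 < q x.
  by move=> xx; rewrite mulr_gt0 ?expR_gt0// subr_gt0 expR_lt1 oppr_lt0.
(* One factor exp (- x) stays outside the power, since [g] alone need not be integrable. It accounts
   for the + 1 in the exponent a n + 1 used in [key]. *)
pose w (x : R) := expR (- x) * g x.
have cw : {for x0, continuous w}.
  apply: continuousM; last exact: cg.
  by apply: is_derive_continuous; apply: dexp; apply: dN.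
have w0 : 0 < w x0 by rewrite mulr_gt0 ?expR_gt0.
pose m := w x0 / 2.
have m0 : 0 < m by rewrite divr_gt0.
have mw : m < w x0 by rewrite /m ltr_pdivrMr// ltr_pMr// ltr1n.
have [d0 /= d00 wd0] : \forall x \near x0, m < w x by apply: (cvgr_gt (w x0) cw).
pose d := Num.min d0 x0 / 2.
have mn0 : 0 < Num.min d0 x0 by rewrite lt_min d00.
have mnd : Num.min d0 x0 <= d0 by rewrite ge_min lexx.
have mnx : Num.min d0 x0 <= x0 by rewrite ge_min lexx orbT.
have dmn : d < Num.min d0 x0 by rewrite /d ltr_pdivrMr// ltr_pMr// ltr1n.
have dd0 : d < d0 by exact: lt_le_trans mnd.
have dx0 : d < x0 by exact: lt_le_trans mnx.
have d0' : 0 < d by rewrite divr_gt0// lt_min d00.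
(* [q2] bounds [q] at distance more than d from x0, where the sign of [w] is unknown. The level [q1]
   lies strictly between [q2] and the maximum, and [q] exceeds it on the smaller interval [J]. *)
pose q2 := Num.max (q (x0 - d)) (q (x0 + d)).
have q2q : q2 < q x0.
  by rewrite gt_max q_inc ?q_dec// ?ltrDl ?gtrBl ?lerDl ?gerBl// ltW.
have q20 : 0 < q2 by rewrite lt_max q_gt0// subr_gt0.
pose q1 := (q2 + q x0) / 2.
have /andP[q12 q1q] : q2 < q1 < q x0 by rewrite /q1 !midf_lt.
have q10 : 0 < q1 by exact: lt_trans q12.
have [e0 /= e00 qe0] : \forall x \near x0, q1 < q x by apply: (cvgr_gt (q x0) (cq x0)).
pose e := Num.min (e0 / 2) d.
have e0' : 0 < e by rewrite lt_min d0' divr_gt0.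
have ed : e <= d by rewrite ge_min lexx orbT.
have ee0 : e < e0.
  apply: (@le_lt_trans _ _ (e0 / 2)); first by rewrite ge_min lexx.
  by rewrite ltr_pdivrMr// ltr_pMr// ltr1n.
pose J : set R := `[x0 - e, x0 + e]%classic.
have mJ : measurable J by exact: measurable_itv.
have Iw : hL1 w.
  by apply: eq_hL1 (Ig ltr01) => x _; rewrite mul1r.
have JH : J `<=` H.
  by move=> x; rewrite halflineE /J/= in_itv/= => /andP[+ _]; apply: lt_le_trans; rewrite subr_gt0 (le_lt_trans ed).
have muJ : mu J = (e + e)%:E.
  rewrite /J lebesgue_measure_itv/= lte_fin ifT; last by rewrite ltrBlDr -addrA ltrDl addr_gt0.
  by rewrite -EFinB; congr EFin; ring.
have I1E' : (\int[mu]_(x in H) (\1_J x)%:E = (e + e)%:E)%E.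
  rewrite integral_indic//; last exact: measurable_halfline.
  by rewrite -muJ; congr (mu _); exact: setIidl.
have I1 : hL1 (\1_J : R -> R).
  apply/integrableP; split; first by apply/measurable_EFinP; exact: measurable_indic.
  under eq_integral do rewrite /= ger0_norm ?indicE//.
  by rewrite I1E' ltry.
have I1E : \int[mu]_(x in H) (\1_J x) = e + e by rewrite /Rintegral I1E'.
have qw0 (x : R) : d < `|x - x0| -> 0 < x -> q x <= q2.
  move=> dx x1; rewrite le_max; have [xx0|xx0] := leP x x0.
    rewrite ler0_norm ?subr_le0// opprB ltrBrDr addrC -ltrBrDr in dx.
    by rewrite ltW// q_inc// gerBl ltW.
  rewrite gtr0_norm ?subr_gt0// ltrBrDr addrC in dx.
  by rewrite orbC ltW// q_dec// lerDl ltW.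
(* The integrand q^n w has integral 0. It is at least q1^n m on [J], nonnegative elsewhere within d
   of x0, and at least - q2^n |w| farther away. The resulting inequality fails for large n because
   (q2 / q1)^n tends to 0. *)
have key n : q1 ^+ n * m * (e + e) <= q2 ^+ n * \int[mu]_(x in H) `|w x|.
  have an0 : 0 < a * n%:R + 1 by rewrite ltr_wpDl// mulr_ge0// ltW.
  have [Iqw zqw] := lerch_bernstein n an0.
  rewrite -I1E -(hintZ _ I1) -(hintZ _ (hL1_norm Iw)) -subr_le0.
  rewrite -(hintB (hL1Z _ I1) (hL1Z _ (hL1_norm Iw))).
  rewrite -[leRHS]zqw; apply: le_hint => //.
    by apply: hL1B; [exact: hL1Z I1|exact: hL1Z (hL1_norm Iw)].
  move=> x xx.
  have -> : expR (- ((a * n%:R + 1) * x)) * (1 - expR (- x)) ^+ n * g x = q x ^+ n * w x.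
    rewrite /q /w exprMn -expRM_natr mulrDl mul1r opprD expRD.
    by rewrite (_ : - (a * x) * n%:R = - (a * n%:R * x)); ring.
  have q0 := q_gt0 x xx.
  have q20n : 0 <= q2 ^+ n * `|w x| by rewrite mulr_ge0// exprn_ge0// ltW.
  have [xd|xd] := leP `|x - x0| d.
    have wx : m < w x by apply: wd0 => /=; rewrite distrC; exact: le_lt_trans dd0.
    have qw0' : 0 <= q x ^+ n * w x by rewrite mulr_ge0// ?exprn_ge0// ltW// (lt_trans m0).
    rewrite indicE; case: (boolP (x \in J)) => xJ /=; last first.
      by rewrite mulr0 sub0r; apply: le_trans qw0'; rewrite oppr_le0.
    rewrite mulr1 lerBlDr; apply: (@le_trans _ _ (q x ^+ n * w x)); last by rewrite lerDl.
    apply: ler_pM; [by rewrite exprn_ge0// ltW|exact: ltW| |exact: ltW].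
    apply: lerXn2r; rewrite ?nnegrE ?(ltW q10) ?(ltW q0)//.
    apply: ltW; apply: qe0 => /=; rewrite distrC; apply: le_lt_trans ee0.
    by move: xJ; rewrite inE/J/= in_itv/= ler_distl.
  rewrite indicE memNset ?mulr0 ?sub0r; last first.
    rewrite /J/= in_itv/= -ler_distl => /le_trans/(_ ed).
    by rewrite leNgt xd.
  rewrite lerNl; apply: le_trans (ler_norm _) _.
  rewrite normrN normrM (ger0_norm (exprn_ge0 n (ltW q0))).
  by apply: ler_wpM2r => //; apply: lerXn2r; rewrite ?nnegrE ?qw0 ?(ltW q0) ?(ltW q20).
have r0 : 0 <= q2 / q1 by rewrite divr_ge0 ?ltW.
have r1 : q2 / q1 < 1 by rewrite ltr_pdivrMr// mul1r.
have cr : (q2 / q1) ^+ n * \int[mu]_(x in H) `|w x| @[n --> \oo] --> (0 * \int[mu]_(x in H) `|w x|).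
  by apply: cvgM; [apply: cvg_expr; rewrite ger0_norm|exact: cvg_cst].
rewrite mul0r in cr.
have me0 : 0 < m * (e + e) by rewrite mulr_gt0// addr_gt0.
have [n _ /(_ n (leqnn _))] : \forall n \near \oo, (q2 / q1) ^+ n * \int[mu]_(x in H) `|w x| < m * (e + e).
  exact: (cvgr_lt _ cr).
rewrite /= ltNge => /negP; apply.
have q1n : 0 < q1 ^+ n by rewrite exprn_gt0.
have K := key n; rewrite -mulrA in K.
rewrite -(ler_pM2l q1n) (le_trans K)// mulrA -exprMn mulrCA divff ?gt_eqF//.
by rewrite mulr1.
Qed.
End vanishing.

Lemma lerch (f h : R -> R) :
  (forall x : R, 0 < x -> {for x, continuous f}) ->
  (forall x : R, 0 < x -> {for x, continuous h}) ->
  (forall l : R, 0 < l -> hL1 (fun x => expR (- (l * x)) * f x)) ->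
  (forall l : R, 0 < l -> hL1 (fun x => expR (- (l * x)) * h x)) ->
  (forall l : R, 0 < l -> \int[mu]_(x in H) (expR (- (l * x)) * f x) =
                          \int[mu]_(x in H) (expR (- (l * x)) * h x)) ->
  forall x : R, 0 < x -> f x = h x.
Proof.
move=> cf ch If Ih E.
have le (f1 f2 : R -> R) :
  (forall x : R, 0 < x -> {for x, continuous f1}) ->
  (forall x : R, 0 < x -> {for x, continuous f2}) ->
  (forall l : R, 0 < l -> hL1 (fun x => expR (- (l * x)) * f1 x)) ->
  (forall l : R, 0 < l -> hL1 (fun x => expR (- (l * x)) * f2 x)) ->
  (forall l : R, 0 < l -> \int[mu]_(x in H) (expR (- (l * x)) * f1 x) =
                          \int[mu]_(x in H) (expR (- (l * x)) * f2 x)) ->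
  forall x : R, 0 < x -> f1 x <= f2 x.
  move=> c1 c2 I1 I2 EE x x0; rewrite -subr_le0.
  apply: (@lerch_nonpos (fun x => f1 x - f2 x)) => // [y y0|l l0|l l0].
  - by apply: continuousB; [exact: c1|exact: c2].
  - by apply: eq_hL1 (hL1B (I1 l l0) (I2 l l0)) => y _; rewrite mulrBr.
  - under eq_Rintegral do rewrite mulrBr.
    by rewrite (hintB (I1 l l0) (I2 l l0)) EE ?subrr.
move=> x x0; apply/eqP; rewrite eq_le; apply/andP; split; first exact: le.
by apply: le => // l l0; rewrite E.
Qed.
End Lerch.

(** * Contours *)

Section holomorphic.
Context {R : realType}.
Local Notation Re := complex.Re.
Local Notation Im := complex.Im.
Local Notation normc := ComplexField.Normc.normc.
Local Open Scope complex_scope.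
Implicit Types (W : R -> R -> R[i]) (w z : R[i]).

Lemma cReM z w : Re (z * w) = Re z * Re w - Im z * Im w.
Proof. by case: z w => [a b] [c d]. Qed.

Lemma cImM z w : Im (z * w) = Re z * Im w + Im z * Re w.
Proof. by case: z w => [a b] [c d]. Qed.

Lemma cReD z w : Re (z + w) = Re z + Re w.
Proof. by case: z w => [a b] [c d]. Qed.

Lemma cImD z w : Im (z + w) = Im z + Im w.
Proof. by case: z w => [a b] [c d]. Qed.

Lemma cReN z : Re (- z) = - Re z.
Proof. by case: z. Qed.

Lemma cImN z : Im (- z) = - Im z.
Proof. by case: z. Qed.

Lemma cReV z : Re z^-1 = Re z / (Re z ^+ 2 + Im z ^+ 2).
Proof. by case: z. Qed.

Lemma cImV z : Im z^-1 = - Im z / (Re z ^+ 2 + Im z ^+ 2).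
Proof. by case: z => a b; rewrite /= mulNr. Qed.

Lemma Re_cexp z : Re (cexp z) = expR (Re z) * cos (Im z).
Proof. by rewrite /cexp cReM /= mul0r subr0. Qed.

Lemma Im_cexp z : Im (cexp z) = expR (Re z) * sin (Im z).
Proof. by rewrite /cexp cImM /= mul0r addr0. Qed.

Definition ReImE := (cReM, cImM, cReD, cImD, cReN, cImN, cReV, cImV, Re_cexp, Im_cexp).

Lemma complex_eq z w : Re z = Re w -> Im z = Im w -> z = w.
Proof. by case: z w => [a b] [c d] /= -> ->. Qed.

Lemma cexpD z w : cexp (z + w) = cexp z * cexp w.
Proof.
apply: complex_eq; rewrite !ReImE expRD.
  by rewrite cosD; ring.
by rewrite sinD; ring.
Qed.

Lemma cexp0 : cexp 0 = 1 :> R[i].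
Proof. by apply: complex_eq; rewrite !ReImE /= expR0 ?cos0 ?sin0 mul1r. Qed.

Lemma normc_cexp z : normc (cexp z) = expR (Re z).
Proof.
have -> : cexp z = (expR (Re z) * cos (Im z)) +i* (expR (Re z) * sin (Im z)).
  by apply: complex_eq; rewrite !ReImE.
by rewrite /= !exprMn -mulrDr cos2Dsin2 mulr1 sqrtr_sqr ger0_norm.
Qed.

Lemma normc_ge0 z : 0 <= normc z.
Proof. by case: z => a b; exact: sqrtr_ge0. Qed.

Lemma normcD_le z w : normc (z + w) <= normc z + normc w.
Proof. exact: le_normcD. Qed.

Lemma normcR (k : R) : normc k%:C = `|k|.
Proof. by rewrite /= expr0n addr0 sqrtr_sqr. Qed.

Lemma normRe z : `|Re z| <= normc z.
Proof.
case: z => a b /=; rewrite -(sqrtr_sqr a) ler_wsqrtr//.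
by rewrite lerDl sqr_ge0.
Qed.

Lemma normIm z : `|Im z| <= normc z.
Proof.
case: z => a b /=; rewrite -(sqrtr_sqr b) ler_wsqrtr//.
by rewrite lerDr sqr_ge0.
Qed.

(* Complex differentiability of W(x + i y), through the Cauchy-Riemann equations. *)
Definition holo W (x y : R) w := [/\
  is_derive x (1 : R) (fun t => Re (W t y)) (Re w),
  is_derive x (1 : R) (fun t => Im (W t y)) (Im w),
  is_derive y (1 : R) (fun t => Re (W x t)) (- Im w) &
  is_derive y (1 : R) (fun t => Im (W x t)) (Re w)].

Lemma holo_eq W x y w w' : holo W x y w -> w = w' -> holo W x y w'.
Proof. by move=> ? <-. Qed.

Lemma holo_cst w0 x y : holo (fun _ _ => w0) x y 0.
Proof. by split; apply: is_derive_eq; rewrite /= ?oppr0. Qed.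

Lemma holo_id x y : holo (fun x y => x +i* y) x y 1.
Proof. by split => /=; rewrite ?oppr0; [exact: dI|exact: dC|exact: dC|exact: dI]. Qed.

Lemma holoD W1 W2 x y w1 w2 : holo W1 x y w1 -> holo W2 x y w2 ->
  holo (fun x y => W1 x y + W2 x y) x y (w1 + w2).
Proof.
move=> [a1 b1 c1 d1] [a2 b2 c2 d2]; split; under eq_fun do rewrite !ReImE.
- by apply: is_derive_eq (dD a1 a2) _; rewrite !ReImE.
- by apply: is_derive_eq (dD b1 b2) _; rewrite !ReImE.
- by apply: is_derive_eq (dD c1 c2) _; rewrite !ReImE opprD.
- by apply: is_derive_eq (dD d1 d2) _; rewrite !ReImE.
Qed.

Lemma holoM W1 W2 x y w1 w2 : holo W1 x y w1 -> holo W2 x y w2 ->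
  holo (fun x y => W1 x y * W2 x y) x y (w1 * W2 x y + W1 x y * w2).
Proof.
move=> [a1 b1 c1 d1] [a2 b2 c2 d2]; split; under eq_fun do rewrite !ReImE.
- by apply: is_derive_eq (dB (dM a1 a2) (dM b1 b2)) _; rewrite !ReImE; ring.
- by apply: is_derive_eq (dD (dM a1 b2) (dM b1 a2)) _; rewrite !ReImE; ring.
- by apply: is_derive_eq (dB (dM c1 c2) (dM d1 d2)) _; rewrite !ReImE; ring.
- by apply: is_derive_eq (dD (dM c1 d2) (dM d1 c2)) _; rewrite !ReImE; ring.
Qed.

Lemma holoZ W x y w k : holo W x y w -> holo (fun x y => k * W x y) x y (k * w).
Proof.
by move=> hW; apply: holo_eq (holoM (holo_cst k x y) hW) _; rewrite mul0r add0r.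
Qed.

Lemma holo_exp W x y w : holo W x y w ->
  holo (fun x y => cexp (W x y)) x y (w * cexp (W x y)).
Proof.
move=> [a b c d]; split; under eq_fun do rewrite !ReImE.
- by apply: is_derive_eq (dM (dexp a) (dcos b)) _; rewrite !ReImE; ring.
- by apply: is_derive_eq (dM (dexp a) (dsin b)) _; rewrite !ReImE; ring.
- by apply: is_derive_eq (dM (dexp c) (dcos d)) _; rewrite !ReImE; ring.
- by apply: is_derive_eq (dM (dexp c) (dsin d)) _; rewrite !ReImE; ring.
Qed.

Lemma ReIm_neq0 z : z != 0 -> Re z ^+ 2 + Im z ^+ 2 != 0.
Proof.
case: z => a b; apply: contra; rewrite paddr_eq0 ?sqr_ge0// !sqrf_eq0 /=.
by move=> /andP[/eqP -> /eqP ->].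
Qed.

Lemma holoV W x y w : W x y != 0 -> holo W x y w ->
  holo (fun x y => (W x y)^-1) x y (- w * (W x y)^-1 ^+ 2).
Proof.
move=> /ReIm_neq0 W0 [a b c d]; split; under eq_fun do rewrite !ReImE.
- have N0 := dV (f := fun t => Re (W t y) * Re (W t y) + Im (W t y) * Im (W t y)) W0 (dD (dM a a) (dM b b)).
  apply: is_derive_eq (dM a N0) _.
  by rewrite expr2 !ReImE -!expr2; field.
- have N0 := dV (f := fun t => Re (W t y) * Re (W t y) + Im (W t y) * Im (W t y)) W0 (dD (dM a a) (dM b b)).
  apply: is_derive_eq (dM (dN b) N0) _.
  by rewrite expr2 !ReImE -!expr2; field.
- have N0 := dV (f := fun t => Re (W x t) * Re (W x t) + Im (W x t) * Im (W x t)) W0 (dD (dM c c) (dM d d)).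
  apply: is_derive_eq (dM c N0) _.
  by rewrite expr2 !ReImE -!expr2; field.
- have N0 := dV (f := fun t => Re (W x t) * Re (W x t) + Im (W x t) * Im (W x t)) W0 (dD (dM c c) (dM d d)).
  apply: is_derive_eq (dM (dN d) N0) _.
  by rewrite expr2 !ReImE -!expr2; field.
Qed.

End holomorphic.

(** * Decay at the two ends of the half-line *)

Section decay.
Context {R : realType}.
Notation H := (@halfline R).

Lemma cvg0_le (V : R -> R) (K p : R) : 0 < K -> 0 < p ->
  (forall x, 0 < x -> x <= 1 -> `|V x| <= K * x `^ p) -> V x @[x --> 0^'+] --> (0 : R).
Proof.
move=> K0 p0 bV; apply/cvgr0Pnorm_le => e e0.
have /cvgr0Pnorm_le/(_ _ e0) : K * s `^ p @[s --> 0^'+] --> (0 : R).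
  by apply: cvg_trans (pow_cvg00 K0 p0) _; exact: cvg_within.
move=> h; near=> x.
have x0 : 0 < x by [].
apply: le_trans (bV _ x0 _) _; first by near: x; exact: nbhs_right_le.
apply: le_trans (ler_norm _) _.
by near: x.
Unshelve. all: by end_near. Qed.

Lemma cvgy_le (V : R -> R) (K p : R) : 0 < K -> 0 < p ->
  (forall x, 1 <= x -> `|V x| <= K * x `^ (- p)) -> V x @[x --> +oo] --> (0 : R).
Proof.
move=> K0 p0 bV; apply/cvgr0Pnorm_le => e e0.
have np : - p < 0 by rewrite oppr_lt0.
have /cvgr0Pnorm_le/(_ _ e0) : K * s `^ (- p) @[s --> +oo] --> (0 : R).
  by apply: cvg_trans (pow_cvgy0 K0 np) _; exact: cvg_within.
move=> h; near=> x.
apply: le_trans (bV _ _) _; first by near: x; apply: nbhs_pinfty_ge; rewrite num_real.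
apply: le_trans (ler_norm _) _.
by near: x.
Unshelve. all: by end_near. Qed.

Lemma env_le_left (p x : R) : 0 < x -> env p x <= x `^ (p - 1).
Proof.
move=> x0; rewrite /env ler_pdivrMr ?exprn_gt0 ?ltr_pwDl ?powR_ge0//.
by rewrite ler_peMr ?powR_ge0// exprn_ege1// lerDl powR_ge0.
Qed.

Lemma env_le_right (p x : R) : 0 < x -> env p x <= x `^ (- p - 1).
Proof.
move=> x0; have p0 : 0 < x `^ p by exact: powR_gt0.
rewrite /env ler_pdivrMr ?exprn_gt0 ?ltr_pwDl ?powR_ge0//.
rewrite (_ : p - 1 = - p - 1 + (p + p)); last by ring.
rewrite powRDp// ler_wpM2l ?powR_ge0// powRDp// -expr2.
by rewrite lerXn2r ?nnegrE ?addr_ge0 ?powR_ge0// lerDr.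
Qed.

Lemma gamma_hL1 (p k s : R) : 0 < p -> 0 < k -> 0 < s ->
  hL1 (fun x : R => x `^ (p - 1) * expR (- (k * x `^ s))).
Proof.
move=> p0 k0 s0; have [K K0 HK] := gamma_env p0 k0 s0.
apply: (hL1_le _ _ (hL1Z K (env_hL1 p0))).
  apply: continuous_hmeas => x x0; apply: is_derive_continuous.
  apply: dM; first exact: dpow.
  by apply: dexp; apply: dN; apply: dZ; exact: dpow.
by move=> x x0; rewrite ger0_norm ?HK// mulr_ge0 ?powR_ge0 ?expR_ge0.
Qed.

Lemma expN_hL1 (k s : R) : 0 < k -> 0 < s -> hL1 (fun x : R => expR (- (k * x `^ s))).
Proof.
move=> k0 s0; apply: eq_hL1 (gamma_hL1 ltr01 k0 s0) => x x0.
by rewrite subrr powRr0 mul1r.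
Qed.

End decay.

Section contours.
Context {R : realType}.
Notation mu := (@lebesgue_measure R).
Notation H := (@halfline R).
Local Notation Re := complex.Re.
Local Notation Im := complex.Im.
Local Notation normc := ComplexField.Normc.normc.
Local Open Scope complex_scope.

(* In logarithmic coordinates x + i s = log z the rays arg z = s are horizontal lines. *)
Lemma ray_rotation (W w w' : R -> R -> R[i]) (K p a b : R) : a < b -> 0 < K -> 0 < p ->
  (forall x s, a <= s <= b -> holo W x s (w x s)) ->
  (forall x s, a <= s <= b -> holo w x s (w' x s)) ->
  (forall u s, 0 < u -> a <= s <= b -> normc (W (ln u) s) <= K * (u * env p u)) ->
  (forall u s, 0 < u -> a <= s <= b -> normc (w (ln u) s) <= K * (u * env p u)) ->
  \int[mu]_(u in H) (Im (W (ln u) a) / u) = \int[mu]_(u in H) (Im (W (ln u) b) / u).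
Proof.
move=> ab K0 p0 hW hw bW bw.
have bdiv (v x : R) : 0 < x -> `|v| <= K * (x * env p x) -> `|v / x| <= K * env p x.
  move=> x0 vb; rewrite normrM normfV (gtr0_norm x0) ler_pdivrMr//.
  by apply: le_trans vb _; rewrite -mulrA (mulrC x).
have weak s : a < s < b -> a <= s <= b by move=> /andP[? ?]; rewrite !ltW.
(* In the coordinate x = ln u the measure is dx = du / u. By the Cauchy-Riemann equations the
   derivative of Im W / u in the angle and that of Re W in u are both Re w / u. *)
apply: (@contour_shift _ (fun u s => Im (W (ln u) s) / u) (fun u s => Re (W (ln u) s))
  (fun u s => Re (w (ln u) s) / u) (fun u => K * env p u)) => //.
- move=> x s x0 sab; have [_ _ _ d] := hW (ln x) s sab.
  by apply: is_derive_eq (dM d (dC s x^-1)) _; rewrite mulr0 addr0.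
- move=> x s x0 /weak sab; have [d _ _ _] := hW (ln x) s sab.
  exact: (dchain (g := @ln R) d (is_derive1_ln x0)).
- move=> x s x0 /weak sab; have [d _ _ _] := hw (ln x) s sab.
  have x1 : x != 0 by rewrite gt_eqF.
  exact: is_derive_continuous (dM (dchain (g := @ln R) d (is_derive1_ln x0)) (dV (f := id) x1 (dI x))).
- move=> s sab; apply: continuous_hmeas => x x0; have [_ d _ _] := hW (ln x) s sab.
  have x1 : x != 0 by rewrite gt_eqF.
  exact: is_derive_continuous (dM (dchain (g := @ln R) d (is_derive1_ln x0)) (dV (f := id) x1 (dI x))).
- by move=> x s x0 sab; apply: bdiv => //; apply: le_trans (bW _ _ x0 sab); exact: normIm.
- by move=> x s x0 /weak sab; apply: bdiv => //; apply: le_trans (bw _ _ x0 sab); exact: normRe.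
- exact/hL1Z/env_hL1.
- move=> s /weak sab; apply: (@cvg0_le _ _ K p) => // x x0 _.
  apply: le_trans (normRe _) _; apply: le_trans (bW _ _ x0 sab) _.
  rewrite ler_pM2l// -(mulr_powRB1 (ltW x0) p0) ler_pM2l//.
  exact: env_le_left.
- move=> s /weak sab; apply: (@cvgy_le _ _ K p) => // x x1.
  have x0 : 0 < x by exact: lt_le_trans x1.
  apply: le_trans (normRe _) _; apply: le_trans (bW _ _ x0 sab) _.
  rewrite ler_pM2l// (_ : - p = 1 + (- p - 1)); last by ring.
  rewrite powRDp// powRr1 ?(ltW x0)// ler_pM2l//.
  exact: env_le_right.
Qed.

(** Symmetry is applied to the positive and negative parts, which are nonnegative, continuous and
    even; the point 0 has measure zero. *)
Lemma integral_even (f : R -> R) : continuous f -> (forall x, f (- x) = f x) -> hL1 f ->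
  \int[mu]_(x in [set: R]) f x = 2 * \int[mu]_(x in H) f x.
Proof.
move=> cf ef If.
have Hge (h : R -> R) : continuous h -> (\int[mu]_(x in [set x | (0 <= x)%R]) (h x)%:E =
    \int[mu]_(x in H) (h x)%:E)%E.
  move=> ch; rewrite (_ : [set x | 0 <= x] = `[0, +oo[%classic); last by rewrite set_itvcy.
  rewrite /halfline integral_itv_obnd_cbnd//; apply/measurable_EFinP.
  by apply: continuous_hmeas => x _; exact: ch.
have sym (h : R -> R) : (forall x, 0 <= h x) -> continuous h -> (forall x, h (- x) = h x) ->
    (\int[mu]_x (h x)%:E = 2%:E * \int[mu]_(x in H) (h x)%:E)%E.
  by move=> h0 ch eh; rewrite -Hge//; apply: ge0_symfun_integralT => // x; rewrite /= eh.
pose fp x := Num.max (f x) 0; pose fn x := Num.max (- f x) 0.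
have cfp : continuous fp.
  by move=> x; apply: (@continuous_max R R f (cst 0) x); [exact: cf|exact: cst_continuous].
have cfn : continuous fn.
  move=> x; apply: (@continuous_max R R (fun x => - f x) (cst 0) x).
    by apply: continuousN; exact: cf.
  exact: cst_continuous.
have Ip : hL1 fp.
  apply: (hL1_le _ _ (hL1_norm If)); first by apply: continuous_hmeas => x _; exact: cfp.
  by move=> x _; rewrite /fp; case: (leP (f x) 0) => // _; rewrite normr0.
have In : hL1 fn.
  apply: (hL1_le _ _ (hL1_norm If)); first by apply: continuous_hmeas => x _; exact: cfn.
  by move=> x _; rewrite /fn; case: (leP (- f x) 0) => // _; rewrite ?normrN// normr0.
have fE x : f x = fp x - fn x.
  rewrite /fp /fn; case: (leP (f x) 0) => f0; case: (leP (- f x) 0) => f1; lra.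
have -> : \int[mu]_(x in H) f x = \int[mu]_(x in H) fp x - \int[mu]_(x in H) fn x.
  by rewrite -hintB//; apply: eq_hint => x _.
rewrite {1}/Rintegral integralE.
rewrite (_ : (fun x => (f x)%:E)^\+%E = (fun x => (fp x)%:E)); last first.
  by apply/funext => x; rewrite funeposE /fp EFin_max.
rewrite (_ : (fun x => (f x)%:E)^\-%E = (fun x => (fn x)%:E)); last first.
  by apply/funext => x; rewrite funenegE /fn EFin_max EFinN.
rewrite !sym//; last 4 first.
- by move=> x; rewrite /fn le_max lexx orbT.
- by move=> x; rewrite /fn ef.
- by move=> x; rewrite /fp le_max lexx orbT.
- by move=> x; rewrite /fp ef.
by rewrite (hintE Ip) (hintE In) -!EFinM -EFinB /=; ring.
Qed.

End contours.

(** * The Bromwich line in real coordinates *)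

Section line.
Context {R : realType}.
Notation mu := (@lebesgue_measure R).
Notation H := (@halfline R).
Local Notation Re := complex.Re.
Local Notation Im := complex.Im.
Local Notation normc := ComplexField.Normc.normc.
Local Open Scope complex_scope.
Implicit Types (c y t s al : R) (z : R[i]).

(* The principal logarithm of c + i y for y > 0, in a form which is smooth in c across c = 0. *)
Definition ulog c y : R[i] := (ln (c * c + y * y) / 2) +i* (pi / 2 - atan (c / y)).

Lemma sq_gt0 c y : 0 < y -> 0 < c * c + y * y.
Proof. by move=> y0; rewrite ltr_wpDl ?mulr_gt0// -expr2 sqr_ge0. Qed.

Lemma datan (f : R -> R) x a : is_derive x (1 : R) f a ->
  is_derive x (1 : R) (fun y => atan (f y)) ((1 + f x ^+ 2)^-1 * a).
Proof. by move=> df; apply: (dchain (f := @atan R)) df; exact: is_derive1_atan. Qed.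

Lemma sin_atan x : sin (atan x) = x * cos (atan x) :> R.
Proof.
have c0 : cos (atan x) != 0.
  by rewrite gt_eqF// cos_gt0_pihalf// atan_gtNpi2 atan_ltpi2.
by rewrite -{2}(atanK x) /tan mulfVK.
Qed.

Lemma cexp_ulog c y : 0 < y -> cexp (ulog c y) = c +i* y.
Proof.
move=> y0; have s0 := sq_gt0 c y0.
set r := Num.sqrt (c * c + y * y).
have r0 : 0 < r by rewrite sqrtr_gt0.
have er : expR (ln (c * c + y * y) / 2) = r.
  rewrite /r -powR12_sqrt ?ltW// /powR gt_eqF//; congr expR.
  by rewrite mulrC.
have ca : cos (atan (c / y)) = y / r.
  rewrite cos_atan (_ : 1 + (c / y) ^+ 2 = (r / y) ^+ 2); last first.
    by rewrite !exprMn sqr_sqrtr ?ltW// -!expr2; field; rewrite gt_eqF.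
  by rewrite sqrtr_sqr ger0_norm ?divr_ge0 ?ltW// invf_div.
apply: complex_eq; rewrite !ReImE /= er.
  rewrite cosB cos_pihalf sin_pihalf mul0r add0r mul1r sin_atan ca.
  by field; rewrite !gt_eqF.
rewrite sinB cos_pihalf sin_pihalf mul1r mul0r subr0 ca.
by field; rewrite !gt_eqF.
Qed.

Lemma holo_ulog c y : 0 < y -> holo ulog c y (c +i* y)^-1.
Proof.
move=> y0; have s0 := sq_gt0 c y0.
have y1 : y != 0 by rewrite gt_eqF.
have s1 : c * c + y * y != 0 by rewrite gt_eqF.
have s2 : c ^+ 2 + y ^+ 2 != 0 by rewrite !expr2.
have s3 : 1 + (c / y) ^+ 2 != 0.
  by rewrite gt_eqF// ltr_pwDl// sqr_ge0.
split; rewrite /ulog /=.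
- apply: is_derive_eq (dM (dln (f := fun t => t * t + y * y) s0
    (dD (dM (dI c) (dI c)) (dC c (y * y)))) (dC c 2^-1)) _.
  by rewrite /=; field; rewrite s1.
- apply: is_derive_eq (dB (dC c (pi / 2)) (datan (dM (dI c) (dC c y^-1)))) _.
  by rewrite /=; field; rewrite ?s2 ?y1 ?s3.
- apply: is_derive_eq (dM (dln (f := fun t => c * c + t * t) s0
    (dD (dC y (c * c)) (dM (dI y) (dI y)))) (dC y 2^-1)) _.
  by rewrite /=; field; rewrite s1.
- apply: is_derive_eq (dB (dC y (pi / 2)) (datan (dM (dC y c) (dV (f := id) y1 (dI y))))) _.
  by rewrite /=; field; rewrite ?s2 ?y1 ?s3.
Qed.

Lemma Im_ulog_itv c y : 0 <= c -> 0 < y -> 0 < Im (ulog c y) <= pi / 2.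
Proof.
move=> c0 y0 /=; rewrite subr_gt0 atan_ltpi2 /= gerBl.
by rewrite -atan0 le_atan// divr_ge0// ltW.
Qed.

Lemma expR_ulog c y p : 0 < y -> expR (p * Re (ulog c y)) = (c * c + y * y) `^ (p / 2).
Proof.
by move=> y0; rewrite /powR gt_eqF ?sq_gt0//=; congr expR; ring.
Qed.

Lemma sq_powR y p : 0 < y -> (y * y) `^ (p / 2) = y `^ p.
Proof.
move=> y0; rewrite powRM ?ltW// -powRDp//; congr (_ `^ _).
by field.
Qed.

Lemma expR_ulog_ge c y p : 0 < y -> 0 <= p -> y `^ p <= expR (p * Re (ulog c y)).
Proof.
move=> y0 p0; rewrite expR_ulog// -sq_powR// ge0_ler_powR ?divr_ge0 ?nnegrE//.
- by rewrite mulr_ge0 ?ltW.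
- by rewrite ltW ?sq_gt0.
- by rewrite lerDr -expr2 sqr_ge0.
Qed.

Lemma expR_ulog_le c y p : 0 < y -> p < 0 -> expR (p * Re (ulog c y)) <= y `^ p.
Proof.
move=> y0 p0; rewrite expR_ulog// -(sq_powR p y0).
by apply: powR_anti; rewrite ?mulr_gt0 ?pmulr_llt0// lerDr -expr2 sqr_ge0.
Qed.

Lemma cos_alpha_gt0 al : 0 < al < 1 -> 0 < cos (al * (pi / 2)) :> R.
Proof.
move=> /andP[a0 a1]; have p0 : 0 < pi / 2 :> R by rewrite divr_gt0 ?pi_gt0.
apply: cos_gt0_pihalf; apply/andP; split.
  by apply: lt_trans (mulr_gt0 a0 p0); rewrite oppr_lt0.
by rewrite gtr_pMl.
Qed.

Lemma cos_le_alpha al s : 0 < al < 1 -> 0 <= s <= pi / 2 ->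
  cos (al * (pi / 2)) <= cos (al * s) :> R.
Proof.
move=> /andP[a0 a1] /andP[s0 s1]; have p0 : 0 < pi / 2 :> R by rewrite divr_gt0 ?pi_gt0.
have p1 : al * (pi / 2) <= pi.
  apply: (@le_trans _ _ (pi / 2)); first by rewrite ger_pMl// ltW.
  by rewrite ger_pMr ?pi_gt0// invf_le1 ?ler1n.
have [|] := ltP s (pi / 2) => [s2|s2]; last first.
  by have -> : s = pi / 2 by apply/eqP; rewrite eq_le s1 s2.
rewrite ltW// ltr_cos ?in_itv/=.
- by rewrite ltr_pM2l.
- by rewrite mulr_ge0 ?(ltW a0)//=; apply: le_trans p1; rewrite ler_pM2l.
- by rewrite p1 mulr_ge0 ?(ltW p0) ?(ltW a0).
Qed.

(** The Levy integrand exp (s z - t z^al) on the upper half of the line, written with [ulog] so that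
    c = 0 is allowed. *)
Definition Fline al t s c y : R[i] :=
  cexp (s%:C * (c +i* y) + (- t)%:C * cexp (al%:C * ulog c y)).

Lemma cexp_ulogV al c y : 0 < y ->
  (c +i* y)^-1 * cexp (al%:C * ulog c y) = cexp ((al - 1)%:C * ulog c y).
Proof.
move=> y0; have c1 : c +i* y != 0 by rewrite eq_complex /= (gt_eqF y0) andbF.
have -> : al%:C * ulog c y = (al - 1)%:C * ulog c y + ulog c y.
  by rewrite rmorphB rmorph1; ring.
by rewrite cexpD (cexp_ulog _ y0) mulrCA mulVf// mulr1.
Qed.

Definition dFline al t s c y : R[i] :=
  (s%:C + (- t)%:C * (al%:C * (c +i* y)^-1 * cexp (al%:C * ulog c y))) * Fline al t s c y.

Lemma holo_Fline al t s c y : 0 < y -> holo (Fline al t s) c y (dFline al t s c y).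
Proof.
move=> y0; apply: holo_eq (holo_exp (holoD (holoZ s%:C (holo_id c y))
  (holoZ (- t)%:C (holo_exp (holoZ al%:C (holo_ulog c y0)))))) _.
by rewrite mulr1.
Qed.

(** The real part of z^al is |z|^al cos (al arg z), with |z| >= y and arg z at most pi / 2. The
    decay rate therefore does not depend on c, and this uniformity is what lets the line move. *)
Lemma normc_Fline al t s c y : 0 < al < 1 -> 0 < t -> 0 <= c -> 0 < y ->
  normc (Fline al t s c y) <=
  expR (s * c) * expR (- (t * cos (al * (pi / 2)) * y `^ al)).
Proof.
move=> al01 t0 c0 y0; rewrite normc_cexp -expRD ler_expR !ReImE /= !mul0r !subr0.
rewrite addr0 lerD2l mulNr lerN2 -mulrA ler_pM2l// [leLHS]mulrC.
have /andP[q0 q1] := Im_ulog_itv c0 y0.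
apply: ler_pM; rewrite ?powR_ge0 ?(ltW (cos_alpha_gt0 al01))//.
  by apply: expR_ulog_ge => //; case/andP: al01 => /ltW.
by apply: cos_le_alpha => //; rewrite (ltW q0).
Qed.

Lemma normc_dFline al t s c y : 0 < al < 1 -> 0 < t -> 0 <= c -> 0 < y ->
  normc (dFline al t s c y) <= (`|s| + t * al * y `^ (al - 1)) *
  (expR (s * c) * expR (- (t * cos (al * (pi / 2)) * y `^ al))).
Proof.
move=> al01 t0 c0 y0; have /andP[a0 a1] := al01.
rewrite /dFline ComplexField.Normc.normcM ler_pM ?normc_ge0 ?normc_Fline//.
apply: le_trans (normcD_le _ _) _; rewrite normcR lerD2l.
rewrite -mulrA (cexp_ulogV _ _ y0) ComplexField.Normc.normcM normcR normrN (gtr0_norm t0).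
rewrite -mulrA ler_pM2l// ComplexField.Normc.normcM normcR (gtr0_norm a0) ler_pM2l//.
rewrite normc_cexp cReM /= mul0r subr0.
by apply: expR_ulog_le; rewrite // subr_lt0.
Qed.

Lemma expN_decay (k p : R) : 0 < k -> 0 < p ->
  exists2 K : R, 0 < K & forall x, 0 < x -> expR (- (k * x `^ p)) <= K * x `^ (- 1).
Proof.
move=> k0 p0; have [K K0 HK] := pow_expN_bounded ler01 k0 p0.
exists K => // x x0; rewrite powRN powRr1 ?(ltW x0)// ler_pdivlMr// mulrC.
by have := HK x x0; rewrite powRr1 ?(ltW x0).
Qed.

(** One majorant for the strip 0 <= c <= C: the leading 1 takes care of [Fline], the other two terms
    of its derivative. *)
Definition Fline_bound al t s C y : R :=
  (1 + `|s| + t * al * y `^ (al - 1)) *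
  (expR (`|s| * C) * expR (- (t * cos (al * (pi / 2)) * y `^ al))).

Lemma Fline_bound_hL1 al t s C : 0 < al < 1 -> 0 < t -> hL1 (Fline_bound al t s C).
Proof.
move=> al01 t0; have /andP[a0 _] := al01.
have k0 : 0 < t * cos (al * (pi / 2)) by rewrite mulr_gt0// cos_alpha_gt0.
apply: eq_hL1 (hL1D (hL1Z ((1 + `|s|) * expR (`|s| * C)) (expN_hL1 k0 a0))
  (hL1Z (t * al * expR (`|s| * C)) (gamma_hL1 a0 k0 a0))) => x x0.
by rewrite /Fline_bound; ring.
Qed.

Lemma expR_sC s c C : 0 <= c <= C -> expR (s * c) <= expR (`|s| * C).
Proof.
move=> /andP[c0 cC]; rewrite ler_expR; apply: (@le_trans _ _ (`|s| * c)).
  by rewrite ler_wpM2r// ler_norm.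
by rewrite ler_wpM2l.
Qed.

Lemma Fline_dom al t s c C y : 0 < al < 1 -> 0 < t -> 0 <= c <= C -> 0 < y ->
  normc (Fline al t s c y) <= Fline_bound al t s C y.
Proof.
move=> al01 t0 cC y0; have /andP[c0 _] := cC; have /andP[a0 _] := al01.
apply: le_trans (normc_Fline s al01 t0 c0 y0) _.
rewrite /Fline_bound; apply: (@le_trans _ _ (1 * (expR (`|s| * C) *
    expR (- (t * cos (al * (pi / 2)) * y `^ al))))).
  by rewrite mul1r ler_wpM2r ?expR_ge0// expR_sC.
rewrite ler_wpM2r ?mulr_ge0 ?expR_ge0// -addrA lerDl addr_ge0//.
by rewrite !mulr_ge0 ?powR_ge0// ltW.
Qed.

Lemma dFline_dom al t s c C y : 0 < al < 1 -> 0 < t -> 0 <= c <= C -> 0 < y ->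
  normc (dFline al t s c y) <= Fline_bound al t s C y.
Proof.
move=> al01 t0 cC y0; have /andP[c0 _] := cC; have /andP[a0 _] := al01.
apply: le_trans (normc_dFline s al01 t0 c0 y0) _.
have p0 : 0 <= t * al * y `^ (al - 1) by rewrite !mulr_ge0 ?powR_ge0// ltW.
apply: ler_pM; rewrite ?mulr_ge0 ?addr_ge0 ?expR_ge0//.
  by rewrite lerD2r lerDr.
by rewrite ler_wpM2r ?expR_ge0// expR_sC.
Qed.

(** The derivative of exp (s z - t z^al) combines the Levy integrand, with weight s, and the
    Mainardi integrand, with weight - t al; that it integrates to 0 is the link between the
    kernels. *)
Lemma Re_dFline al t s c y : 0 < y -> Re (dFline al t s c y) =
  s * Re (Fline al t s c y) - t * al * Re (cexp ((al - 1)%:C * ulog c y) * Fline al t s c y).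
Proof.
move=> y0; rewrite /dFline -[_ * _ * cexp (al%:C * _)]mulrA (cexp_ulogV _ _ y0).
by move: (cexp _) (Fline _ _ _ _ _) => [a b] [a' b'] /=; ring.
Qed.

Lemma cont_Re_Fline al t s c y : 0 < y -> {for y, continuous (fun y => Re (Fline al t s c y))}.
Proof. by move=> /(holo_Fline al t s c)[_ _ d _]; exact: is_derive_continuous d. Qed.

Lemma holo_dFline al t s c y : 0 < y -> exists w, holo (dFline al t s) c y w.
Proof.
move=> y0; have c1 : c +i* y != 0 by rewrite eq_complex /= (gt_eqF y0) andbF.
eexists; apply: (holoM (W2 := Fline al t s)); last exact: holo_Fline.
apply: (holoD (holo_cst s%:C c y)); apply: (holoZ (- t)%:C).
apply: (holoM (W1 := fun c y => al%:C * (c +i* y)^-1)).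
  by apply: (holoZ al%:C); exact: holoV c1 (holo_id c y).
exact: holo_exp (holoZ al%:C (holo_ulog c y0)).
Qed.

Lemma cont_Re_dFline al t s c y : 0 < y -> {for y, continuous (fun y => Re (dFline al t s c y))}.
Proof. by move=> /(holo_dFline al t s c)[w [_ _ d _]]; exact: is_derive_continuous d. Qed.

Lemma hL1_Fline al t s c : 0 < al < 1 -> 0 < t -> 0 <= c -> hL1 (fun y => Re (Fline al t s c y)).
Proof.
move=> al01 t0 c0; apply: (hL1_le _ _ (Fline_bound_hL1 s c al01 t0)).
  by apply: continuous_hmeas => y; exact: cont_Re_Fline.
move=> y y0; apply: le_trans (normRe _) _; apply: Fline_dom => //.
by rewrite c0 lexx.
Qed.

Lemma hL1_dFline al t s c : 0 < al < 1 -> 0 < t -> 0 <= c -> hL1 (fun y => Re (dFline al t s c y)).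
Proof.
move=> al01 t0 c0; apply: (hL1_le _ _ (Fline_bound_hL1 s c al01 t0)).
  by apply: continuous_hmeas => y; exact: cont_Re_dFline.
move=> y y0; apply: le_trans (normRe _) _; apply: dFline_dom => //.
by rewrite c0 lexx.
Qed.

Lemma cvgy_Im_Fline al t s c : 0 < al < 1 -> 0 < t -> 0 <= c ->
  Im (Fline al t s c y) @[y --> +oo] --> (0 : R).
Proof.
move=> al01 t0 c0; have /andP[a0 _] := al01.
have k0 : 0 < t * cos (al * (pi / 2)) by rewrite mulr_gt0// cos_alpha_gt0.
have [K K0 HK] := expN_decay k0 a0.
apply: (@cvgy_le _ _ (expR (s * c) * K) 1) => //; first by rewrite mulr_gt0 ?expR_gt0.
move=> x x1; have x0 : 0 < x by exact: lt_le_trans x1.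
apply: le_trans (normIm _) _; apply: le_trans (normc_Fline s al01 t0 c0 x0) _.
by rewrite -[leRHS]mulrA ler_pM2l ?expR_gt0// HK.
Qed.

(** The principal logarithm for c > 0 and y of either sign: smooth across y = 0, whereas [ulog] is
    smooth across c = 0. *)
Definition llog c y : R[i] := (ln (c * c + y * y) / 2) +i* atan (y / c).

Lemma clogE c y : 0 < c -> clog (c +i* y) = llog c y.
Proof.
move=> c0; have s0 : 0 < c * c + y * y by rewrite ltr_pwDl ?mulr_gt0// -expr2 sqr_ge0.
rewrite /clog /llog /carg /= -!expr2; rewrite !expr2.
congr (_ +i* _).
  by rewrite -powR12_sqrt ?(ltW s0)// ln_powR mulrC.
have -> : c / Num.sqrt (c * c + y * y) = cos (atan (y / c)).
  rewrite cos_atan (_ : c * c + y * y = c ^+ 2 * (1 + (y / c) ^+ 2)); last first.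
    by field; rewrite gt_eqF.
  rewrite sqrtrM ?sqr_ge0// sqrtr_sqr gtr0_norm// invfM mulrA divff ?gt_eqF// mul1r//.
case: ifPn => y0.
  rewrite cosK// in_itv/= -{1}atan0 le_atan ?divr_ge0 ?(ltW c0)//=.
  rewrite (le_trans (ltW (atan_ltpi2 _)))// ger_pMr ?pi_gt0// invf_le1 ?ler1n//.
rewrite -ltNge in y0; rewrite cosKN ?opprK//; apply/andP; split.
  rewrite (le_trans _ (ltW (atan_gtNpi2 _)))// lerN2.
  by rewrite ger_pMr ?pi_gt0// invf_le1 ?ler1n.
by rewrite -atan0 le_atan// pmulr_lle0 ?invr_gt0// ltW.
Qed.

Lemma llog_ulog c y : 0 < c -> 0 < y -> llog c y = ulog c y.
Proof.
move=> c0 y0; rewrite /llog /ulog; congr (_ +i* _).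
have p2 : 0 < pi / 2 :> R by rewrite divr_gt0 ?pi_gt0.
have a0 : 0 < atan (c / y) by rewrite -atan0 lt_atan// divr_gt0.
have -> : y / c = tan (pi / 2 - atan (c / y)).
  have ca : cos (atan (c / y)) != 0.
    by rewrite gt_eqF// cos_gt0_pihalf// atan_gtNpi2 atan_ltpi2.
  rewrite /tan sinB cosB cos_pihalf sin_pihalf !mul1r !mul0r subr0 add0r sin_atan.
  by field; rewrite ca !gt_eqF.
rewrite tanK// in_itv/=; apply/andP; split; last by rewrite gtrBl.
by apply: (@lt_trans _ _ 0); rewrite ?oppr_lt0// subr_gt0 atan_ltpi2.
Qed.

Lemma Re_bromwich c (F : R[i] -> R[i]) :
  Re (bromwich c F) = (2 * pi)^-1 * \int[mu]_(y in [set: R]) Re (F (c +i* y)).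
Proof.
rewrite /bromwich /cintegral cReM cReV cImV /= !expr0n/= add0r !mul0r sub0r.
rewrite (_ : (fun y => Im _) = (fun y => Re (F (c +i* y)))); last first.
  by apply/funext => y; rewrite cImM /= mulr1 mulr0 addr0.
rewrite mulNr mulNr opprK; congr (_ * _).
by rewrite expr2 invfM mulrA divff ?mul1r// gt_eqF// mulr_gt0 ?pi_gt0.
Qed.

Definition ccont (f : R -> R[i]) := continuous (fun y => Re (f y)) /\ continuous (fun y => Im (f y)).

Lemma ccontD f g : ccont f -> ccont g -> ccont (fun y => f y + g y).
Proof.
move=> [f1 f2] [g1 g2]; split => y; under eq_fun do rewrite !ReImE.
  by apply: continuousD; [exact: f1|exact: g1].
by apply: continuousD; [exact: f2|exact: g2].
Qed.

Lemma ccontM f g : ccont f -> ccont g -> ccont (fun y => f y * g y).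
Proof.
move=> [f1 f2] [g1 g2]; split => y; under eq_fun do rewrite !ReImE.
  by apply: cvgB; apply: cvgM; [exact: f1|exact: g1|exact: f2|exact: g2].
by apply: cvgD; apply: cvgM; [exact: f1|exact: g2|exact: f2|exact: g1].
Qed.

Lemma ccont_cst k : ccont (fun=> k).
Proof. by split => y; exact: cst_continuous. Qed.

Lemma ccont_cexp f : ccont f -> ccont (fun y => cexp (f y)).
Proof.
move=> [f1 f2]; split => y; under eq_fun do rewrite !ReImE.
  apply: cvgM; first exact: (cvg_comp _ _ (f1 y) (@continuous_expR R _)).
  exact: (cvg_comp _ _ (f2 y) (@continuous_cos R _)).
apply: cvgM; first exact: (cvg_comp _ _ (f1 y) (@continuous_expR R _)).
exact: (cvg_comp _ _ (f2 y) (@continuous_sin R _)).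
Qed.

Lemma ccont_id c : ccont (fun y => c +i* y).
Proof. by split => y /=; [exact: cst_continuous|exact: cvg_id]. Qed.

Lemma ccont_llog c : 0 < c -> ccont (llog c).
Proof.
move=> c0; have s0 y : 0 < c * c + y * y by rewrite ltr_pwDl ?mulr_gt0// -expr2 sqr_ge0.
split => y /=; last exact: is_derive_continuous (datan (dM (dI y) (dC y c^-1))).
exact: is_derive_continuous (dM (dln (f := fun t => c * c + t * t) (s0 y)
  (dD (dC y (c * c)) (dM (dI y) (dI y)))) (dC y 2^-1)).
Qed.

Definition cconj (f : R -> R[i]) := forall y, f (- y) = conjc (f y).

Lemma Re_conj z : Re (conjc z) = Re z. Proof. by case: z. Qed.

Lemma Im_conj z : Im (conjc z) = - Im z. Proof. by case: z. Qed.

Lemma cexp_conj z : cexp (conjc z) = conjc (cexp z).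
Proof.
by apply: complex_eq; rewrite ?Re_conj ?Im_conj !ReImE Re_conj Im_conj ?cosN ?sinN ?mulrN.
Qed.

Lemma conj_llog c : cconj (llog c).
Proof. by move=> y; rewrite /llog /= mulrNN mulNr atanN. Qed.

(* Agrees with Fline for y > 0, but is smooth in y across 0 when c > 0. *)
Definition Gline al t s c y : R[i] :=
  cexp (s%:C * (c +i* y) + (- t)%:C * cexp (al%:C * llog c y)).

Lemma Gline_Fline al t s c y : 0 < c -> 0 < y -> Gline al t s c y = Fline al t s c y.
Proof. by move=> c0 y0; rewrite /Gline llog_ulog. Qed.

Lemma ccont_Gline al t s c : 0 < c -> ccont (Gline al t s c).
Proof.
move=> c0; apply: ccont_cexp; apply: ccontD; apply: ccontM; try exact: ccont_cst.
  exact: ccont_id.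
by apply: ccont_cexp; apply: ccontM; [exact: ccont_cst|exact: ccont_llog].
Qed.

Lemma conj_Gline al t s c : cconj (Gline al t s c).
Proof.
move=> y; rewrite /Gline conj_llog.
have -> : al%:C * conjc (llog c y) = conjc (al%:C * llog c y).
  by rewrite rmorphM/= oppr0.
rewrite cexp_conj -[RHS]cexp_conj; congr cexp.
by rewrite rmorphD !rmorphM/= !oppr0.
Qed.

(** By conjugation symmetry the integrand is real on the real axis, so the boundary term at y = 0
    vanishes. *)
Lemma cvg0_Im_Fline al t s c : 0 < c -> Im (Fline al t s c y) @[y --> 0^'+] --> (0 : R).
Proof.
move=> c0.
have G0 : Im (Gline al t s c 0) = 0.
  have := congr1 (@Im R) (conj_Gline al t s c 0); rewrite oppr0 Im_conj => /eqP.
  by rewrite -subr_eq0 opprK -mulr2n mulrn_eq0 => /eqP.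
have [_ cG] := ccont_Gline al t s c0.
have : Im (Gline al t s c y) @[y --> 0^'+] --> (0 : R).
  by rewrite -{2}G0; apply: cvg_at_right_filter; exact: cG.
apply: cvg_trans; apply: near_eq_cvg; near=> y.
by rewrite Gline_Fline.
Unshelve. all: by end_near. Qed.

Lemma levyE c al t s : 0 < c -> 0 < al < 1 -> 0 < t ->
  levy_kernel c al t s = pi^-1 * \int[mu]_(y in H) Re (Fline al t s c y).
Proof.
move=> c0 al01 t0; rewrite /levy_kernel Re_bromwich.
rewrite (_ : (fun y => Re _) = (fun y => Re (Gline al t s c y))); last first.
  by apply/funext => y; rewrite /cpow clogE// /Gline rmorphN mulNr [s%:C * _]mulrC.
have E y : 0 < y -> Re (Fline al t s c y) = Re (Gline al t s c y).
  by move=> y0; rewrite Gline_Fline.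
rewrite integral_even.
- rewrite (eq_hint E) mulrA; congr (_ * _).
  by rewrite invfM mulrAC mulVf ?mul1r// pnatr_eq0.
- exact: (ccont_Gline al t s c0).1.
- by move=> y; rewrite conj_Gline Re_conj.
- exact: eq_hL1 E (hL1_Fline _ al01 t0 (ltW c0)).
Qed.

Lemma hL1_pFline al t s c : 0 < al < 1 -> 0 < t -> 0 <= c ->
  hL1 (fun y => Re (cexp ((al - 1)%:C * ulog c y) * Fline al t s c y)).
Proof.
move=> al01 t0 c0; have /andP[a0 _] := al01.
have ta : t * al != 0 by rewrite gt_eqF// mulr_gt0.
apply: eq_hL1 (hL1Z (t * al)^-1 (hL1B (hL1Z s (hL1_Fline s al01 t0 c0)) (hL1_dFline s al01 t0 c0))).
by move=> y y0; rewrite Re_dFline// opprB addrC subrK mulrA mulVf// mul1r.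
Qed.

Lemma mainardiE c al t s : 0 < c -> 0 < al < 1 -> 0 < t ->
  mainardi_kernel c al s t =
  pi^-1 * \int[mu]_(y in H) Re (cexp ((al - 1)%:C * ulog c y) * Fline al t s c y).
Proof.
move=> c0 al01 t0; rewrite /mainardi_kernel Re_bromwich.
pose G y := cexp ((al - 1)%:C * llog c y) * Gline al t s c y.
rewrite (_ : (fun y => Re _) = (fun y => Re (G y))); last first.
  by apply/funext => y; rewrite /cpow clogE// /G /Gline rmorphN mulNr [s%:C * _]mulrC.
have E y : 0 < y -> Re (cexp ((al - 1)%:C * ulog c y) * Fline al t s c y) = Re (G y).
  by move=> y0; rewrite /G Gline_Fline// llog_ulog.
rewrite integral_even.
- rewrite (eq_hint E) mulrA; congr (_ * _).
  by rewrite invfM mulrAC mulVf ?mul1r// pnatr_eq0.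
- apply: (ccontM _ (ccont_Gline al t s c0)).1.
  by apply: ccont_cexp; apply: ccontM; [exact: ccont_cst|exact: ccont_llog].
- move=> y; rewrite /G conj_Gline conj_llog.
  rewrite (_ : (al - 1)%:C * _ = conjc ((al - 1)%:C * llog c y)).
    by rewrite cexp_conj -rmorphM Re_conj.
  by rewrite rmorphM/= oppr0.
- exact: eq_hL1 E (hL1_pFline _ al01 t0 (ltW c0)).
Qed.

(* Integration by parts on the contour. *)
Lemma Fline_parts c al t s : 0 <= c -> 0 < al < 1 -> 0 < t ->
  Im (Fline al t s c y) @[y --> 0^'+] --> (0 : R) ->
  s * \int[mu]_(y in H) Re (Fline al t s c y) =
  al * t * \int[mu]_(y in H) Re (cexp ((al - 1)%:C * ulog c y) * Fline al t s c y).
Proof.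
move=> c0 al01 t0 cF.
have dF0 : \int[mu]_(y in H) Re (dFline al t s c y) = 0 - 0.
  apply: (hFTC (F := fun y => Im (Fline al t s c y)) (hL1_dFline s al01 t0 c0)).
  - by move=> y /(holo_Fline al t s c)[_ _ _ d].
  - by move=> y; exact: cont_Re_dFline.
  - exact: cF.
  - exact: cvgy_Im_Fline.
rewrite -(hintZ s (hL1_Fline s al01 t0 c0)).
rewrite -(hintZ (al * t) (hL1_pFline s al01 t0 c0)).
apply/eqP; rewrite -subr_eq0 -hintB; last 2 first.
- exact/hL1Z/hL1_Fline.
- exact/hL1Z/hL1_pFline.
rewrite -[X in _ == X](subrr (0 : R)) -dF0; apply/eqP/eq_hint => y y0.
by rewrite Re_dFline// [t * al]mulrC.
Qed.

Lemma levy_mainardi c al t s : 0 < c -> 0 < al < 1 -> 0 < t ->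
  s * levy_kernel c al t s = al * t * mainardi_kernel c al s t.
Proof.
move=> c0 al01 t0; rewrite (levyE s c0 al01 t0) (mainardiE s c0 al01 t0).
rewrite [LHS]mulrCA [RHS]mulrCA; congr (_ * _).
by apply: Fline_parts => //; [exact: ltW|exact: cvg0_Im_Fline].
Qed.

(** [contour_shift] asks for boundary limits only at abscissae strictly between 0 and c, so the
    branch point on the limiting line does no harm. *)
Lemma levy_indep c al t s : 0 < c -> 0 < al < 1 -> 0 < t ->
  levy_kernel c al t s = pi^-1 * \int[mu]_(y in H) Re (Fline al t s 0 y).
Proof.
move=> c0 al01 t0; rewrite (levyE s c0 al01 t0); congr (_ * _); apply/esym.
apply: (@contour_shift _ (fun y c => Re (Fline al t s c y)) (fun y c => Im (Fline al t s c y))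
  (fun y c => Re (dFline al t s c y)) (Fline_bound al t s c)).
- exact: c0.
- by move=> y x y0 _; have [d _ _ _] := holo_Fline al t s x y0.
- by move=> y x y0 _; have [_ _ _ d] := holo_Fline al t s x y0.
- by move=> y x y0 _; exact: cont_Re_dFline.
- by move=> x _; apply: continuous_hmeas => y; exact: cont_Re_Fline.
- by move=> y x y0 xc; apply: le_trans (normRe _) _; apply: Fline_dom.
- move=> y x y0 /andP[x0 xc]; apply: le_trans (normRe _) _; apply: dFline_dom => //.
  by rewrite !ltW.
- exact: Fline_bound_hL1.
- by move=> x /andP[x0 _]; exact: cvg0_Im_Fline.
- by move=> x /andP[x0 _]; exact: cvgy_Im_Fline (ltW x0).
Qed.

End line.

(** * The Levy kernel *)

Section kernel.
Context {R : realType}.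
Notation mu := (@lebesgue_measure R).
Notation H := (@halfline R).
Local Notation Re := complex.Re.
Local Notation Im := complex.Im.
Local Notation normc := ComplexField.Normc.normc.
Local Notation normcM := ComplexField.Normc.normcM.
Local Open Scope complex_scope.
Implicit Types (c y t s al x e k v u : R) (z : R[i]).

Lemma FlineM al t s c y : Fline al t s c y = cexp (s%:C * (c +i* y)) * Fline al t 0 c y.
Proof. by rewrite -cexpD; congr cexp; rewrite mul0r add0r. Qed.

(** Isolates s: this gives continuity in s, and it makes suitably weighted values at s and - s add
    up to a cosine. *)
Lemma Re_FlineE al t s c y : Re (Fline al t s c y) = expR (s * c) *
  (cos (s * y) * Re (Fline al t 0 c y) - sin (s * y) * Im (Fline al t 0 c y)).
Proof.
rewrite FlineM; move: (Fline al t 0 c y) => F0.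
rewrite cReM Re_cexp Im_cexp /= !mul0r subr0 addr0.
by ring.
Qed.

Lemma norm_expNM (a v : R) : 0 <= a -> `|expR (- a) * v| <= `|v|.
Proof.
move=> a0; rewrite normrM ger0_norm ?expR_ge0// ler_piMl ?normr_ge0//.
by rewrite expR_le1 oppr_le0.
Qed.

Lemma half_div (p : R) : p != 0 -> p / 2 * (2 / p) = 1.
Proof. by move=> p0; field. Qed.

Lemma cancel_coef (p q a v : R) : p * q = 1 -> p * (a * (q * v)) = a * v.
Proof. by move=> pq; rewrite mulrCA (mulrA p) pq mul1r. Qed.

Lemma sqD_gt0 e y : 0 < e -> 0 < e ^+ 2 + y ^+ 2.
Proof. by move=> e0; rewrite ltr_pwDl ?exprn_gt0// sqr_ge0. Qed.

Lemma poisson_scale e v : 0 < e -> e * (e / (e ^+ 2 + (e * v) ^+ 2)) = (1 + v ^+ 2)^-1.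
Proof.
move=> e0; have v1 : 1 + v ^+ 2 != 0 by rewrite gt_eqF// ltr_pwDl// sqr_ge0.
have v2 : e ^+ 2 + (e * v) ^+ 2 != 0 by rewrite gt_eqF// sqD_gt0.
by field; rewrite v1 v2.
Qed.

Lemma poisson_le e y : 0 < e -> `|e / (e ^+ 2 + y ^+ 2)| <= e^-1.
Proof.
move=> e0; rewrite ger0_norm ?divr_ge0 ?(ltW e0) ?(ltW (sqD_gt0 y e0))//.
by rewrite ler_pdivrMr ?sqD_gt0// mulrC ler_pdivlMr// -expr2 lerDl sqr_ge0.
Qed.

Lemma poisson_cont e y : 0 < e -> {for y, continuous (fun y => e / (e ^+ 2 + y ^+ 2))}.
Proof.
move=> e0; have gy : e * e + y * y != 0 by rewrite -!expr2 gt_eqF// sqD_gt0.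
exact: is_derive_continuous (dM (dC y e)
    (dV (f := fun y => e * e + y * y) gy (dD (dC y (e * e)) (dM (dI y) (dI y))))).
Qed.

Lemma ulog0 y : 0 < y -> ulog 0 y = ln y +i* (pi / 2).
Proof.
move=> y0; rewrite /ulog mul0r add0r mul0r atan0 subr0; congr (_ +i* _).
by rewrite lnM ?posrE//; field.
Qed.

(* The Levy kernel with its contour moved to the imaginary axis. *)
Definition stable al t s : R := pi^-1 * \int[mu]_(y in H) Re (Fline al t s 0 y).

Section fixed.
Variables (al t : R).
Hypotheses (al01 : 0 < al < 1) (t0 : 0 < t).
Let a0 : 0 < al. Proof. by case/andP: al01. Qed.
Let b0 : 0 < t * cos (al * (pi / 2)). Proof. by rewrite mulr_gt0// cos_alpha_gt0. Qed.
Let I0 := expN_hL1 b0 a0.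

Lemma stable_indep c s : 0 < c -> stable al t s = pi^-1 * \int[mu]_(y in H) Re (Fline al t s c y).
Proof. by move=> c0; rewrite /stable -(levy_indep s c0 al01 t0) (levyE s c0 al01 t0). Qed.

Definition stable_bound := pi^-1 * \int[mu]_(y in H) expR (- (t * cos (al * (pi / 2)) * y `^ al)).

Lemma stable_bound_ge0 : 0 <= stable_bound.
Proof.
by rewrite mulr_ge0 ?invr_ge0 ?pi_ge0// Rintegral_ge0.
Qed.

Lemma norm_int_Fline c s : 0 <= c ->
  `|pi^-1 * \int[mu]_(y in H) Re (Fline al t s c y)| <= expR (s * c) * stable_bound.
Proof.
move=> c0; rewrite normrM ger0_norm ?invr_ge0 ?pi_ge0// [leRHS]mulrCA ler_wpM2l ?invr_ge0 ?pi_ge0//.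
rewrite -hintZ//; apply: (norm_hint_le (hL1_Fline s al01 t0 c0)); first exact: hL1Z.
move=> y y0; apply: le_trans (normRe _) _.
exact: normc_Fline.
Qed.

Lemma stable_bounded s : `|stable al t s| <= stable_bound.
Proof. by have := norm_int_Fline s (lexx 0); rewrite mulr0 expR0 mul1r. Qed.

(** The abscissa is free, and at - s the bound is exp (- s c) times a constant independent of c.
    With the c chosen here, v exp (s c) >= v (1 + s c) = v + [stable_bound] + 1, which contradicts
    that bound. *)
Lemma stable_neg s : 0 < s -> stable al t (- s) = 0.
Proof.
move=> s0; apply/eqP; rewrite -normr_eq0; apply/negPn/negP => n0.
pose v := `|stable al t (- s)|.
have v0 : 0 < v by rewrite lt_def n0 normr_ge0.
have c0 : 0 < (stable_bound + 1) / (s * v).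
  by rewrite divr_gt0 ?mulr_gt0// ltr_wpDl// stable_bound_ge0.
have := norm_int_Fline (- s) (ltW c0); rewrite -stable_indep// -/v.
rewrite mulNr expRN => h.
have e0 := expR_gt0 (s * ((stable_bound + 1) / (s * v))).
rewrite mulrC ler_pdivlMr// in h.
have h2 := expR_ge1Dx (s * ((stable_bound + 1) / (s * v))).
have h3 : v * (1 + s * ((stable_bound + 1) / (s * v))) <= stable_bound.
  by apply: le_trans h; rewrite ler_pM2l.
have h4 : v * (1 + s * ((stable_bound + 1) / (s * v))) = v + (stable_bound + 1).
  by field; rewrite !gt_eqF.
move: h3; rewrite h4 leNgt => /negP; apply.
by rewrite addrCA ltrDl addr_gt0.
Qed.

Lemma stable_cont s : {for s, continuous (stable al t)}.
Proof.
apply: cvgM; first exact: cvg_cst.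
have s1 : s - 1 < s < s + 1 by apply/andP; split; lra.
apply: (hcont s1 _ _ _ I0) => [x _|x y _ y0|x y _ y0].
- by apply: continuous_hmeas => y; exact: cont_Re_Fline.
- have -> : (fun x => Re (Fline al t x 0 y)) = (fun x => cos (x * y) * Re (Fline al t 0 0 y) -
      sin (x * y) * Im (Fline al t 0 0 y)).
    by apply/funext => {}x; rewrite Re_FlineE mulr0 expR0 mul1r.
  exact: is_derive_continuous (dB (dM (dcos (dM (dI x) (dC x y))) (dC x _)) (dM (dsin (dM (dI x) (dC x y))) (dC x _))).
- apply: le_trans (normRe _) _.
  by have := normc_Fline x al01 t0 (lexx 0) y0; rewrite mulr0 expR0 mul1r.
Qed.

End fixed.

Lemma cexp_dsigma (A z : R[i]) s : is_derive s (1 : R)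
  (fun s => Im (A * cexp (- (s%:C * z)))) (Im (A * (- z * cexp (- (s%:C * z))))).
Proof.
have [_ d _ _] := holoZ A (holo_exp (holoZ (- z) (holo_id s 0))).
have -> : (fun s => Im (A * cexp (- (s%:C * z)))) =
          (fun s => Im (A * cexp (- z * (s +i* 0)))).
  by apply/funext => u; rewrite mulNr [z * _]mulrC.
apply: is_derive_eq d _.
rewrite mulr1; congr (Im (_ * (_ * cexp _))).
by rewrite mulNr; congr (- _); exact: mulrC.
Qed.

Lemma Re_realM (k : R) z : Re (k%:C * z) = k * Re z.
Proof. by rewrite cReM /= mul0r subr0. Qed.

Lemma normc_cexpN (A z : R[i]) s :
  normc (A * cexp (- (s%:C * z))) = normc A * expR (- (Re z * s)).
Proof. by rewrite normcM normc_cexp cReN Re_realM [s * _]mulrC. Qed.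

Lemma lap_cexp_hL1 (A z : R[i]) : 0 < Re z ->
  hL1 (fun s => Im (A * cexp (- (s%:C * z)))).
Proof.
move=> z0; apply: (hL1_le _ _ (hL1Z (normc A) (expN_hL1 z0 ltr01))).
  by apply: continuous_hmeas => s _; exact: is_derive_continuous (cexp_dsigma A z s).
by move=> s s0; apply: le_trans (normIm _) _; rewrite normc_cexpN (powRr1 (ltW s0)).
Qed.

(** Used twice: z = e + i y yields the Poisson kernel, and the value of z^al + l on the opened ray
    yields the resolvent of the Mainardi transform. *)
Lemma lap_cexp (A z : R[i]) : 0 < Re z ->
  \int[mu]_(s in H) Im (A * cexp (- (s%:C * z))) = Im (A * z^-1).
Proof.
move=> z0; have z1 : z != 0 by apply: contraTneq z0 => ->; rewrite ltxx.
have dF s : is_derive s (1 : R) (fun s => Im (- (A * z^-1) * cexp (- (s%:C * z))))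
    (Im (A * cexp (- (s%:C * z)))).
  apply: is_derive_eq (cexp_dsigma _ _ _) _; congr Im.
  by field.
have cF s : {for s, continuous (fun s => Im (- (A * z^-1) * cexp (- (s%:C * z))))}.
  exact: is_derive_continuous (dF s).
rewrite (hFTC (l0 := Im (- (A * z^-1))) (l1 := 0) (lap_cexp_hL1 A z0) (fun s _ => dF s)).
- by rewrite sub0r cImN opprK.
- by move=> s _; exact: is_derive_continuous (cexp_dsigma A z s).
- have := cvg_at_right_filter (cF 0).
  by rewrite mul0r oppr0 cexp0 mulr1; apply.
- have [K K0 HK] := expN_decay z0 ltr01.
  apply: (@cvgy_le _ _ ((normc (- (A / z)) + 1) * K) 1) => //.
    by rewrite mulr_gt0// ltr_wpDl ?normc_ge0.
  move=> s s1; have s0 : 0 < s by exact: lt_le_trans s1.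
  apply: le_trans (normIm _) _; rewrite normc_cexpN -[leRHS]mulrA.
  apply: ler_pM; rewrite ?normc_ge0 ?expR_ge0 ?lerDl//.
  by have := HK s s0; rewrite (powRr1 (ltW s0)).
Qed.

Lemma oneDsqrV_hL1 : hL1 (fun v => (1 + v ^+ 2)^-1 : R).
Proof.
apply: (@hL1_FTC _ _ (fun v => atan v) (pi / 2)).
- by move=> v _; rewrite invr_ge0 addr_ge0 ?sqr_ge0.
- move=> v _; have v1 : 1 + v * v != 0 by rewrite gt_eqF// ltr_pwDl// -expr2 sqr_ge0.
  exact: is_derive_continuous (dV (f := fun v => 1 + v * v) v1 (dD (dC v 1) (dM (dI v) (dI v)))).
- by move=> v _; rewrite ler_norml !ltW ?atan_gtNpi2 ?atan_ltpi2.
Qed.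

Lemma oneDsqrV_hint : \int[mu]_(v in H) (1 + v ^+ 2)^-1 = pi / 2.
Proof.
rewrite (hFTC (F := fun v => atan v) (l0 := 0) (l1 := pi / 2) oneDsqrV_hL1).
- by rewrite subr0.
- move=> v _; have v1 : 1 + v * v != 0 by rewrite gt_eqF// ltr_pwDl// -expr2 sqr_ge0.
  exact: is_derive_continuous (dV (f := fun v => 1 + v * v) v1 (dD (dC v 1) (dM (dI v) (dI v)))).
- by rewrite -{2}atan0; apply: cvg_at_right_filter; exact: continuous_atan.
- exact: cvgy_atan.
Qed.

Local Opaque cexp Fline stable pi.

Section laplace.
Variables (al t l : R).
Hypotheses (al01 : 0 < al < 1) (t0 : 0 < t) (l0 : 0 < l).
Let a0 : 0 < al. Proof. by case/andP: al01. Qed.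

Lemma lap_stable_hL1 : hL1 (fun s => expR (- (l * s)) * stable al t s).
Proof.
apply: (hL1_le _ _ (hL1Z (stable_bound al t) (expN_hL1 l0 ltr01))).
  apply: continuous_hmeas => s _; apply: cvgM; last exact: stable_cont.
  exact: is_derive_continuous (dexp (dN (dZ l (dI s)))).
move=> s s0; rewrite normrM ger0_norm ?expR_ge0// mulrC (powRr1 (ltW s0)).
by rewrite ler_wpM2r ?expR_ge0// stable_bounded.
Qed.

Let G y := Re (Fline al t 0 l y).

Let IG : hL1 G. Proof. exact: hL1_Fline (ltW l0). Qed.

(* For s > 0 the kernel vanishes at - s, which turns the inversion integral into a cosine transform. *)
Lemma stable_cosine s : 0 < s ->
  expR (- (l * s)) * stable al t s = (2 / pi) * \int[mu]_(y in H) (cos (s * y) * G y).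
Proof.
move=> s0.
have ->  : expR (- (l * s)) * stable al t s =
    expR (- (l * s)) * stable al t s + expR (l * s) * stable al t (- s).
  by rewrite stable_neg// mulr0 addr0.
rewrite !(stable_indep al01 t0 _ l0) mulrCA [X in _ + X]mulrCA -mulrDr.
have I1 := hL1_Fline s al01 t0 (ltW l0); have I2 := hL1_Fline (- s) al01 t0 (ltW l0).
rewrite -(hintZ (expR (- (l * s))) I1) -(hintZ (expR (l * s)) I2) -hintD; [|exact: hL1Z|exact: hL1Z].
rewrite mulrAC mulrC; congr (_ * _).
have Icos : hL1 (fun y => cos (s * y) * G y).
  apply: (hL1_le _ _ (hL1_norm IG)).
    apply: continuous_hmeas => y y0; apply: cvgM; last exact: cont_Re_Fline.
    exact: is_derive_continuous (dcos (dZ s (dI y))).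
  by move=> y _; rewrite normrM ler_piMl// cos_max.
rewrite mulrC -hintZ//; apply: eq_hint => y y0.
rewrite (Re_FlineE al t s) (Re_FlineE al t (- s)) !mulNr cosN sinN -/(G y).
transitivity (expR (- (s * l)) * expR (s * l) * (2 * (cos (s * y) * G y))).
  by ring.
by rewrite expRN mulVf ?mul1r// expR_eq0.
Qed.

(** The cosine representation shows no decay in s, since exp (- l s) has been absorbed. The Abel
    factor exp (- e s) restores it and licenses Fubini; the inner integral is e / (e^2 + y^2), and y
    = e v removes e from the kernel. *)
Lemma lap_stable_poisson e : 0 < e ->
  \int[mu]_(s in H) (expR (- (e * s)) * (expR (- (l * s)) * stable al t s)) =
  (2 / pi) * \int[mu]_(v in H) ((1 + v ^+ 2)^-1 * G (e * v)).
Proof.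
move=> e0.
pose k s y := expR (- (e * s)) * (cos (s * y) * G y).
have Ie : hL1 (fun s => expR (- (e * s))).
  by apply: eq_hL1 (expN_hL1 e0 ltr01) => s s0; rewrite (powRr1 (ltW s0)).
have mG : measurable_fun H G by apply: continuous_hmeas => y; exact: cont_Re_Fline.
have Icos s : hL1 (fun y => cos (s * y) * G y).
  apply: (hL1_le _ _ (hL1_norm IG)).
    apply: continuous_hmeas => y y0; apply: cvgM; last exact: cont_Re_Fline.
    exact: is_derive_continuous (dcos (dZ s (dI y))).
  by move=> y _; rewrite normrM ler_piMl// cos_max.
have F : \int[mu]_(s in H) (\int[mu]_(y in H) k s y) = \int[mu]_(y in H) (\int[mu]_(s in H) k s y).
  apply: (hFubini (g := fun s => expR (- (e * s))) (h := fun y => `|G y|)) => //.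
  - apply: measurable_funM; first exact: measurable_HH1 (hL1_meas Ie).
    apply: measurable_funM; last exact: measurable_HH2 mG.
    apply: measurableT_comp; first by apply: continuous_measurable_fun; exact: continuous_cos.
    by apply: measurable_funM; apply: measurable_funTS; [exact: measurable_fst|exact: measurable_snd].
  - exact: hL1_norm.
  - move=> s y s0 y0; rewrite normrM ger0_norm ?expR_ge0// ler_wpM2l ?expR_ge0//.
    by rewrite normrM ler_piMl// cos_max.
rewrite (eq_hint (g := fun s => (2 / pi) * \int[mu]_(y in H) k s y)); last first.
  by move=> s s0; rewrite (stable_cosine s0) mulrCA /k (hintZ _ (Icos s)).
have inner y : 0 < y -> \int[mu]_(s in H) k s y = e / (e ^+ 2 + y ^+ 2) * G y.
  move=> y0; pose z : R[i] := e +i* y.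
  have z0 : 0 < Re z by [].
  have <- : Im ((0 +i* G y) * z^-1) = e / (e ^+ 2 + y ^+ 2) * G y.
    by rewrite cImM cReV /= mul0r add0r mulrC.
  rewrite -(lap_cexp _ z0); apply: eq_hint => s s0.
  rewrite /k cImM Re_cexp Im_cexp /= !mul0r subr0 add0r addr0 cosN mulrC [e * s]mulrC.
  by ring.
have Ief : hL1 (fun s => expR (- (e * s)) * (expR (- (l * s)) * stable al t s)).
  apply: (hL1_le _ _ (hL1_norm lap_stable_hL1)).
    apply: measurable_funM; first exact: hL1_meas Ie.
    exact: hL1_meas lap_stable_hL1.
  by move=> s s0; apply: norm_expNM; rewrite mulr_ge0 ?(ltW e0) ?(ltW s0).
have pi2 : pi / 2 * (2 / pi) = 1 :> R.
  exact/half_div/lt0r_neq0/pi_gt0.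
have Ik : hL1 (fun s => \int[mu]_(y in H) k s y).
  apply: eq_hL1 (hL1Z (pi / 2) Ief) => s s0.
  rewrite (stable_cosine s0) (cancel_coef _ _ pi2).
  exact: esym (hintZ _ (Icos s)).
rewrite (hintZ _ Ik) F; congr (_ * _).
rewrite (eq_hint inner).
pose g y := e / (e ^+ 2 + y ^+ 2) * G y.
have cg y : 0 < y -> {for y, continuous g}.
  by move=> y0; apply: cvgM; [exact: poisson_cont|exact: cont_Re_Fline].
have Ig : hL1 g.
  apply: (hL1_le _ _ (hL1Z e^-1 (hL1_norm IG))); first exact: continuous_hmeas.
  by move=> y y0; rewrite normrM; apply: ler_wpM2r; [exact: normr_ge0|exact: poisson_le].
rewrite -(hint_subst e0 (oner_neq0 R) cg Ig); apply: eq_hint => v v0.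
by rewrite normr1 mul1r subrr powRr0 mulr1 (powRr1 (ltW v0)) /g mulrA poisson_scale.
Qed.

(** As e tends to 0, G (e v) tends to the value of the integrand at z = l on the real axis, exp (- t
    l^al), and the mass pi / 2 of the Poisson kernel cancels the factor 2 / pi. *)
Lemma lap_stable : \int[mu]_(s in H) (expR (- (l * s)) * stable al t s) = expR (- (t * l `^ al)).
Proof.
pose e n : R := n.+2%:R^-1.
have e0 n : 0 < e n by rewrite invr_gt0 ltr0n.
have ce : e n @[n --> \oo] --> (0 : R) by exact: cvg_nat2V.
have G01 y : 0 < y -> `|G y| <= 1.
  move=> y0; apply: le_trans (normRe _) _; apply: le_trans (normc_Fline 0 al01 t0 (ltW l0) y0) _.
  rewrite mul0r expR0 mul1r expR_le1 oppr_le0 !mulr_ge0 ?powR_ge0 ?(ltW t0)//.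
  exact: ltW (cos_alpha_gt0 al01).
have L : \int[mu]_(s in H) (expR (- (e n * s)) * (expR (- (l * s)) * stable al t s)) @[n --> \oo] -->
    \int[mu]_(s in H) (expR (- (l * s)) * stable al t s).
  apply: (hDCT _ _ _ (hL1_norm lap_stable_hL1)) => [n|s s0|n s s0].
  - apply: measurable_funM; last exact: hL1_meas lap_stable_hL1.
    by apply: continuous_hmeas => s _; exact: is_derive_continuous (dexp (dN (dZ (e n) (dI s)))).
  - rewrite -[X in _ --> X]mul1r; apply: cvgM; last exact: cvg_cst.
    have cs : - (e n * s) @[n --> \oo] --> - (0 * s).
      by apply: cvgN; apply: cvgM => //; exact: cvg_cst.
    have := cvg_comp _ _ cs (@continuous_expR R _).
    by rewrite mul0r oppr0 expR0.
  - by apply: norm_expNM; rewrite mulr_ge0 ?(ltW (e0 n)) ?(ltW s0).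
have cG0 : G y @[y --> 0^'+] --> expR (- (t * l `^ al)).
  have [cG _] := ccont_Gline al t 0 l0.
  have -> : expR (- (t * l `^ al)) = Re (Gline al t 0 l 0).
    rewrite /Gline.
    have -> : llog l 0 = (ln (l * l) / 2)%:C by rewrite /llog mul0r mul0r addr0 atan0.
    rewrite !ReImE /=.
    rewrite !mulr0 !mul0r !subr0 !addr0 sin0 cos0 !mulr0 !addr0 cos0 !mulr1 !add0r mulNr.
    rewrite /powR gt_eqF// lnM ?posrE//; congr (expR (- (_ * expR _))).
    by field.
  have : Re (Gline al t 0 l y) @[y --> 0^'+] --> Re (Gline al t 0 l 0).
    by apply: cvg_at_right_filter; exact: cG.
  apply: cvg_trans; apply: near_eq_cvg; near=> y.
  by rewrite Gline_Fline.
have Rr : (2 / pi) * \int[mu]_(v in H) ((1 + v ^+ 2)^-1 * G (e n * v)) @[n --> \oo] -->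
   (2 / pi) * \int[mu]_(v in H) ((1 + v ^+ 2)^-1 * expR (- (t * l `^ al))).
  apply: cvgM; first exact: cvg_cst.
  apply: (hDCT (f_ := fun n v => (1 + v ^+ 2)^-1 * G (e n * v)) (g := fun v => (1 + v ^+ 2)^-1)
    (f := fun v => (1 + v ^+ 2)^-1 * expR (- (t * l `^ al))) _ _ _ oneDsqrV_hL1) => [n|v v0|n v v0].
  - apply: measurable_funM; first exact: hL1_meas oneDsqrV_hL1.
    apply: continuous_hmeas => v v0.
    apply: (@continuous_comp _ _ _ (fun v => e n * v) G).
      exact: is_derive_continuous (dZ (e n) (dI v)).
    by apply: cont_Re_Fline; rewrite mulr_gt0.
  - apply: cvgM; first exact: cvg_cst.
    move/cvg_at_rightP : cG0; apply; split; first by move=> n; rewrite mulr_gt0.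
    by rewrite -(mul0r v); apply: cvgM => //; exact: cvg_cst.
  - have v1 : 0 <= (1 + v ^+ 2)^-1 by rewrite invr_ge0 addr_ge0// sqr_ge0.
    by rewrite normrM (ger0_norm v1) ler_piMr// G01// mulr_gt0.
have Rr' : \int[mu]_(s in H) (expR (- (e n * s)) * (expR (- (l * s)) * stable al t s)) @[n --> \oo] -->
   (2 / pi) * \int[mu]_(v in H) ((1 + v ^+ 2)^-1 * expR (- (t * l `^ al))).
  by under eq_fun do rewrite lap_stable_poisson//.
rewrite (cvg_unique _ L Rr').
rewrite (eq_hint (g := fun v => expR (- (t * l `^ al)) * (1 + v ^+ 2)^-1)); last first.
  by move=> v _; rewrite mulrC.
rewrite (hintZ _ oneDsqrV_hL1) oneDsqrV_hint mulrCA [X in _ * X]mulrC.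
by rewrite half_div ?mulr1//; exact/lt0r_neq0/pi_gt0.
Unshelve. all: by end_near. Qed.

End laplace.

End kernel.

(** * The Mainardi kernel *)

(* Locked: rewriting would otherwise see the product hidden in cexp. *)
HB.lock Definition Eray (R : realType) (x s : R) : R[i] := cexp (x +i* s)%C.
HB.lock Definition Aray (R : realType) (al x s : R) : R[i] := cexp (al%:C * (x +i* s))%C.
Arguments Eray {R}.
Arguments Aray {R}.

Section rays.
Context {R : realType}.
Notation mu := (@lebesgue_measure R).
Notation H := (@halfline R).
Local Notation Re := complex.Re.
Local Notation Im := complex.Im.
Local Notation normc := ComplexField.Normc.normc.
Local Notation normcM := ComplexField.Normc.normcM.
Local Open Scope complex_scope.
Implicit Types (c y t s al x e k v u q : R) (z : R[i]).

Lemma lt_cos x y : 0 <= x -> x < y -> y <= pi -> cos y < cos x.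
Proof.
move=> x0 xy yp; rewrite ltr_cos// in_itv/= ?x0 ?yp ?andbT/=.
  exact: le_trans (ltW xy) yp.
exact: le_trans x0 (ltW xy).
Qed.

Lemma le_cos x y : 0 <= x -> x <= y -> y <= pi -> cos y <= cos x.
Proof.
move=> x0; rewrite le_eqVlt => /predU1P[->//|xy] yp.
by apply: ltW; exact: lt_cos.
Qed.

Lemma holo_E x s : holo Eray x s (Eray x s).
Proof. by rewrite Eray.unlock; apply: holo_eq (holo_exp (holo_id x s)) _; rewrite mul1r. Qed.

Lemma holo_A al x s : holo (Aray al) x s (al%:C * Aray al x s).
Proof. by rewrite Aray.unlock; apply: holo_eq (holo_exp (holoZ al%:C (holo_id x s))) _; rewrite mulr1. Qed.

Lemma Re_E u s : 0 < u -> Re (Eray (ln u) s) = u * cos s.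
Proof. by move=> u0; rewrite Eray.unlock Re_cexp /= lnK ?posrE. Qed.

Lemma Re_A al u s : 0 < u -> Re (Aray al (ln u) s) = u `^ al * cos (al * s).
Proof. by move=> u0; rewrite Aray.unlock Re_cexp !ReImE /= !mul0r subr0 addr0 /powR gt_eqF. Qed.

Lemma Im_A al u s : 0 < u -> Im (Aray al (ln u) s) = u `^ al * sin (al * s).
Proof. by move=> u0; rewrite Aray.unlock Im_cexp !ReImE /= !mul0r subr0 addr0 /powR gt_eqF. Qed.

Lemma normc_E u s : 0 < u -> normc (Eray (ln u) s) = u.
Proof. by move=> u0; rewrite Eray.unlock normc_cexp /= lnK ?posrE. Qed.

Lemma normc_A al u s : 0 < u -> normc (Aray al (ln u) s) = u `^ al.
Proof. by move=> u0; rewrite Aray.unlock normc_cexp !ReImE /= !mul0r subr0 /powR gt_eqF. Qed.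

Lemma E_pi2 y : 0 < y -> Eray (ln y) (pi / 2) = 0 +i* y.
Proof. by move=> y0; rewrite Eray.unlock -(cexp_ulog 0 y0) ulog0. Qed.

Lemma A_pi2 al y : 0 < y -> Aray al (ln y) (pi / 2) = cexp (al%:C * ulog 0 y).
Proof. by move=> y0; rewrite Aray.unlock ulog0. Qed.

(** The Mainardi integrand at z = exp (x + i q), multiplied by z because dz = z d(log z). *)
Definition Wray al s t x q :=
  Aray al x q * cexp (s%:C * Eray x q + (- t)%:C * Aray al x q).

(** The logarithmic derivative of [Wray] with respect to log z; [Qray] is the derivative of [Pray],
    from which the continuity needed in [ray_rotation] follows. *)
Definition Pray al s t x q :=
  al%:C + (s%:C * Eray x q + (- t)%:C * (al%:C * Aray al x q)).

Definition Qray al s t x q :=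
  s%:C * Eray x q + (- t)%:C * (al%:C * (al%:C * Aray al x q)).

Lemma holo_P al s t x q : holo (Pray al s t) x q (Qray al s t x q).
Proof.
exact: holo_eq (holoD (holo_cst al%:C x q) (holoD (holoZ s%:C (holo_E x q))
  (holoZ (- t)%:C (holoZ al%:C (holo_A al x q))))) (add0r _).
Qed.

Lemma holo_W al s t x q : holo (Wray al s t) x q (Pray al s t x q * Wray al s t x q).
Proof.
apply: holo_eq (holoM (holo_A al x q) (holo_exp (holoD (holoZ s%:C (holo_E x q))
  (holoZ (- t)%:C (holo_A al x q))))) _.
rewrite /Pray /Wray [RHS]mulrDl -[al%:C * Aray al x q * _]mulrA; congr (_ + _).
by rewrite mulrCA.
Qed.

Lemma normc_W al s t u q : 0 < u ->
  normc (Wray al s t (ln u) q) =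
  u `^ al * expR (s * (u * cos q) - t * (u `^ al * cos (al * q))).
Proof.
move=> u0; rewrite normcM normc_A// normc_cexp cReD !Re_realM Re_E// Re_A//.
by rewrite mulNr.
Qed.

Lemma normc_P al s t u q : 0 < u -> 0 <= al -> 0 <= s -> 0 <= t ->
  normc (Pray al s t (ln u) q) <= al + s * u + t * al * u `^ al.
Proof.
move=> u0 al0 s0 t0; apply: le_trans (normcD_le _ _) _.
rewrite normcR ger0_norm// -addrA lerD2l; apply: le_trans (normcD_le _ _) _.
by rewrite !normcM !normcR normc_E// normc_A// normrN !ger0_norm// mulrA.
Qed.

(** The exponential is split into two equal halves: one absorbs the prefactor coming from the
    logarithmic derivative, the other is compared with the envelope. *)
Lemma ray_env al k p b1 b2 : 0 < al -> 0 < k -> 0 < p -> 0 <= b1 -> 0 <= b2 ->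
  exists2 K : R, 0 < K & forall u, 0 < u ->
    (1 + b1 * u + b2 * u `^ al) * (u `^ al * expR (- (k * u `^ p))) <= K * (u * env al u).
Proof.
move=> a0 k0 p0 b10 b20; have k20 : 0 < k / 2 by rewrite divr_gt0.
have [K1 K10 HK1] := pow_expN_bounded ler01 k20 p0.
have [K2 K20 HK2] := pow_expN_bounded (ltW a0) k20 p0.
have [K3 K30 HK3] := gamma_env a0 k20 p0.
have C0 : 0 < 1 + b1 * K1 + b2 * K2.
  by rewrite -addrA ltr_pwDl// addr_ge0// mulr_ge0// ltW.
exists ((1 + b1 * K1 + b2 * K2) * K3) => [|u u0]; first exact: mulr_gt0.
pose X := expR (- (k / 2 * u `^ p)).
have -> : expR (- (k * u `^ p)) = X * X.
  by rewrite -expRD; congr expR; rewrite -opprD -mulrDl -splitr.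
have -> : u `^ al = u * u `^ (al - 1).
  by rewrite -{2}(powRr1 (ltW u0)) -powRDp// addrC subrK.
have X1 : X <= 1 by rewrite expR_le1 oppr_le0 mulr_ge0 ?powR_ge0 ?ltW.
have hX := HK3 u u0; rewrite -/X in hX.
have -> : (1 + b1 * u + b2 * (u * u `^ (al - 1))) * (u * u `^ (al - 1) * (X * X)) =
    (X + b1 * (u * X) + b2 * (u * u `^ (al - 1) * X)) * (u * (u `^ (al - 1) * X)).
  by ring.
rewrite -[X in _ <= X]mulrA; apply: ler_pM.
- by rewrite !addr_ge0 ?mulr_ge0 ?expR_ge0 ?powR_ge0 ?(ltW u0).
- by rewrite !mulr_ge0 ?expR_ge0 ?powR_ge0 ?(ltW u0).
- apply: lerD; first apply: lerD => //.
    by rewrite ler_wpM2l//; have := HK1 u u0; rewrite (powRr1 (ltW u0)).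
  rewrite ler_wpM2l//; have := HK2 u u0.
  have {1}-> : u `^ al = u * u `^ (al - 1) by rewrite -{2}(powRr1 (ltW u0)) -powRDp// addrC subrK.
  exact.
- by rewrite [X in _ <= X]mulrCA ler_pM2l.
Qed.

(** The angle q = p / (1 + al) solves q + al q = p. For p = pi, q and al q are symmetric about pi /
    2, so that exp z and exp (- t z^al) both decay along the ray. *)
Lemma ray_angle (p al : R) : 0 < p -> 0 < al < 1 ->
  [/\ p / 2 < p / (1 + al), p / (1 + al) < p & al * (p / (1 + al)) < p / 2].
Proof.
move=> p0 /andP[a0 a1]; have b0 : 0 < 1 + al by rewrite ltr_pwDl// ltW.
split.
- by rewrite ltr_pM2l// ltf_pV2 ?posrE//; lra.
- by rewrite ltr_pdivrMr// mulrDr mulr1 ltrDl mulr_gt0.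
- rewrite mulrA ltr_pdivrMr// mulrC mulrAC; rewrite -mulrA ltr_pM2l//; lra.
Qed.

Section fixed.
Variable al : R.
Hypothesis al01 : 0 < al < 1.
Let a0 : 0 < al. Proof. by case/andP: al01. Qed.
Let q0 : R := pi / (1 + al).

Let ang : [/\ pi / 2 < q0, q0 < pi & al * q0 < pi / 2].
Proof. exact: ray_angle (pi_gt0 R) al01. Qed.
Let pi20 : 0 < pi / 2 :> R. Proof. by rewrite divr_gt0 ?pi_gt0. Qed.
Let q0_gt0 : 0 < q0. Proof. by case: ang => h _ _; exact: lt_trans h. Qed.

Lemma cos_q0_lt0 : cos q0 < 0.
Proof.
case: ang => h1 h2 _; rewrite -(@cos_pihalf R); apply: lt_cos => //; exact: ltW.
Qed.

Lemma cos_alq0_gt0 : 0 < cos (al * q0).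
Proof.
case: ang => _ _ h; rewrite -(@cos_pihalf R); apply: lt_cos => //.
  by rewrite mulr_ge0// ltW.
by rewrite ler_pdivrMr// ler_peMr ?pi_ge0// ler1n.
Qed.

(** Between the two rays cos q <= 0, so exp (s z) has modulus at most 1, and exp (- t z^al) alone
    supplies the decay, uniformly at the rate t cos (al q0). *)
Lemma rotate_W s t : 0 <= s -> 0 < t ->
  \int[mu]_(u in H) (Im (Wray al s t (ln u) (pi / 2)) / u) =
  \int[mu]_(u in H) (Im (Wray al s t (ln u) q0) / u).
Proof.
move=> s0 t0; case: ang => h1 h2 h3; have al1 : al <= 1 by case/andP: al01 => _ /ltW.
have k0 : 0 < t * cos (al * q0) by rewrite mulr_gt0// cos_alq0_gt0.
have ta0 : 0 <= t * al by rewrite mulr_ge0 ?ltW.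
have [K K0 HK] := ray_env a0 k0 a0 s0 ta0.
have bW u q : 0 < u -> pi / 2 <= q <= q0 ->
    normc (Wray al s t (ln u) q) <= u `^ al * expR (- (t * cos (al * q0) * u `^ al)).
  move=> u0 /andP[q1 q2]; rewrite normc_W// ler_wpM2l ?powR_ge0// ler_expR.
  have c1 : cos q <= 0.
    by rewrite -(@cos_pihalf R); apply: le_cos q1 _; [exact: ltW|exact: le_trans q2 (ltW h2)].
  have c2 : cos (al * q0) <= cos (al * q).
    apply: le_cos.
    - by rewrite mulr_ge0 ?(ltW a0)//; exact: le_trans (ltW pi20) q1.
    - by rewrite ler_wpM2l// ltW.
    - apply: le_trans (ltW h3) _; apply: le_trans (ltW h1) (ltW h2).
  rewrite ler_wnDl//; first by rewrite mulr_ge0_le0// mulr_ge0_le0// ltW.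
  by rewrite lerN2 -mulrA ler_wpM2l ?(ltW t0)// mulrC ler_wpM2l ?powR_ge0.
have bE u : 0 < u -> 0 <= u `^ al * expR (- (t * cos (al * q0) * u `^ al)).
  by move=> _; exact: mulr_ge0 (powR_ge0 _ _) (expR_ge0 _).
apply: (@ray_rotation _ (Wray al s t) (fun x q => Pray al s t x q * Wray al s t x q)
  (fun x q => Qray al s t x q * Wray al s t x q +
     Pray al s t x q * (Pray al s t x q * Wray al s t x q)) K al (pi / 2) q0 h1 K0 a0).
- by move=> x q _; exact: holo_W.
- by move=> x q _; exact: holoM (holo_P _ _ _ _ _) (holo_W _ _ _ _ _).
- move=> u q u0 qq; apply: le_trans (bW u q u0 qq) _; apply: le_trans (HK u u0).
  rewrite ler_peMl ?bE// -addrA lerDl.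
  exact: addr_ge0 (mulr_ge0 s0 (ltW u0)) (mulr_ge0 ta0 (powR_ge0 _ _)).
- move=> u q u0 qq; rewrite normcM; apply: le_trans (HK u u0).
  apply: ler_pM; rewrite ?normc_ge0 ?bW//.
  apply: le_trans (normc_P _ u0 (ltW a0) s0 (ltW t0)) _.
  by rewrite !lerD2r.
Qed.

Lemma Re_kernel s t y : 0 < y ->
  Re (cexp ((al - 1)%:C * ulog 0 y) * Fline al t s 0 y) =
  Im (Wray al s t (ln y) (pi / 2)) / y.
Proof.
move=> y0; rewrite -cexp_ulogV// -mulrA.
have -> : cexp (al%:C * ulog 0 y) * Fline al t s 0 y = Wray al s t (ln y) (pi / 2).
  by rewrite /Wray A_pi2// E_pi2.
rewrite cReM cReV cImV /= expr0n/= add0r mul0r mul0r sub0r mulNr mulNr opprK mulrC.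
by congr (_ * _); rewrite expr2 invfM mulrA mulfV ?mul1r// gt_eqF.
Qed.

Lemma Im_FlineE s t y : 0 < y -> Im (Fline al t s 0 y) =
  expR (- (t * cos (al * (pi / 2)) * y `^ al)) *
  sin (s * y - t * sin (al * (pi / 2)) * y `^ al).
Proof.
move=> y0; rewrite Im_cexp cReD cImD Re_realM -A_pi2// Re_realM.
rewrite !cImM Re_A// Im_A// /= !mul0r !mulr0 !addr0 add0r.
by congr (expR _ * sin _); ring.
Qed.

(** The conjugation argument needs c > 0. On the imaginary axis itself the limit is read off an
    explicit formula. *)
Lemma cvg0_Im_Fline0 s t : Im (Fline al t s 0 y) @[y --> 0^'+] --> (0 : R).
Proof.
have cp : y `^ al @[y --> 0^'+] --> (0 : R).
  have := @pow_cvg00 R 1 al ltr01 a0; under eq_fun do rewrite mul1r.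
  by move/cvg_trans; apply; exact: cvg_at_right_filter cvg_id.
have ci : (fun y : R => y) y @[y --> 0^'+] --> (0 : R) by exact: cvg_at_right_filter cvg_id.
have cZ k (f : R -> R) : f y @[y --> 0^'+] --> (0 : R) -> k * f y @[y --> 0^'+] --> (0 : R).
  by move=> cf; have := cvgM (cvg_cst k) cf; rewrite mulr0; apply.
have : expR (- (t * cos (al * (pi / 2)) * y `^ al)) *
    sin (s * y - t * sin (al * (pi / 2)) * y `^ al) @[y --> 0^'+] --> (0 : R).
  have e1 := cvg_comp _ _ (cvgN (cZ (t * cos (al * (pi / 2))) _ cp)) (@continuous_expR R _).
  have e2 := cvg_comp _ _ (cvgB (cZ s _ ci) (cZ (t * sin (al * (pi / 2))) _ cp))
    (@continuous_sin R _).
  have FF : Filter ((0 : R)^'+) by exact: at_right_proper_filter.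
  by have := cvgM (e1 FF) (e2 FF); rewrite subrr sin0 mulr0; apply.
apply: cvg_trans; apply: near_eq_cvg; near=> y.
by rewrite Im_FlineE.
Unshelve. all: by end_near. Qed.

(* The Mainardi kernel at t = 1, its contour opened to the rays arg z = +- pi / (1 + al),
   along which both exp z and exp (- t z^al) decay. *)
Definition wright t : R := pi^-1 * \int[mu]_(u in H) (Im (Wray al 1 t (ln u) q0) / u).

Lemma stable_wright t : 0 < t -> stable al t 1 = al * t * wright t.
Proof.
move=> t0; rewrite /stable /wright mulrCA -[X in _ * X = _]mul1r; congr (_ * _).
rewrite (Fline_parts (lexx 0) al01 t0 (cvg0_Im_Fline0 _ _)); congr (_ * _).
rewrite -(rotate_W ler01 t0); apply: eq_hint => y y0.
exact: Re_kernel.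
Qed.

(** A majorant of the integrand of [wright t] that is uniform in t > 0: it keeps the decay of exp z
    only, which is available because cos q0 < 0. *)
Definition mray u := u `^ (al - 1) * expR (- (- cos q0 * u `^ 1)).

Lemma mray_hL1 : hL1 mray.
Proof. by apply: gamma_hL1 => //; rewrite oppr_gt0 cos_q0_lt0. Qed.

Lemma W_le t u : 0 < t -> 0 < u ->
  normc (Wray al 1 t (ln u) q0) / u <= mray u * expR (- (t * (cos (al * q0) * u `^ al))).
Proof.
move=> t0 u0; rewrite normc_W// expRD mul1r ler_pdivrMr// /mray (powRr1 (ltW u0)).
rewrite mulNr opprK [cos q0 * u]mulrC [cos (al * q0) * _]mulrC.
have {1}-> : u `^ al = u `^ (al - 1) * u by rewrite -{3}(powRr1 (ltW u0)) -powRDp// subrK.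
by rewrite le_eqVlt; apply/orP; left; apply/eqP; ring.
Qed.

Lemma Im_W_le t u : 0 < t -> 0 < u ->
  `|Im (Wray al 1 t (ln u) q0) / u| <= mray u * expR (- (t * (cos (al * q0) * u `^ al))).
Proof.
move=> t0 u0; apply: le_trans (W_le t0 u0).
rewrite normrM normfV (gtr0_norm u0) ler_wpM2r ?invr_ge0 ?(ltW u0)//; exact: normIm.
Qed.

Lemma Im_W_le1 t u : 0 < t -> 0 < u -> `|Im (Wray al 1 t (ln u) q0) / u| <= mray u.
Proof.
move=> t0 u0; apply: le_trans (Im_W_le t0 u0) _.
rewrite ler_piMr ?mulr_ge0 ?powR_ge0 ?expR_ge0// expR_le1 oppr_le0.
by rewrite !mulr_ge0 ?powR_ge0 ?(ltW t0) ?(ltW cos_alq0_gt0).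
Qed.

Lemma meas_W s t : measurable_fun H (fun u => Im (Wray al s t (ln u) q0) / u).
Proof.
apply: continuous_hmeas => u u0; have [_ d _ _] := holo_W al s t (ln u) q0.
have ud : u != 0 by rewrite gt_eqF.
exact: is_derive_continuous (dM (dchain d (dln u0 (dI u))) (dV ud (dI u))).
Qed.

Lemma W_hL1 t : 0 < t -> hL1 (fun u => Im (Wray al 1 t (ln u) q0) / u).
Proof. by move=> t0; apply: hL1_le (meas_W _ _) _ mray_hL1 => u u0; exact: Im_W_le1. Qed.

Definition wright_bound : R := pi^-1 * \int[mu]_(u in H) mray u.

Lemma wright_le t : 0 < t -> `|wright t| <= wright_bound.
Proof.
move=> t0; rewrite normrM ger0_norm ?invr_ge0 ?pi_ge0// ler_wpM2l ?invr_ge0 ?pi_ge0//.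
by apply: (norm_hint_le (W_hL1 t0) mray_hL1) => u u0; exact: Im_W_le1.
Qed.

End fixed.

End rays.

(** * Laplace transform of the Mainardi function and the diagonal kernel *)

Section mlap.
Context {R : realType}.
Notation mu := (@lebesgue_measure R).
Notation H := (@halfline R).
Local Notation Re := complex.Re.
Local Notation Im := complex.Im.
Local Notation normc := ComplexField.Normc.normc.
Local Notation normcM := ComplexField.Normc.normcM.
Local Open Scope complex_scope.
Implicit Types (c y t s al x e k v u q : R) (z : R[i]).

Definition diag_kernel al r : R := pi^-1 * (r `^ (al - 1) * sin (al * pi) /
  (r `^ (2 * al) + 2 * r `^ al * cos (al * pi) + 1)).

Lemma pow2 al u : u `^ (2 * al) = (u `^ al) ^+ 2.
Proof. by rewrite mulrC powRrM -powR_mulrn ?powR_ge0. Qed.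

Lemma sin_al_gt0 al : 0 < al < 1 -> 0 < sin (al * pi) :> R.
Proof.
move=> /andP[a0 a1]; apply: sin_gt0_pi.
by rewrite mulr_gt0 ?pi_gt0//= gtr_pMl ?pi_gt0.
Qed.

Lemma quad_ge (x l c q : R) : 0 <= x -> 0 <= l -> q <= c ->
  l ^+ 2 * (1 - q ^+ 2) <= x ^+ 2 + 2 * x * c * l + l ^+ 2.
Proof.
move=> x0 l0 qc; have h : 0 <= 2 * x * l * (c - q) by rewrite !mulr_ge0// subr_ge0.
rewrite -subr_ge0 (_ : _ - _ = (x + l * q) ^+ 2 + 2 * x * l * (c - q)); last by ring.
by rewrite addr_ge0// sqr_ge0.
Qed.

Lemma normc_AD al l u q : 0 < u -> normc (Aray al (ln u) q + l%:C) =
  Num.sqrt ((u `^ al) ^+ 2 + 2 * u `^ al * cos (al * q) * l + l ^+ 2).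
Proof.
move=> u0; rewrite (_ : Aray al (ln u) q + l%:C =
    (u `^ al * cos (al * q) + l) +i* (u `^ al * sin (al * q))); last first.
  by apply: complex_eq; rewrite ?cReD ?cImD /= ?Re_A ?Im_A ?addr0.
rewrite /=; congr Num.sqrt.
have := cos2Dsin2 (al * q); move: (cos _) (sin _) (_ `^ _) => C S X CS.
have -> : X ^+ 2 = X ^+ 2 * (C ^+ 2 + S ^+ 2) by rewrite CS mulr1.
ring.
Qed.

Lemma Im_frac z e l : Im (z * e%:C / (z + l%:C)) =
  e * (l * Im z) / ((Re z + l) ^+ 2 + Im z ^+ 2).
Proof.
case: z => a b; rewrite cImM cReV cImV /= !addr0.
by move: (_^-1) => d; ring.
Qed.

Section fixed.
Variable al : R.
Hypothesis al01 : 0 < al < 1.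
Let a0 : 0 < al. Proof. by case/andP: al01. Qed.
Let q0 : R := pi / (1 + al).
Let S := sin (al * pi).
Let S0 : 0 < S. Proof. exact: sin_al_gt0. Qed.
Let ang : [/\ pi / 2 < q0, q0 < pi & al * q0 < pi / 2].
Proof. exact: ray_angle (pi_gt0 R) al01. Qed.
Let q0_gt0 : 0 < q0.
Proof. by case: ang => h _ _; apply: lt_trans h; rewrite divr_gt0 ?pi_gt0. Qed.
Let qpi : q0 <= (pi : R) <= pi.
Proof. by apply/andP; split; [case: ang => _ /ltW|]. Qed.
Let k0 : 0 < - cos q0. Proof. by rewrite oppr_gt0 cos_q0_lt0. Qed.

(** For q <= pi one has cos (al q) >= cos (al pi); completing the square in |z^al + l|^2 leaves the
    factor 1 - cos^2 (al pi) = S^2. Hence no pole is met up to the negative axis. *)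
Lemma AD_ge l u q : 0 < l -> 0 < u -> q0 <= q <= pi ->
  S * l <= normc (Aray al (ln u) q + l%:C) /\ S * u `^ al <= normc (Aray al (ln u) q + l%:C).
Proof.
move=> l0 u0 /andP[q1 q2]; have [a1 al1] := andP al01.
have p0 : 0 <= q by exact: le_trans (ltW q0_gt0) q1.
have c1 : cos (al * pi) <= cos (al * q).
  apply: le_cos; rewrite ?mulr_ge0 ?(ltW a0) ?ler_wpM2l ?(ltW a0)//.
  by rewrite ger_pMl ?pi_gt0// ltW.
have SE : S ^+ 2 = 1 - cos (al * pi) ^+ 2.
  by rewrite -(cos2Dsin2 (al * pi)) addrC addKr.
have u1 : 0 <= u `^ al by exact: powR_ge0.
have SM v : 0 <= v -> S * v = Num.sqrt ((S * v) ^+ 2).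
  by move=> v0; rewrite sqrtr_sqr ger0_norm// mulr_ge0// ltW.
rewrite normc_AD// (SM _ (ltW l0)) (SM _ u1); split; rewrite ler_wsqrtr//.
  by rewrite exprMn mulrC SE quad_ge// ltW.
rewrite exprMn mulrC SE [X in _ <= X](_ : _ = l ^+ 2 + 2 * l * cos (al * q) * u `^ al + (u `^ al) ^+ 2).
  by rewrite quad_ge// ltW.
by ring.
Qed.

Variable l : R.
Hypothesis l0 : 0 < l.

Definition Vres x q := (Aray al x q + l%:C)^-1.
Definition Xray x q := Aray al x q * cexp (Eray x q).
(** z^al exp z / (z^al + l), the integrand in d(log z) of the Hankel integral for the Mittag-Leffler
    value E_al(-l). [Nray] is its logarithmic derivative. *)
Definition Yray x q := Xray x q * Vres x q.
Definition Nray x q := al%:C + (Eray x q + (- al)%:C * (Aray al x q * Vres x q)).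
Definition dVres x q := - (al%:C * Aray al x q + 0) * (Aray al x q + l%:C)^-1 ^+ 2.
Definition dNray x q : R[i] :=
  0 + (Eray x q + (- al)%:C * (al%:C * Aray al x q * Vres x q + Aray al x q * dVres x q)).

Lemma AD_neq0 x q : q0 <= q <= pi -> Aray al x q + l%:C != 0.
Proof.
move=> qq; have [+ _] := AD_ge l0 (expR_gt0 x) qq; rewrite expRK => h.
have := lt_le_trans (mulr_gt0 S0 l0) h.
by apply: contraTneq => ->; rewrite (normcR 0 : normc 0 = _) normr0 ltxx.
Qed.

Lemma holo_V x q : q0 <= q <= pi -> holo Vres x q (dVres x q).
Proof.
by move=> qq; exact: holoV (AD_neq0 x qq) (holoD (holo_A al x q) (holo_cst l%:C x q)).
Qed.

Lemma dYrayE (a A E X V : R[i]) :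
  (a * A * X + A * (E * X)) * V + (A * X) * (- (a * A + 0) * V ^+ 2) =
  (a + (E + (- a) * (A * V))) * (A * X * V).
Proof. by ring. Qed.

Lemma holo_Y x q : q0 <= q <= pi -> holo Yray x q (Nray x q * Yray x q).
Proof.
move=> qq; apply: holo_eq (holoM (holoM (holo_A al x q) (holo_exp (holo_E x q))) (holo_V x qq)) _.
by rewrite dYrayE /Nray rmorphN.
Qed.

Lemma holo_N x q : q0 <= q <= pi -> holo Nray x q (dNray x q).
Proof.
move=> qq; exact: holoD (holo_cst al%:C x q) (holoD (holo_E x q)
  (holoZ (- al)%:C (holoM (holo_A al x q) (holo_V x qq)))).
Qed.

Lemma normc_Vres u q : 0 < u -> q0 <= q <= pi ->
  normc (Vres (ln u) q) <= (S * l)^-1 /\ normc (Aray al (ln u) q * Vres (ln u) q) <= S^-1.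
Proof.
move=> u0 qq; have [h1 h2] := AD_ge l0 u0 qq; have Sl := mulr_gt0 S0 l0.
have n0 := lt_le_trans Sl h1.
rewrite normcM normc_A// /Vres ComplexField.Normc.normcV; split; first by rewrite lef_pV2.
by rewrite ler_pdivrMr// mulrC ler_pdivlMr// mulrC.
Qed.

Lemma normc_X u q : 0 < u -> q0 <= q <= pi ->
  normc (Xray (ln u) q) <= u `^ al * expR (- (- cos q0 * u `^ 1)).
Proof.
move=> u0 /andP[q1 q2]; rewrite normcM normc_A// normc_cexp Re_E//.
rewrite ler_wpM2l ?powR_ge0// ler_expR (powRr1 (ltW u0)) mulNr opprK mulrC ler_pM2r//.
by apply: le_cos q1 q2; exact: ltW.
Qed.

Lemma normc_N u q : 0 < u -> q0 <= q <= pi ->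
  normc (Nray (ln u) q) <= (1 + S^-1) * (1 + 1 * u + 0 * u `^ al).
Proof.
move=> u0 qq; apply: le_trans (normcD_le _ _) _.
have [_ al1] := andP al01; have Si : 0 <= S^-1 by rewrite invr_ge0 ltW.
have [_ h] := normc_Vres u0 qq.
have h2 : normc (Eray (ln u) q + (- al)%:C * (Aray al (ln u) q * Vres (ln u) q)) <= u + S^-1.
  apply: le_trans (normcD_le _ _) _; rewrite normc_E// lerD2l normcM normcR normrN gtr0_norm//.
  exact: le_trans (ler_piMl (normc_ge0 _) (ltW al1)) h.
rewrite normcR gtr0_norm// mul0r addr0 mul1r.
apply: (@le_trans _ _ (1 + (u + S^-1))); first exact: lerD (ltW al1) h2.
rewrite -subr_ge0 (_ : _ - _ = S^-1 * u); last by ring.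
by rewrite mulr_ge0// ltW.
Qed.

(** Beyond q0 the decay of exp z is at least exp (u cos q0), and [AD_ge] bounds the resolvent, so
    the ray can be turned as far as the cut. *)
Lemma rotate_Y :
  \int[mu]_(u in H) (Im (Yray (ln u) q0) / u) = \int[mu]_(u in H) (Im (Yray (ln u) pi) / u).
Proof.
have [K K0 HK] := ray_env a0 k0 ltr01 ler01 (lexx 0).
have Sl : 0 < (S * l)^-1 by rewrite invr_gt0 mulr_gt0.
have B0 : 0 < 1 + S^-1 by rewrite ltr_pwDl// invr_ge0 ltW.
have B1 : 1 <= 1 + S^-1 by rewrite lerDl invr_ge0 ltW.
have bY u q : 0 < u -> q0 <= q <= pi -> normc (Yray (ln u) q) <=
    (S * l)^-1 * (u `^ al * expR (- (- cos q0 * u `^ 1))).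
  move=> u0 qq; rewrite normcM mulrC; have [h _] := normc_Vres u0 qq.
  by apply: ler_pM; rewrite ?normc_ge0 ?normc_X.
have bQ u : 0 < u -> 1 <= 1 + 1 * u + 0 * u `^ al.
  by move=> u0; rewrite mul1r mul0r addr0 lerDl ltW.
have bX u : 0 < u -> 0 <= u `^ al * expR (- (- cos q0 * u `^ 1)).
  by move=> _; exact: mulr_ge0 (powR_ge0 _ _) (expR_ge0 _).
have bN u q : 0 < u -> q0 <= q <= pi -> normc (Nray (ln u) q) * normc (Yray (ln u) q) <=
    (1 + S^-1) * (S * l)^-1 * K * (u * env al u).
  move=> u0 qq.
  apply: le_trans (ler_pM (normc_ge0 _) (normc_ge0 _) (normc_N u0 qq) (bY u q u0 qq)) _.
  rewrite mulrACA -[X in _ <= X]mulrA; apply: ler_wpM2l (HK u u0).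
  exact: mulr_ge0 (ltW B0) (ltW Sl).
case: ang => _ q1 _.
apply: (@ray_rotation _ Yray (fun x q => Nray x q * Yray x q)
  (fun x q => dNray x q * Yray x q + Nray x q * (Nray x q * Yray x q))
  ((1 + S^-1) * (S * l)^-1 * K) al q0 pi q1 (mulr_gt0 (mulr_gt0 B0 Sl) K0) a0).
- by move=> x q qq; exact: holo_Y.
- by move=> x q qq; exact: holoM (holo_N _ qq) (holo_Y _ qq).
- move=> u q u0 qq; apply: le_trans (bY u q u0 qq) _.
  rewrite -[X in _ <= X]mulrA -[X in _ <= X]mulrA -[X in X <= _]mul1r.
  apply: ler_pM => //; first exact: mulr_ge0 (ltW Sl) (bX _ u0).
  rewrite (ler_pM2l Sl); apply: le_trans (HK u u0).
  exact: ler_peMl (bX _ u0) (bQ _ u0).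
- by move=> u q u0 qq; rewrite normcM; exact: bN.
Qed.

Lemma Im_Ypi u : 0 < u -> Im (Yray (ln u) pi) =
  expR (- u) * (l * u `^ al * S) / ((u `^ al) ^+ 2 + 2 * u `^ al * cos (al * pi) * l + l ^+ 2).
Proof.
move=> u0; rewrite /Yray /Xray /Vres.
have -> : cexp (Eray (ln u) pi) = (expR (- u))%:C.
  have hI : Im (Eray (ln u) pi) = 0 by rewrite Eray.unlock Im_cexp /= sinpi mulr0.
  by apply: complex_eq; rewrite ?Re_cexp ?Im_cexp hI Re_E// cospi mulrN1 ?cos0 ?sin0 ?mulr1 ?mulr0.
have qq := qpi.
rewrite Im_frac Re_A// Im_A// -/S; congr (_ / _); first by rewrite !mulrA.
have := cos2Dsin2 (al * pi); rewrite -/S; move: (cos _) S (_ `^ _) => C S' X CS.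
have -> : X ^+ 2 = X ^+ 2 * (C ^+ 2 + S' ^+ 2) by rewrite CS mulr1.
ring.
Qed.

Lemma Im_Y_le u q : q0 <= q <= pi -> 0 < u -> `|Im (Yray (ln u) q) / u| <=
  (S * l)^-1 * (u `^ (al - 1) * expR (- (- cos q0 * u `^ 1))).
Proof.
move=> qq u0; rewrite normrM normfV (gtr0_norm u0) ler_pdivrMr//; apply: le_trans (normIm _) _.
rewrite normcM mulrC -!mulrA; have [h _] := normc_Vres u0 qq.
apply: ler_pM; rewrite ?normc_ge0//; apply: le_trans (normc_X u0 qq) _.
have {1}-> : u `^ al = u `^ (al - 1) * u by rewrite -{3}(powRr1 (ltW u0)) -powRDp// subrK.
by rewrite mulrAC -mulrA.
Qed.

Lemma cont_Im_Y u q : q0 <= q <= pi -> 0 < u ->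
  {for u, continuous (fun u => Im (Yray (ln u) q) / u)}.
Proof.
move=> qq u0; have [_ d _ _] := holo_Y (ln u) qq; have ud : u != 0 by rewrite gt_eqF.
exact: is_derive_continuous (dM (dchain d (dln u0 (dI u))) (dV ud (dI u))).
Qed.

Lemma Im_Y_hL1 q : q0 <= q <= pi -> hL1 (fun u => Im (Yray (ln u) q) / u).
Proof.
move=> qq; apply: (hL1_le _ (fun u => Im_Y_le qq) (hL1Z _ (gamma_hL1 a0 k0 ltr01))).
by apply: continuous_hmeas => u; exact: cont_Im_Y.
Qed.

Lemma Im_W_split t u : 0 < u -> expR (- (l * t)) * (Im (Wray al 1 t (ln u) q0) / u) =
  u^-1 * Im (Xray (ln u) q0 * cexp (- (t%:C * (Aray al (ln u) q0 + l%:C)))).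
Proof.
move=> u0; rewrite mulrA mulrC; congr (_ * _).
have -> : Xray (ln u) q0 * cexp (- (t%:C * (Aray al (ln u) q0 + l%:C))) =
    (expR (- (l * t)))%:C * Wray al 1 t (ln u) q0.
  have -> : - (t%:C * (Aray al (ln u) q0 + l%:C)) =
      (- t)%:C * Aray al (ln u) q0 + (- (l * t))%:C.
    by rewrite mulrDr opprD !rmorphN rmorphM mulNr [l%:C * _]mulrC.
  have -> : (expR (- (l * t)))%:C = cexp (- (l * t))%:C.
    by apply: complex_eq; rewrite ?Re_cexp ?Im_cexp /= ?cos0 ?sin0 ?mulr1 ?mulr0.
  by rewrite /Wray /Xray rmorph1 mul1r !cexpD; ring.
by rewrite cImM /= mul0r addr0.
Qed.

(** Joint measurability does not follow from continuity in u for each t. It is read off an expansion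
    into real factors, each measurable in the pair. *)
Lemma meas_W2 : measurable_fun (H `*` H)
  (fun z : R * R => Im (Wray al 1 z.1 (ln z.2) q0) / z.2).
Proof.
have mH := @measurable_halfline R.
have mHH : measurable (H `*` H : set (R * R)) by exact: measurableX.
have mc (f : R -> R) : (forall u, 0 < u -> {for u, continuous f}) ->
    measurable_fun (H `*` H) (fun z : R * R => f z.2).
  by move=> cf; apply: measurable_HH2; exact: continuous_hmeas.
have mp p k : measurable_fun (H `*` H) (fun z : R * R => k * z.2 `^ p).
  by apply: (mc (fun u => k * u `^ p)) => u u0; exact: is_derive_continuous (dZ k (dpow p u0)).
have m1 : measurable_fun (H `*` H) (fun z : R * R => z.1).
  by apply: measurable_funTS; exact: measurable_fst.
pose A1 (z : R * R) := cos (al * q0) * z.2 `^ al.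
pose A2 (z : R * R) := sin (al * q0) * z.2 `^ al.
pose e (z : R * R) := expR (cos q0 * z.2 `^ 1 - z.1 * A1 z).
pose a (z : R * R) := sin q0 * z.2 `^ 1 - z.1 * A2 z.
have me : measurable_fun (H `*` H) e.
  apply: measurableT_comp => //; apply: measurable_funB; first exact: mp.
  by apply: measurable_funM; [exact: m1|exact: mp].
have ma : measurable_fun (H `*` H) a.
  apply: measurable_funB; first exact: mp.
  by apply: measurable_funM; [exact: m1|exact: mp].
apply: (@eq_measurable_fun _ _ _ _ _
  (fun z : R * R => (A1 z * (e z * sin (a z)) + A2 z * (e z * cos (a z))) * z.2^-1)).
  move=> [t u]; rewrite inE => -[/= _]; rewrite halflineE => u0; congr (_ * _).
  rewrite /Wray rmorph1 mul1r cImM Re_cexp Im_cexp cReD cImD Re_realM.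
  rewrite cImM /= mul0r addr0 Re_A// Im_A// Re_E//.
  rewrite /A1 /A2 /e /a /A1 /A2 /= (powRr1 (ltW u0)).
  have -> : Im (Eray (ln u) q0) = u * sin q0 by rewrite Eray.unlock Im_cexp /= lnK ?posrE.
  by rewrite ![_ * cos q0]mulrC ![u * _]mulrC ![u `^ al * _]mulrC !mulNr.
apply: measurable_funM; last first.
  by apply: (mc (fun u => u^-1)) => u u0; apply: cvgV; [rewrite gt_eqF|].
apply: measurable_funD; (apply: measurable_funM; first exact: mp); apply: measurable_funM => //.
  by apply: measurableT_comp => //; apply: continuous_measurable_fun; exact: continuous_sin.
by apply: measurableT_comp => //; apply: continuous_measurable_fun; exact: continuous_cos.
Qed.

(** Fubini rests on the product majorant exp (- l t) [mray] u. The inner integral of exp (- t (z^al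
    + l)) converges since z^al has positive real part on the opened ray. *)
Lemma lap_wright_Y : \int[mu]_(t in H) (expR (- (l * t)) * wright al t) =
  pi^-1 * \int[mu]_(u in H) (Im (Yray (ln u) q0) / u).
Proof.
pose k t u := pi^-1 * (expR (- (l * t)) * (Im (Wray al 1 t (ln u) q0) / u)).
have Ie : hL1 (fun t => expR (- (l * t))).
  by apply: eq_hL1 (expN_hL1 l0 ltr01) => s s0; rewrite (powRr1 (ltW s0)).
have F : \int[mu]_(t in H) (\int[mu]_(u in H) k t u) = \int[mu]_(u in H) (\int[mu]_(t in H) k t u).
  apply: (hFubini (g := fun t => expR (- (l * t))) (h := fun u => pi^-1 * mray al u)
    _ Ie (hL1Z _ (mray_hL1 al01))).
  - apply: measurable_funM; first exact: measurable_cst.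
    apply: measurable_funM; first exact: measurable_HH1 (hL1_meas Ie).
    exact: meas_W2.
  - move=> t u t0 u0; rewrite normrM ger0_norm ?invr_ge0 ?pi_ge0// [leRHS]mulrCA.
    rewrite ler_wpM2l ?invr_ge0 ?pi_ge0// normrM ger0_norm ?expR_ge0//.
    by rewrite ler_wpM2l ?expR_ge0// Im_W_le1.
rewrite (eq_hint (g := fun t => \int[mu]_(u in H) k t u)); last first.
  move=> t t0; rewrite /wright mulrCA /k hintZ; first by rewrite hintZ//; exact: W_hL1.
  by apply: hL1Z; exact: W_hL1.
have qq : q0 <= q0 <= pi by rewrite lexx /=; case: ang => _ /ltW.
rewrite F -(hintZ _ (Im_Y_hL1 qq)); apply: eq_hint => u u0.
have z0 : 0 < Re (Aray al (ln u) q0 + l%:C).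
  rewrite cReD Re_A//; exact: addr_gt0 (mulr_gt0 (powR_gt0 _ u0) (cos_alq0_gt0 al01)) l0.
have Ix := lap_cexp_hL1 (Xray (ln u) q0) z0.
rewrite (eq_hint (g := fun t => pi^-1 * (u^-1 *
    Im (Xray (ln u) q0 * cexp (- (t%:C * (Aray al (ln u) q0 + l%:C))))))); last first.
  by move=> t t0; rewrite /k Im_W_split.
rewrite (hintZ _ (hL1Z _ Ix)) (hintZ _ Ix) lap_cexp//.
by congr (_ * _); rewrite mulrC.
Qed.

Lemma diag_kernelE r : pi * diag_kernel al r = r `^ (al - 1) * S / ((r `^ al) ^+ 2 + 2 * r `^ al * cos (al * pi) + 1).
Proof. by rewrite /diag_kernel mulrA mulfV ?mul1r ?pow2// lt0r_neq0// pi_gt0. Qed.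

End fixed.

Lemma cos_al_gtN1 al : 0 < al < 1 -> 0 < 1 + cos (al * pi) :> R.
Proof.
move=> /andP[a0 a1]; have p0 := pi_gt0 R.
rewrite -ltrBlDl sub0r -(@cospi R); apply: lt_cos => //.
  by rewrite mulr_ge0 ?pi_ge0 ?ltW.
by rewrite gtr_pMl.
Qed.

(** The difference is (1 - q) / 2 (1 - x)^2. The bound compares the denominator of [diag_kernel]
    with that of the envelope. *)
Lemma den_ge x q : q <= 1 -> (1 + q) / 2 * (1 + x) ^+ 2 <= x ^+ 2 + 2 * x * q + 1.
Proof.
move=> q1; rewrite -subr_ge0 (_ : _ - _ = (1 - q) / 2 * (1 - x) ^+ 2); last by field.
by rewrite mulr_ge0 ?sqr_ge0// divr_ge0// subr_ge0.
Qed.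

Lemma den_gt0 al x : 0 < al < 1 -> 0 <= x -> 0 < x ^+ 2 + 2 * x * cos (al * pi) + 1.
Proof.
move=> al01 x0; apply: lt_le_trans (den_ge x (cos_le1 _)).
rewrite mulr_gt0 ?divr_gt0 ?cos_al_gtN1// exprn_gt0//.
by rewrite ltr_pwDl.
Qed.

Lemma den_scale (e l r S x y c : R) : l != 0 -> r != 0 -> y != 0 ->
  x ^+ 2 + 2 * x * c + 1 != 0 ->
  l * (e * (y * (y * x) * S) / ((y * x) ^+ 2 + 2 * (y * x) * c * y + y ^+ 2) / (l * r)) =
  e * (x / r * S / (x ^+ 2 + 2 * x * c + 1)).
Proof.
move=> l0 r0 y0 D0.
have -> : (y * x) ^+ 2 + 2 * (y * x) * c * y + y ^+ 2 = y ^+ 2 * (x ^+ 2 + 2 * x * c + 1) by ring.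
by field; rewrite D0 l0 r0 y0.
Qed.

(** With transform variable l^al the denominator is homogeneous under u = l r, and all powers of l
    cancel. *)
Lemma Ypi_subst al l r : 0 < al < 1 -> 0 < l -> 0 < r ->
  l * (Im (Yray al (l `^ al) (ln (l * r)) pi) / (l * r)) =
  pi * (expR (- (l * r)) * diag_kernel al r).
Proof.
move=> al01 l0 r0; have lr0 : 0 < l * r by rewrite mulr_gt0.
have L0 : 0 < l `^ al by rewrite powR_gt0.
rewrite [RHS]mulrCA diag_kernelE// Im_Ypi// powRM ?ltW//.
have -> : r `^ (al - 1) = r `^ al * r^-1 by rewrite powRDp// powRN powRr1 ?ltW.
by apply: den_scale; rewrite gt_eqF// den_gt0// powR_ge0.
Qed.

Lemma hL1_damp (f : R -> R) l : 0 < l -> hL1 f -> hL1 (fun r => expR (- (l * r)) * f r).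
Proof.
move=> l0 If; apply: (hL1_le _ _ (hL1_norm If)).
  apply: measurable_funM; last exact: hL1_meas If.
  by apply: continuous_hmeas => r _; exact: is_derive_continuous (dexp (dN (dZ l (dI r)))).
by move=> r r0; apply: norm_expNM; rewrite mulr_ge0 ?ltW.
Qed.

Section diag_kernel.
Variable al : R.
Hypothesis al01 : 0 < al < 1.
Let a0 : 0 < al. Proof. by case/andP: al01. Qed.

Lemma diag_kernel_cont r : 0 < r -> {for r, continuous (diag_kernel al)}.
Proof.
move=> r0; have D0 := den_gt0 al01 (powR_ge0 r al).
have D1 : r `^ (2 * al) + 2 * r `^ al * cos (al * pi) + 1 != 0 by rewrite pow2 gt_eqF.
exact: is_derive_continuous (dZ pi^-1 (dM (dM (dpow (al - 1) r0) (dC r _))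
  (dV (f := fun r => r `^ (2 * al) + 2 * r `^ al * cos (al * pi) + 1) D1
    (dD (dD (dpow (2 * al) r0) (dM (dZ 2 (dpow al r0)) (dC r _))) (dC r 1))))).
Qed.

Lemma diag_kernel_le : exists2 K : R, 0 < K & forall r, 0 < r -> `|diag_kernel al r| <= K * env al r.
Proof.
have q0 := cos_al_gtN1 al01; have S0 := sin_al_gt0 al01.
exists (pi^-1 * (sin (al * pi) * ((1 + cos (al * pi)) / 2)^-1)) => [|r r0].
  by rewrite !mulr_gt0 ?invr_gt0 ?pi_gt0// divr_gt0.
have x0 := powR_ge0 r al; have D0 := den_gt0 al01 x0.
have E0 : 0 < (1 + r `^ al) ^+ 2 by rewrite exprn_gt0// ltr_pwDl.
rewrite /diag_kernel pow2 ger0_norm; last first.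
  by rewrite mulr_ge0 ?invr_ge0 ?pi_ge0// divr_ge0 ?(ltW D0)// mulr_ge0 ?powR_ge0// ltW.
rewrite -[leRHS]mulrA ler_wpM2l ?invr_ge0 ?pi_ge0// /env mulrACA.
rewrite [sin (al * pi) * _]mulrC ler_wpM2l ?mulr_ge0 ?powR_ge0 ?(ltW S0)//.
rewrite -invfM lef_pV2 ?posrE//.
  by rewrite den_ge// cos_le1.
by rewrite mulr_gt0// divr_gt0.
Qed.

Lemma diag_kernel_hL1 : hL1 (diag_kernel al).
Proof.
have [K _ HK] := diag_kernel_le; apply: (hL1_le _ HK (hL1Z K (env_hL1 a0))).
by apply: continuous_hmeas => r; exact: diag_kernel_cont.
Qed.

(** The transform of [wright] is taken at l^al because this is the value that superposition with the
    Levy kernel produces. *)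
Lemma lap_diag_kernel l : 0 < l -> \int[mu]_(t in H) (expR (- (l `^ al * t)) * wright al t) =
  \int[mu]_(r in H) (expR (- (l * r)) * diag_kernel al r).
Proof.
move=> l0; have L0 : 0 < l `^ al by rewrite powR_gt0.
have [_ q1 _] := ray_angle (pi_gt0 R) al01.
have qq : pi / (1 + al) <= (pi : R) <= pi by rewrite (ltW q1) /=.
rewrite (lap_wright_Y al01 L0) (rotate_Y al01 L0).
rewrite -(hint_subst l0 (oner_neq0 R) (fun u => cont_Im_Y al01 L0 qq) (Im_Y_hL1 al01 L0 qq)).
have Ie := hL1_damp l0 diag_kernel_hL1.
rewrite (eq_hint (g := fun r => pi * (expR (- (l * r)) * diag_kernel al r))); last first.
  move=> r r0; rewrite normr1 mul1r subrr powRr0 mulr1 (powRr1 (ltW r0)).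
  exact: Ypi_subst.
by rewrite (hintZ _ Ie) mulrA mulVf ?mul1r// lt0r_neq0// pi_gt0.
Qed.

End diag_kernel.
End mlap.

(** * Superposition *)

Section super.
Context {R : realType}.
Notation mu := (@lebesgue_measure R).
Notation H := (@halfline R).
Local Notation Re := complex.Re.
Local Notation Im := complex.Im.
Local Open Scope complex_scope.
Implicit Types (c y t s al x e k v u q r : R) (z : R[i]).

Lemma Fline_scale al t s k v : 0 < k -> 0 < v ->
  Fline al t s 0 (k * v) = Fline al (t * k `^ al) (s * k) 0 v.
Proof.
move=> k0 v0; have kv := mulr_gt0 k0 v0.
rewrite /Fline -!A_pi2//.
have -> : Aray al (ln (k * v)) (pi / 2) = (k `^ al)%:C * Aray al (ln v) (pi / 2).
  apply: complex_eq; rewrite ?Re_realM ?cImM /= ?mul0r ?addr0.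
    by rewrite !Re_A// powRM ?ltW// -mulrA.
  by rewrite !Im_A// powRM ?ltW// -mulrA.
have -> : s%:C * (0 +i* (k * v)) = (s * k)%:C * (0 +i* v).
  by apply: complex_eq; rewrite ?cReM ?cImM /=; ring.
by rewrite [X in cexp (_ + X)]mulrA -rmorphM mulNr.
Qed.

Lemma powR_cancel (p x : R) : p != 0 -> 0 < x -> (x `^ (- (1 / p))) `^ p = x^-1.
Proof. by move=> p0 x0; rewrite div1r -powRrM mulNr mulVf// powRN powRr1// ltW. Qed.

(** Half of the exponent a is given up to absorb the singularity x^(-a/2) at 0; the rest still makes
    an integrable envelope. *)
Lemma pow_env_half a x : 0 < a -> 0 < x -> x `^ (- (a / 2)) * env a x <= 4 * env (a / 2) x.
Proof.
move=> a0 x0; have a2 : 0 < a / 2 by rewrite divr_gt0.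
have n0 : 0 <= x `^ (- (a / 2)) * env a x by rewrite mulr_ge0 ?powR_ge0 ?env_ge0.
rewrite -(ger0_norm n0) -[4]mul1r.
apply: (env_bound a2 ler01 x0) => x1; rewrite (ger0_norm n0) mul1r.
  have -> : a / 2 - 1 = - (a / 2) + (a - 1) by field.
  by rewrite (powRDp _ _ x0) ler_wpM2l ?powR_ge0// env_le_left.
apply: le_trans (_ : x `^ (- (a / 2)) * x `^ (- a - 1) <= _).
  by rewrite ler_wpM2l ?powR_ge0// env_le_right.
rewrite -powRDp//; apply: ler_powR => //; lra.
Qed.

Section fixed.
Variable al : R.
Hypothesis al01 : 0 < al < 1.
Let a0 : 0 < al. Proof. by case/andP: al01. Qed.
Let ad : al != 0. Proof. by rewrite gt_eqF. Qed.

Lemma stable_scale t s k : 0 < k -> 0 < t -> stable al t s = k * stable al (t * k `^ al) (s * k).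
Proof.
move=> k0 t0; have tk : 0 < t * k `^ al by rewrite mulr_gt0 ?powR_gt0.
rewrite /stable [RHS]mulrCA; congr (_ * _).
rewrite -(hintZ _ (hL1_Fline (s * k) al01 tk (lexx 0))).
rewrite -(hint_subst k0 (oner_neq0 R) (@cont_Re_Fline R al t s 0) (hL1_Fline s al01 t0 (lexx 0))).
apply: eq_hint => v v0; rewrite normr1 mul1r subrr powRr0 mulr1 (powRr1 (ltW v0)).
by rewrite Fline_scale.
Qed.

Lemma stable_unit t s : 0 < t -> stable al t s = t `^ (- (1 / al)) * stable al 1 (s * t `^ (- (1 / al))).
Proof.
move=> t0; rewrite (stable_scale s (powR_gt0 (- (1 / al)) t0) t0).
by rewrite powR_cancel// mulfV// gt_eqF.
Qed.

(** The kernel is bounded near 0. For x > 1, scaling to time x^(-al) and [stable_wright] give al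
    x^(-1-al) wright (x^(-al)) with [wright] bounded; every smaller e follows. *)
Lemma stable_unit_le : exists2 C : R, 0 < C &
  forall e x, 0 <= e -> e <= 1 + al -> 0 < x -> `|stable al 1 x| <= C * x `^ (- e).
Proof.
have F0 := stable_bound_ge0 al 1.
have M0 : 0 <= wright_bound al by apply: le_trans (normr_ge0 _) (wright_le al01 ltr01).
exists (1 + stable_bound al 1 + al * wright_bound al) => [|e x e0 e1 x0].
  by rewrite -addrA ltr_pwDl// addr_ge0// mulr_ge0// ltW.
have [x1|/ltW x1] := leP x 1.
  apply: le_trans (stable_bounded al01 ltr01 x) _.
  apply: (@le_trans _ _ (1 + stable_bound al 1 + al * wright_bound al)).
    by rewrite -addrA addrCA lerDl addr_ge0// mulr_ge0 ?(ltW a0).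
  apply: (ler_peMr (addr_ge0 (addr_ge0 ler01 F0) (mulr_ge0 (ltW a0) M0))).
  by rewrite powRN invf_ge1 ?powR_gt0// powR_le1.
have t0 : 0 < x `^ (- al) by rewrite powR_gt0.
have tx : (x `^ (- al)) `^ (- (1 / al)) = x.
  by rewrite -powRrM mulrNN div1r mulfV// powRr1// ltW.
have := stable_unit 1 t0; rewrite tx mul1r (stable_wright al01 t0) => h.
have -> : stable al 1 x = al * wright al (x `^ (- al)) * x `^ (- (1 + al)).
  apply: (mulfI (lt0r_neq0 x0)); rewrite -h opprD powRDp// [x `^ (- 1)]powRN powRr1 ?(ltW x0)//.
  by move: (wright al _) => m; move: (x `^ (- al)) => X; field; exact: lt0r_neq0.
rewrite normrM [X in _ * X]ger0_norm ?powR_ge0//; apply: ler_pM; rewrite ?powR_ge0//.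
  rewrite normrM gtr0_norm//; apply: (@le_trans _ _ (al * wright_bound al)).
    by rewrite ler_pM2l// wright_le.
  by rewrite lerDr addr_ge0.
by apply: ler_powR => //; rewrite lerN2.
Qed.

(** The value e = 0 is used for convergence of the superposition, e = a / 2 for Fubini in its
    Laplace transform, and e = 1 for the t^(-2) decay of [wright]. *)
Lemma stable_le : exists2 C : R, 0 < C & forall e t s, -1 <= e -> al * e <= 1 -> 0 < t -> 0 < s ->
  `|stable al t s| <= C * (t `^ (- e) * s `^ (al * e - 1)).
Proof.
have [C C0 HC] := stable_unit_le; exists C => // e t s e1 ae t0 s0.
have t1 : 0 < t `^ (- (1 / al)) by rewrite powR_gt0.
rewrite (stable_unit _ t0) normrM ger0_norm ?powR_ge0//.
have h1 : 0 <= 1 - al * e by rewrite subr_ge0.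
have h2 : 1 - al * e <= 1 + al.
  by rewrite lerD2l -mulrN ger_pMr// lerNl.
apply: le_trans (ler_wpM2l (ltW t1) (HC _ _ h1 h2 (mulr_gt0 s0 t1))) _.
rewrite mulrCA ler_pM2l// powRM ?(ltW s0) ?(ltW t1)// opprB mulrCA mulrC ler_pM2r ?powR_gt0//.
rewrite -powRrM -powRDp// (_ : _ + _ = - e)//.
by field.
Qed.

Lemma stable_cont_t t s : 0 < t -> {for t, continuous (fun t => stable al t s)}.
Proof.
move=> t0; pose g t := t `^ (- (1 / al)) * stable al 1 (s * t `^ (- (1 / al))).
have cg : {for t, continuous g}.
  have cp := is_derive_continuous (dpow (- (1 / al)) t0).
  apply: cvgM; first exact: cp.
  apply: (@continuous_comp _ _ _ (fun t => s * t `^ (- (1 / al))) (stable al 1)).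
    by apply: cvgM; [exact: cvg_cst|exact: cp].
  exact: stable_cont.
rewrite /prop_for /continuous_at (stable_unit _ t0).
apply: cvg_trans cg; apply: near_eq_cvg; near=> u.
by rewrite /g -stable_unit//; near: u; exact: near_halfline.
Unshelve. all: by end_near. Qed.

Lemma wrightE t : 0 < t -> wright al t = stable al t 1 * (al * t)^-1.
Proof. by move=> t0; rewrite stable_wright// mulrAC mulfV ?mul1r// gt_eqF// mulr_gt0. Qed.

Lemma wright_cont t : 0 < t -> {for t, continuous (wright al)}.
Proof.
move=> t0; have at0 : al * t != 0 by rewrite gt_eqF// mulr_gt0.
rewrite /prop_for /continuous_at wrightE//.
have cg : stable al u 1 * (al * u)^-1 @[u --> t] --> stable al t 1 * (al * t)^-1.
  apply: cvgM; first exact: stable_cont_t.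
  exact: is_derive_continuous (dV at0 (dZ al (dI t))).
apply: cvg_trans cg; apply: near_eq_cvg; near=> u.
by rewrite wrightE//; near: u; exact: near_halfline.
Unshelve. all: by end_near. Qed.

Lemma wright_env : exists2 K : R, 0 < K & forall t, 0 < t -> `|wright al t| <= K * env 1 t.
Proof.
have [C C0 HC] := stable_le; have aC : 0 < C / al by rewrite divr_gt0.
have M0 : 0 <= wright_bound al by apply: le_trans (normr_ge0 _) (wright_le al01 ltr01).
exists ((C / al + wright_bound al) * 4) => [|t t0]; first by rewrite mulr_gt0// ltr_pwDl.
apply: env_bound => // [|_|t1]; first by rewrite addr_ge0// ltW.
  rewrite subrr powRr0 mulr1; apply: le_trans (wright_le al01 t0) _.
  by rewrite lerDr ltW.
rewrite wrightE// normrM normfV (gtr0_norm (mulr_gt0 a0 t0)).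
have h1 : -1 <= (1 : R) by lra.
have h2 : al * 1 <= 1 by rewrite mulr1; case/andP: al01 => _ /ltW.
rewrite ler_pdivrMr ?mulr_gt0//; apply: le_trans (HC 1 t 1 h1 h2 t0 ltr01) _.
rewrite powR1 mulr1 (_ : - 1 - 1 = - 1 + - 1)// (powRDp _ _ t0).
have -> : (C / al + wright_bound al) * (t `^ (- 1) * t `^ (- 1)) * (al * t) =
    (C + al * wright_bound al) * t `^ (- 1) * (t `^ (- 1) * t).
  by move: (t `^ (-1)) => T; field.
rewrite [X in _ * (X * t)]powRN powRr1 ?(ltW t0)// mulVf ?gt_eqF// mulr1.
by rewrite ler_wpM2r ?powR_ge0// lerDl mulr_ge0// ltW.
Qed.

Lemma levy_stable c t s : 0 < c -> 0 < t -> levy_kernel c al t s = stable al t s.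
Proof. by move=> c0 t0; rewrite levy_indep. Qed.

Lemma mainardi_stable c t s : 0 < c -> 0 < t -> al * t * mainardi_kernel c al s t = s * stable al t s.
Proof. by move=> c0 t0; rewrite -levy_mainardi// levy_stable. Qed.

Lemma mainardi_wright c t : 0 < c -> 0 < t -> mainardi_kernel c al 1 t = wright al t.
Proof.
move=> c0 t0; rewrite wrightE// -[stable al t 1]mul1r -(mainardi_stable 1 c0 t0) mulrAC mulfV ?mul1r//.
by rewrite gt_eqF// mulr_gt0.
Qed.

Section superposition.
Variables (a K : R) (g : R -> R).
Hypotheses (a01 : 0 < a <= 1) (K0 : 0 < K).
Hypothesis cg : forall x, 0 < x -> {for x, continuous g}.
Hypothesis bg : forall x, 0 < x -> `|g x| <= K * env a x.
Let a_gt0 : 0 < a. Proof. by case/andP: a01. Qed.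

(** The density [g] is left general so that one computation serves both [wright], with a = 1, and
    [diag_kernel], with a = beta and index alpha / beta. *)
Definition superpose r : R := \int[mu]_(x in H) (g x * stable al x r).

Let mint r : measurable_fun H (fun x => g x * stable al x r).
Proof. by apply: continuous_hmeas => x x0; apply: cvgM; [exact: cg|exact: stable_cont_t]. Qed.

Let bint C r : (forall e t s, -1 <= e -> al * e <= 1 -> 0 < t -> 0 < s ->
    `|stable al t s| <= C * (t `^ (- e) * s `^ (al * e - 1))) -> 0 < r ->
  forall x, 0 < x -> `|g x * stable al x r| <= C * r^-1 * K * env a x.
Proof.
move=> HC r0 x x0; rewrite normrM mulrC -[leRHS]mulrA; apply: ler_pM => //; last exact: bg.
have h1 : -1 <= (0 : R) by lra.
have h2 : al * 0 <= 1 by rewrite mulr0.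
have := HC 0 x r h1 h2 x0 r0.
by rewrite mulr0 sub0r oppr0 powRr0 mul1r powRN powRr1// ltW.
Qed.

Lemma superpose_int r : 0 < r -> hL1 (fun x => g x * stable al x r).
Proof.
move=> r0; have [C C0 HC] := stable_le.
exact: hL1_le (mint r) (bint HC r0) (hL1Z _ (env_hL1 a_gt0)).
Qed.

Lemma superpose_cont r : 0 < r -> {for r, continuous superpose}.
Proof.
move=> r0; have [C C0 HC] := stable_le; have r2 : 0 < r / 2 by rewrite divr_gt0.
have rr : r / 2 < r < r + 1 by apply/andP; split; lra.
apply: (hcont rr _ _ _ (hL1Z (C * (r / 2)^-1 * K) (env_hL1 a_gt0))) => [s _|s x _ x0|s x sr x0].
- exact: mint.
- by apply: cvgM; [exact: cvg_cst|exact: stable_cont].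
- have /andP[s1 _] := sr; have s0 := lt_trans r2 s1.
  apply: le_trans (bint HC s0 x0) _.
  rewrite ler_wpM2r ?env_ge0// ler_wpM2r ?(ltW K0)// ler_wpM2l ?(ltW C0)//.
  by rewrite lef_pV2 ?posrE// ltW.
Qed.

Section laplace.
Variable l : R.
Hypothesis l0 : 0 < l.
Let p := al * (a / 2).
Let p0 : 0 < p. Proof. by rewrite mulr_gt0// divr_gt0. Qed.

Let G r := r `^ (p - 1) * expR (- (l * r `^ 1)).
Let IG : hL1 G. Proof. exact: gamma_hL1 p0 l0 ltr01. Qed.

(** With e = 0 the majorant in r would be 1/r near 0. Taking e = a / 2 gives r^(p-1) with p > 0, at
    the price of x^(-a/2), which [pow_env_half] absorbs. *)
Let bk C : 0 < C -> (forall e t s, -1 <= e -> al * e <= 1 -> 0 < t -> 0 < s ->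
    `|stable al t s| <= C * (t `^ (- e) * s `^ (al * e - 1))) ->
  forall r x, 0 < r -> 0 < x ->
  `|expR (- (l * r)) * (g x * stable al x r)| <= (C * K * 4 * G r) * env (a / 2) x.
Proof.
move=> C0 HC r x r0 x0; have /andP[_ a1] := a01.
have h1 : -1 <= a / 2 by apply: le_trans (ltW (divr_gt0 a_gt0 (ltr0Sn R 1))); rewrite lerN10.
have h2 : al * (a / 2) <= 1.
  have /andP[_ al1] := al01; rewrite mulr_ile1 ?(ltW a0) ?(ltW al1)//.
    by rewrite divr_ge0// ltW.
  by rewrite ler_pdivrMr// mul1r (le_trans a1)// ler1n.
have hf := HC _ x r h1 h2 x0 r0.
rewrite normrM ger0_norm ?expR_ge0// normrM.
apply: (@le_trans _ _ (expR (- (l * r)) * ((K * env a x) * (C * (x `^ (- (a / 2)) * r `^ (p - 1)))))).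
  by rewrite ler_wpM2l ?expR_ge0// ler_pM// bg.
rewrite [X in X <= _](_ : _ = (C * K * G r) * (x `^ (- (a / 2)) * env a x)); last first.
  by rewrite /G (powRr1 (ltW r0)); ring.
rewrite [X in _ <= X](_ : _ = (C * K * G r) * (4 * env (a / 2) x)); last by ring.
rewrite ler_wpM2l ?pow_env_half//.
by rewrite !mulr_ge0 ?powR_ge0 ?expR_ge0 ?(ltW C0) ?(ltW K0).
Qed.

Lemma superpose_lap_hL1 : hL1 (fun r => expR (- (l * r)) * superpose r).
Proof.
have [C C0 HC] := stable_le.
apply: (hL1_le _ _ (hL1Z (C * K * 4 * \int[mu]_(x in H) env (a / 2) x) IG)).
  apply: continuous_hmeas => r r0; apply: cvgM; last exact: superpose_cont.
  exact: is_derive_continuous (dexp (dN (dZ l (dI r)))).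
move=> r r0; have a2 : 0 < a / 2 by rewrite divr_gt0.
rewrite /superpose -(hintZ _ (superpose_int r0)).
apply: le_trans (norm_hint_le (hL1Z _ (superpose_int r0)) (hL1Z (C * K * 4 * G r) (env_hL1 a2)) _) _.
  by move=> x x0; exact: bk.
by rewrite (hintZ _ (env_hL1 a2)) mulrAC.
Qed.

Lemma superpose_lap : \int[mu]_(r in H) (expR (- (l * r)) * superpose r) =
  \int[mu]_(x in H) (expR (- (l `^ al * x)) * g x).
Proof.
have [C C0 HC] := stable_le; have a2 : 0 < a / 2 by rewrite divr_gt0.
have mH := @measurable_halfline R.
have mHH : measurable (H `*` H : set (R * R)) by exact: measurableX.
rewrite (eq_hint (g := fun r => \int[mu]_(x in H) (expR (- (l * r)) * (g x * stable al x r)))); last first.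
  by move=> r r0; rewrite (hintZ _ (superpose_int r0)).
rewrite (hFubini (f := fun r x => expR (- (l * r)) * (g x * stable al x r)) _
  (hL1Z (C * K * 4) IG) (env_hL1 a2) (bk C0 HC)); last first.
  apply: measurable_funM.
    apply: (measurable_HH1 (f := fun r => expR (- (l * r)))).
    by apply: continuous_hmeas => r r0; exact: is_derive_continuous (dexp (dN (dZ l (dI r)))).
  apply: measurable_funM; first by apply: measurable_HH2; exact: continuous_hmeas.
  have mp : measurable_fun (H `*` H) (fun z : R * R => z.2 `^ (- (1 / al))).
    apply: (measurable_HH2 (f := fun x => x `^ (- (1 / al)))).
    by apply: continuous_hmeas => x x0; exact: is_derive_continuous (dpow _ x0).
  (* Scaling expresses the kernel through the continuous function [stable al 1] of one variable,
     which settles joint measurability. *)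
  apply: (@eq_measurable_fun _ _ _ _ _
    (fun z : R * R => z.2 `^ (- (1 / al)) * stable al 1 (z.1 * z.2 `^ (- (1 / al))))).
    by move=> [r x]; rewrite inE => -[/= _]; rewrite halflineE => x0; rewrite -stable_unit.
  apply: measurable_funM => //; apply: (measurableT_comp (f := stable al 1)).
    by apply: continuous_measurable_fun => x; exact: stable_cont.
  by apply: measurable_funM => //; apply: measurable_funTS; exact: measurable_fst.
apply: eq_hint => x x0.
rewrite (eq_hint (g := fun r => g x * (expR (- (l * r)) * stable al x r))); last first.
  by move=> r r0; rewrite mulrCA.
by rewrite (hintZ _ (lap_stable_hL1 al01 x0 l0)) lap_stable// mulrC [x * _]mulrC.
Qed.

End laplace.
End superposition.
End fixed.
End super.

(** * The kernels and their Dirac cases *)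

Section kernels.
Context {R : realType}.
Notation mu := (@lebesgue_measure R).
Notation H := (@halfline R).
Implicit Types (c d y t s al be x e k v u q r p : R).

Lemma hint_ereal (F G : R -> R) : hL1 F -> (forall s, 0 < s -> G s = F s) ->
  (\int[mu]_(s in H) F s)%:E = (\int[mu]_(s in H) (G s)%:E)%E.
Proof.
move=> IF GF; rewrite -hintE//; apply: eq_integral => s; rewrite halflineP => s0.
by rewrite GF.
Qed.

Lemma subst_ereal (g G : R -> R) k p : 0 < k -> p != 0 ->
  (forall s, 0 < s -> {for s, continuous g}) -> hL1 g ->
  (forall s, 0 < s -> G s = `|p| * k * s `^ (p - 1) * g (k * s `^ p)) ->
  (\int[mu]_(s in H) g s)%:E = (\int[mu]_(s in H) (G s)%:E)%E.
Proof.
move=> k0 p0 cg Ig GE; rewrite -(hint_subst k0 p0 cg Ig).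
exact: hint_ereal (hL1_subst k0 p0 cg Ig) GE.
Qed.

Lemma dirac_intE (A : set R) (w a : R -> R) p s0 a' : is_derive s0 1 a a' ->
  (forall s, A s -> (a s = p) <-> (s = s0)) ->
  dirac_int A w a p = if s0 \in A then w s0 / `|a'| else 0.
Proof.
move=> da As; rewrite /dirac_int.
have -> : A `&` [set s | a s = p] = A `&` [set s0].
  by apply/seteqP; split => s [? /=]; move/As; move=> /(_ ltac:(assumption)).
case: ifPn => s0A.
  have -> : A `&` [set s0] = [set s0].
    by apply/seteqP; split => [s []//|s /= ->]; split => //; exact: set_mem.
  by rewrite fsbig_set1 derive1E (@derive_val _ _ _ _ _ _ _ da).
have -> : A `&` [set s0] = set0.
  by apply/seteqP; split => // s [sA /= ss0]; move: s0A; rewrite -ss0 mem_set.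
by rewrite fsbig_set0.
Qed.

Lemma dirac_halfline (w a : R -> R) p s0 a' : 0 < s0 -> is_derive s0 1 a a' ->
  (forall s, 0 < s -> (a s = p) <-> (s = s0)) ->
  dirac_int H w a p = w s0 / `|a'|.
Proof.
move=> s00 da As; rewrite (dirac_intE w da) ?halflineP ?s00// => s.
by rewrite halflineE; exact: As.
Qed.

Lemma gint_dirac_id (F : R -> R) : gint H F (Dirac 1) id = (F 1)%:E.
Proof. by rewrite /= (dirac_halfline F ltr01 (dI 1))// normr1 divr1. Qed.

(** The only zero of r / s - 1 is s = r; the Jacobian there has absolute value 1 / r and cancels the
    weight. *)
Lemma gint_dirac_inv (g : R -> R) r : 0 < r ->
  gint H (fun s => s `^ (- 1) * g s) (Dirac 1) (fun s => r * s `^ (- 1)) = (g r)%:E.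
Proof.
move=> r0; rewrite /= (dirac_halfline _ r0 (dZ r (dpow (- 1) r0))); last first.
  move=> s s0; rewrite powRN powRr1 ?(ltW s0)//; split=> [h|->].
    by rewrite -[RHS](mulfVK (lt0r_neq0 s0)) h mul1r.
  by rewrite mulfV// gt_eqF.
congr (_%:E); rewrite mulN1r mulrN normrN (powRDp (- 1) (- 1) r0).
have rr : r * (r `^ (- 1) * r `^ (- 1)) = r^-1.
  by rewrite powRN powRr1 ?(ltW r0)// mulrA mulfV ?mul1r// gt_eqF.
rewrite rr ger0_norm ?invr_ge0 ?(ltW r0)// invrK powRN powRr1 ?(ltW r0)//.
by rewrite mulrAC mulVf ?mul1r// gt_eqF.
Qed.

Lemma as_measure_dirac (w a : R -> R -> R) : is_derive (1 : R) (1 : R) (a ^~ 1) 1 -> w 1 1 = 1 ->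
  (forall r, 0 < r -> a r 1 = r) ->
  as_measure (Dirac 1) (fun A =>
    gint H (fun s => dirac_int A (w ^~ s) (a ^~ s) 1) (Dirac 1) id).
Proof.
move=> da w1 a1 A _ AH; rewrite gint_dirac_id /=; congr (_%:E).
rewrite (dirac_intE _ (dI 1))// (dirac_intE _ da) ?w1// => s /AH.
by rewrite halflineE => /a1 ->.
Qed.

Lemma fker_regular c al t : al != 1 -> fker c al t = Regular (levy_kernel c al t).
Proof. by rewrite /fker => /negbTE ->. Qed.

Lemma fker1 c t : fker c 1 t = Dirac t.
Proof. by rewrite /fker eqxx. Qed.

Lemma phiker_regular d be t : be != 1 -> phiker d be t = Regular (mainardi_kernel d be t).
Proof. by rewrite /phiker => /negbTE ->. Qed.

Lemma phiker1 d t : phiker d 1 t = Dirac t.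
Proof. by rewrite /phiker eqxx. Qed.

Lemma psiker_beta1 c d al t : psiker c d al 1 t = fker c al t.
Proof. by rewrite /psiker eqxx. Qed.

Lemma psiker_alpha1 c d be t : be != 1 -> psiker c d 1 be t = phiker d be t.
Proof. by rewrite /psiker eqxx => /negbTE ->. Qed.

Lemma psiker_regular c d al be t : al != 1 -> be != 1 -> psiker c d al be t =
  Regular (fun tau => \int[mu]_(x in H) (mainardi_kernel d be t x * levy_kernel c al x tau)).
Proof. by rewrite /psiker => /negbTE -> /negbTE ->. Qed.

Section levy_forms.
Variable al : R.
Hypothesis al01 : 0 < al < 1.
Let a0 : 0 < al. Proof. by case/andP: al01. Qed.
Let ad : al != 0. Proof. by rewrite gt_eqF. Qed.

Lemma stable_time t s : 0 < t -> 0 < s -> stable al t s = s^-1 * stable al (t * s `^ (- al)) 1.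
Proof.
move=> t0 s0; have si : 0 < s^-1 by rewrite invr_gt0.
have <- : (s^-1) `^ al = s `^ (- al) by rewrite -powR_inv1 ?(ltW s0)// -powRrM mulN1r.
by rewrite (stable_scale al01 s si t0) mulfV// gt_eqF.
Qed.

(** Self-similarity is inherited from the Levy kernel through the link between the kernels, so the
    contour is opened only for the value 1 of the first argument. *)
Lemma mainardi_scale d t s : 0 < d -> 0 < t -> 0 < s ->
  mainardi_kernel d al t s = t `^ (- al) * wright al (s * t `^ (- al)).
Proof.
move=> d0 t0 s0; have T0 : 0 < t `^ (- al) by rewrite powR_gt0.
have h := mainardi_stable al01 t d0 s0.
rewrite (stable_time s0 t0) mulrA mulfV ?gt_eqF// mul1r in h.
rewrite (wrightE al01 (mulr_gt0 s0 T0)) -h.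
move: (mainardi_kernel _ _ _ _) (_ `^ _) T0 => M T T0.
by field; rewrite ad !gt_eqF.
Qed.

Lemma wright_stable s : 0 < s -> al * s `^ (- al - 1) * wright al (s `^ (- al)) = stable al 1 s.
Proof.
move=> s0; have S0 : 0 < s `^ (- al) by rewrite powR_gt0.
rewrite (stable_time ltr01 s0) mul1r (stable_wright al01 S0) (powRDp (- al) (- 1) s0).
rewrite [s `^ (- 1)]powRN powRr1 ?(ltW s0)//.
by move: (wright _ _) => m; ring.
Qed.

End levy_forms.

Local Notation kern c d al be r :=
  (\int[mu]_(x in H) (mainardi_kernel d be 1 x * levy_kernel c al x r)).

Section regular.
Variables (c d al be : R).
Hypotheses (c0 : 0 < c) (d0 : 0 < d) (al01 : 0 < al < 1) (be01 : 0 < be < 1).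
Let a0 : 0 < al. Proof. by case/andP: al01. Qed.
Let b0 : 0 < be. Proof. by case/andP: be01. Qed.
Let ad : al != 0. Proof. by rewrite gt_eqF. Qed.
Let bd : be != 0. Proof. by rewrite gt_eqF. Qed.
Let one1 : 0 < (1 : R) <= 1. Proof. by rewrite ltr01 lexx. Qed.

Lemma kernE r : kern c d al be r = superpose al (wright be) r.
Proof. by apply: eq_hint => x x0; rewrite mainardi_wright// levy_stable. Qed.

Lemma kern_int r : 0 < r -> hL1 (fun x => wright be x * stable al x r).
Proof.
move=> r0; have [K K0 HK] := wright_env be01.
by have h := superpose_int al01 one1 (wright_cont be01) HK r0.
Qed.

Lemma kern_cont r x : 0 < x -> {for x, continuous (fun x => wright be x * stable al x r)}.
Proof. by move=> x0; apply: cvgM; [exact: wright_cont|exact: stable_cont_t]. Qed.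

(** The substitution is by the factor t^(-beta), the Mainardi scale. Since w^alpha = t^(-beta), it
    also matches the scaling of the Levy factor by w. *)
Lemma kern_rescaling t tau : 0 < t -> 0 < tau ->
  \int[mu]_(x in H) (mainardi_kernel d be t x * levy_kernel c al x tau) =
  t `^ (- (be / al)) * kern c d al be (tau * t `^ (- (be / al))).
Proof.
move=> t0 tau0; set w := t `^ _; have w0 : 0 < w by rewrite powR_gt0.
have T0 : 0 < t `^ (- be) by rewrite powR_gt0.
have wT : w `^ al = t `^ (- be) by rewrite -powRrM mulNr mulfVK.
have tw : 0 < tau * w by rewrite mulr_gt0.
rewrite kernE -(hintZ _ (kern_int tw)).
rewrite -(hint_subst T0 (oner_neq0 R) _ (hL1Z w (kern_int tw))); last first.
  by move=> x x0; apply: cvgM; [exact: cvg_cst|exact: kern_cont].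
apply: eq_hint => s s0; rewrite normr1 mul1r subrr powRr0 mulr1 (powRr1 (ltW s0)).
rewrite mainardi_scale// levy_stable// (stable_scale al01 tau w0 s0) wT [t `^ (- be) * s]mulrC.
by rewrite -mulrA; congr (_ * _); rewrite mulrCA.
Qed.

Lemma kern_levy_mainardi r : 0 < r -> (kern c d al be r)%:E =
  (\int[mu]_(s in H) ((s `^ (- (1 / al)) * mainardi_kernel d be 1 s) *
     levy_kernel c al 1 (r * s `^ (- (1 / al))))%:E)%E.
Proof.
move=> r0; rewrite kernE /superpose; apply: (hint_ereal (kern_int r0)) => s s0.
by rewrite mainardi_wright// levy_stable// (stable_unit al01 r s0) mulrAC mulrC.
Qed.

(** Substitution x = s^(-beta): its Jacobian times wright (s^(-beta)) is the Levy density of index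
    beta, by [wright_stable]. *)
Lemma kern_levy_levy r : 0 < r -> (kern c d al be r)%:E =
  (\int[mu]_(s in H) ((s `^ (be / al) * levy_kernel c be 1 s) *
     levy_kernel c al 1 (r * s `^ (be / al)))%:E)%E.
Proof.
move=> r0; have bn : - be != 0 by rewrite oppr_eq0.
rewrite kernE /superpose; apply: (subst_ereal ltr01 bn (@kern_cont r) (kern_int r0)) => s s0.
have S0 : 0 < s `^ (- be) by rewrite powR_gt0.
rewrite normrN gtr0_norm// mulr1 !mul1r (stable_unit al01 r S0) !levy_stable//.
rewrite -powRrM mulrNN div1r [RHS]mulrA wright_stable//.
by rewrite mulrAC mulrC.
Qed.

(** Substitution x = r^alpha s: by homogeneity the Levy factor becomes r^(-1) times its value at
    time s and point 1, hence a Mainardi function of s. *)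
Lemma kern_mainardi_mainardi r : 0 < r -> (kern c d al be r)%:E =
  (\int[mu]_(s in H) ((al * r `^ (al - 1) * s * mainardi_kernel d al 1 s) *
     mainardi_kernel d be 1 (s * r `^ al))%:E)%E.
Proof.
move=> r0; have A0 : 0 < r `^ al by rewrite powR_gt0.
rewrite kernE /superpose; apply: (subst_ereal A0 (oner_neq0 R) (@kern_cont r) (kern_int r0)) => s s0.
have rs : 0 < r `^ al * s by rewrite mulr_gt0.
rewrite normr1 mul1r subrr powRr0 mulr1 (powRr1 (ltW s0)) (stable_time al01 rs r0).
have -> : r `^ al * s * r `^ (- al) = s by rewrite powRN mulrAC mulfV ?mul1r// gt_eqF.
rewrite stable_wright// !mainardi_wright//; last by rewrite mulrC.
rewrite [s * r `^ al]mulrC (powRDp al (- 1) r0) [r `^ (- 1)]powRN powRr1 ?(ltW r0)//.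
by move: (wright al s) => m; move: (wright be _) => m'; ring.
Qed.

End regular.

Section closed_form.
Variables (c d al : R).
Hypotheses (c0 : 0 < c) (d0 : 0 < d) (al01 : 0 < al < 1).
Let one1 : 0 < (1 : R) <= 1. Proof. by rewrite ltr01 lexx. Qed.

Lemma kern_diag r : 0 < r -> kern c d al al r = diag_kernel al r.
Proof.
rewrite (kernE c0 d0 al01 al01); have [K K0 HK] := wright_env al01.
apply: (lerch (f := superpose al (wright al))).
- exact: (superpose_cont al01 one1 K0 (wright_cont al01) HK).
- by move=> x; exact: diag_kernel_cont.
- by move=> l l0; exact: (superpose_lap_hL1 al01 one1 K0 (wright_cont al01) HK l0).
- by move=> l l0; exact: hL1_damp (diag_kernel_hL1 al01).
- by move=> l l0; rewrite (superpose_lap al01 one1 K0 (wright_cont al01) HK l0) lap_diag_kernel.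
Qed.

End closed_form.

Section levy_closed_form.
Variables (c d al be : R).
Hypotheses (c0 : 0 < c) (d0 : 0 < d) (al01 : 0 < al < 1) (be01 : 0 < be < 1) (ab : al < be).
Let one1 : 0 < (1 : R) <= 1. Proof. by rewrite ltr01 lexx. Qed.

(** The left transform at l is that of [wright be] at l^alpha. The right one is that of
    [diag_kernel be] at l^(alpha/beta), which is again that of [wright be] at
    (l^(alpha/beta))^beta. *)
Lemma kern_levy_kern r : 0 < r -> (kern c d al be r)%:E =
  (\int[mu]_(s in H) ((s `^ (- (be / al)) * kern c d be be s) *
     levy_kernel c (al / be) 1 (r * s `^ (- (be / al))))%:E)%E.
Proof.
move=> r0; have /andP[a0 _] := al01; have /andP[b0 b1] := be01.
have g01 : 0 < al / be < 1 by rewrite divr_gt0//= ltr_pdivrMr// mul1r.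
have bb1 : 0 < be <= 1 by rewrite b0 ltW.
have gi : 1 / (al / be) = be / al by rewrite div1r invf_div.
have [K K0 HK] := wright_env be01; have [C C0 HC] := diag_kernel_le be01.
have cH := diag_kernel_cont be01.
have -> : kern c d al be r = superpose (al / be) (diag_kernel be) r.
  rewrite (kernE c0 d0 al01 be01); apply: (lerch (f := superpose al (wright be))) r0.
  - exact: (superpose_cont al01 one1 K0 (wright_cont be01) HK).
  - exact: (superpose_cont g01 bb1 C0 cH HC).
  - by move=> l l0; exact: (superpose_lap_hL1 al01 one1 K0 (wright_cont be01) HK l0).
  - by move=> l l0; exact: (superpose_lap_hL1 g01 bb1 C0 cH HC l0).
  - move=> l l0; rewrite [LHS](superpose_lap al01 one1 K0 (wright_cont be01) HK l0).
    rewrite [RHS](superpose_lap g01 bb1 C0 cH HC l0) -[RHS](lap_diag_kernel be01 (powR_gt0 _ l0)).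
    by rewrite -powRrM mulfVK// gt_eqF.
apply: (hint_ereal (superpose_int g01 bb1 cH HC r0)) => s s0.
by rewrite (kern_diag c0 d0 be01 s0) levy_stable// (stable_unit g01 r s0) gi mulrAC mulrC.
Qed.

End levy_closed_form.

(** * Assembly of the regular and limiting cases *)

Section cases.
Variables (c d al be : R).
Hypotheses (c0 : 0 < c) (d0 : 0 < d) (halpha : 0 < al <= 1) (hbeta : 0 < be <= 1).

Let lt1 x : 0 < x <= 1 -> x != 1 -> 0 < x < 1.
Proof. by move=> /andP[x0 x1] xd; rewrite x0 lt_neqAle xd. Qed.

Lemma psiker_rescaling t : 0 < t ->
  rescaling (psiker c d al be t) (t `^ (- (be / al))) (subordK c d al be).
Proof.
move=> t0; rewrite /subordK.
have [B|B] := eqVneq be 1.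
  rewrite B !psiker_beta1; have [A|A] := eqVneq al 1.
    rewrite A !fker1 divr1 /rescaling => X _ XH /=; congr (_%:E).
    have w0 : 0 < t `^ (- 1) by rewrite powR_gt0.
    have wE : t `^ (- 1) = t^-1 by rewrite powRN powRr1// ltW.
    rewrite (dirac_intE _ (dI t))//.
    rewrite (dirac_intE (s0 := t) _ (dM (dI t) (dC t (t `^ (- 1))))); last first.
      move=> s /XH; rewrite halflineE wE => s0; split=> [h|->].
        by rewrite -(mulfVK (lt0r_neq0 t0) s) h mul1r.
      by rewrite mulfV// gt_eqF.
    by rewrite normr1 divr1 mulr0 addr0 mul1r gtr0_norm// mulfV// gt_eqF.
  rewrite !fker_regular//= => tau tau0.
  by rewrite !levy_stable ?lt1// (stable_unit (lt1 halpha A) tau t0).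
have [A|A] := eqVneq al 1.
  rewrite A !psiker_alpha1// !phiker_regular//= => tau tau0.
  rewrite divr1 (mainardi_scale (lt1 hbeta B) d0 t0 tau0) mainardi_wright ?lt1//.
  by rewrite mulr_gt0// powR_gt0.
rewrite !psiker_regular//= => tau tau0.
by rewrite (kern_rescaling c0 d0 (lt1 halpha A) (lt1 hbeta B) t0 tau0).
Qed.

Lemma subordK_levy_mainardi : superposition (subordK c d al be)
  (fun r s => s `^ (- (1 / al))) (levyL c al) (fun r s => r * s `^ (- (1 / al)))
  (mainardiM d be).
Proof.
rewrite /subordK /levyL /mainardiM /superposition.
have [B|B] := eqVneq be 1.
  rewrite B psiker_beta1 phiker1; have [A|A] := eqVneq al 1.
    rewrite A fker1; apply: as_measure_dirac => [||r _]; rewrite ?powR1 ?mulr1//.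
    by apply: is_derive_eq (dM (dI 1) (dC 1 _)) _; rewrite mulr0 addr0 mul1r ?powR1.
  rewrite fker_regular// => r r0.
  by rewrite gint_dirac_id powR1 mul1r mulr1.
rewrite phiker_regular//; have [A|A] := eqVneq al 1.
  rewrite A fker1 psiker_alpha1// phiker_regular// divr1 => r r0.
  by rewrite gint_dirac_inv.
rewrite fker_regular// psiker_regular// => r r0 /=.
exact (kern_levy_mainardi c0 d0 (lt1 halpha A) (lt1 hbeta B) r0).
Qed.

Lemma subordK_levy_levy : superposition (subordK c d al be)
  (fun r s => s `^ (be / al)) (levyL c al) (fun r s => r * s `^ (be / al))
  (levyL c be).
Proof.
rewrite /subordK /levyL /superposition.
have [B|B] := eqVneq be 1.
  rewrite B psiker_beta1 (fker1 c 1); have [A|A] := eqVneq al 1.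
    rewrite A fker1; apply: as_measure_dirac => [||r _]; rewrite ?powR1 ?mulr1//.
    by apply: is_derive_eq (dM (dI 1) (dC 1 _)) _; rewrite mulr0 addr0 mul1r ?powR1.
  rewrite fker_regular// => r r0.
  by rewrite gint_dirac_id powR1 mul1r mulr1.
rewrite (fker_regular c 1 B); have [A|A] := eqVneq al 1.
  rewrite A fker1 psiker_alpha1// phiker_regular// divr1 => r r0.
  have [b0 _] := andP hbeta; have bd : be != 0 by rewrite gt_eqF.
  (* The only zero of r s^beta - 1. What remains expresses both the Levy density at s0 and M_beta(r)
     through [stable be 1 s0]. *)
  pose s0 := r `^ (- (1 / be)); have s00 : 0 < s0 by rewrite powR_gt0.
  have s0b : s0 `^ be = r^-1 by rewrite powR_cancel.
  rewrite /= (dirac_halfline _ s00 (dZ r (dpow be s00))); last first.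
    move=> s sp; split=> [h|->]; last by rewrite s0b mulfV// gt_eqF.
    have sb : s `^ be = r^-1 by rewrite -[LHS](mulKf (lt0r_neq0 r0)) h mulr1.
    have rE : r = s `^ (- be) by rewrite powRN sb invrK.
    by rewrite /s0 rE -powRrM mulrNN div1r mulfV// powRr1// ltW.
  congr (_%:E); rewrite levy_stable ?lt1// mainardi_wright ?lt1// wrightE ?lt1//.
  rewrite (stable_unit (lt1 hbeta B) 1 r0) -/s0 [1 * s0]mul1r.
  rewrite (powRDp be (- 1) s00) s0b [s0 `^ (- 1)]powRN powRr1 ?(ltW s00)//.
  rewrite ger0_norm; last by rewrite !mulr_ge0 ?invr_ge0 ?(ltW r0) ?(ltW b0) ?(ltW s00).
  by move: (stable _ _ _) => F; field; rewrite !gt_eqF.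
rewrite fker_regular// psiker_regular// => r r0 /=.
exact (kern_levy_levy c0 d0 (lt1 halpha A) (lt1 hbeta B) r0).
Qed.

Lemma subordK_mainardi_mainardi : superposition (subordK c d al be)
  (fun r s => al * r `^ (al - 1) * s) (mainardiM d be) (fun r s => s * r `^ al)
  (mainardiM d al).
Proof.
rewrite /subordK /mainardiM /superposition.
have [B|B] := eqVneq be 1.
  rewrite B psiker_beta1 (phiker1 d 1); have [A|A] := eqVneq al 1.
    rewrite A fker1 phiker1; apply: as_measure_dirac => [||r r0].
    - by apply: is_derive_eq (dZ 1 (dpow 1 ltr01)) _; rewrite subrr powRr0 !mulr1.
    - by rewrite powR1 !mulr1.
    - by rewrite mul1r powRr1// ltW.
  rewrite fker_regular// phiker_regular// => r r0.
  have [a0 _] := andP halpha; have ad : al != 0 by rewrite gt_eqF.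
  have R0 : 0 < r `^ al by rewrite powR_gt0.
  (* r^(-alpha) is the only zero of s r^alpha - 1, and the identity reduces to [wright_stable]. *)
  have s00 : 0 < r `^ (- al) by rewrite powR_gt0.
  have sE : r `^ (- al) = (r `^ al)^-1 by rewrite powRN.
  rewrite /= (dirac_halfline _ s00 (dM (dI _) (dC _ (r `^ al)))); last first.
    move=> s sp; split=> [h|->]; last by rewrite sE mulVf// gt_eqF.
    by rewrite sE -[LHS](mulfK (lt0r_neq0 R0)) h mul1r.
  congr (_%:E); rewrite mulr0 addr0 mul1r levy_stable ?lt1// mainardi_wright ?lt1//.
  rewrite -(wright_stable (lt1 halpha A) r0) gtr0_norm//.
  rewrite (powRDp al (- 1) r0) (powRDp (- al) (- 1) r0).
  move: (wright _ _) (r `^ (- 1)) => m q; rewrite sE.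
  by field; rewrite gt_eqF.
rewrite phiker_regular//; have [A|A] := eqVneq al 1.
  rewrite A psiker_alpha1// phiker1 phiker_regular// => r r0.
  by rewrite gint_dirac_id subrr powRr0 !mul1r powRr1// ltW.
rewrite phiker_regular// psiker_regular// => r r0 /=.
exact (kern_mainardi_mainardi c0 d0 (lt1 halpha A) (lt1 hbeta B) r0).
Qed.

Lemma subordK_closed_form : al < 1 -> pointwise (subordK c d al al) (fun r =>
  (pi^-1 * (r `^ (al - 1) * sin (al * pi) /
     (r `^ (2 * al) + 2 * r `^ al * cos (al * pi) + 1)))%:E).
Proof.
move=> a1; have ad : al != 1 by rewrite lt_eqF.
rewrite /subordK psiker_regular// => r r0.
by rewrite (kern_diag c0 d0 (lt1 halpha ad) r0).
Qed.

Lemma subordK_levy_subordK : al <= be -> superposition (subordK c d al be)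
  (fun r s => s `^ (- (be / al))) (levyL c (al / be)) (fun r s => r * s `^ (- (be / al)))
  (subordK c d be be).
Proof.
move=> ab; have [a0 _] := andP halpha; have [b0 _] := andP hbeta.
have ad : al != 0 by rewrite gt_eqF.
rewrite /subordK /levyL /superposition.
have [B|B] := eqVneq be 1.
  rewrite B !psiker_beta1 divr1 (fker1 c 1); have [A|A] := eqVneq al 1.
    rewrite A fker1; apply: as_measure_dirac => [||r _]; rewrite ?powR1 ?mulr1//.
    by apply: is_derive_eq (dM (dI 1) (dC 1 _)) _; rewrite mulr0 addr0 mul1r ?powR1.
  rewrite fker_regular// => r r0.
  by rewrite gint_dirac_id powR1 mul1r mulr1.
have A : al != 1.
  by rewrite lt_eqF//; apply: le_lt_trans ab _; case/andP: (lt1 hbeta B).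
(* For alpha = beta < 1 the index alpha / beta is 1, so the Levy factor is itself a delta and must
   be evaluated apart. *)
rewrite !psiker_regular//; have [AB|AB] := eqVneq al be.
  rewrite -AB divff// fker1 => r r0.
  by rewrite gint_dirac_inv.
have lab : al < be by rewrite lt_neqAle AB.
have gd : al / be != 1 by rewrite lt_eqF// ltr_pdivrMr// mul1r.
rewrite fker_regular// => r r0 /=.
exact (kern_levy_kern c0 d0 (lt1 halpha A) (lt1 hbeta B) lab r0).
Qed.

End cases.
End kernels.

Theorem theorem3p1 (R : realType) (c d : R) (hc : 0 < c) (hd : 0 < d)
    (alpha beta : R) (halpha : 0 < alpha <= 1) (hbeta : 0 < beta <= 1) :
  (forall t : R, 0 < t ->
     rescaling (psiker c d alpha beta t) (t `^ (- (beta / alpha)))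
       (subordK c d alpha beta)) /\
  superposition (subordK c d alpha beta)
    (fun r s => s `^ (- (1 / alpha)))
    (levyL c alpha) (fun r s => r * s `^ (- (1 / alpha)))
    (mainardiM d beta) /\
  superposition (subordK c d alpha beta)
    (fun r s => s `^ (beta / alpha))
    (levyL c alpha) (fun r s => r * s `^ (beta / alpha))
    (levyL c beta) /\
  superposition (subordK c d alpha beta)
    (fun r s => alpha * r `^ (alpha - 1) * s)
    (mainardiM d beta) (fun r s => s * r `^ alpha)
    (mainardiM d alpha) /\
  (alpha = beta -> alpha < 1 ->
     pointwise (subordK c d alpha alpha) (fun r =>
       (pi^-1 * (r `^ (alpha - 1) * sin (alpha * pi) /
          (r `^ (2 * alpha) + 2 * r `^ alpha * cos (alpha * pi) + 1)))%:E)) /\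
  (alpha <= beta ->
     superposition (subordK c d alpha beta)
       (fun r s => s `^ (- (beta / alpha)))
       (levyL c (alpha / beta)) (fun r s => r * s `^ (- (beta / alpha)))
       (subordK c d beta beta)).
Proof.
split; first by move=> t; exact: psiker_rescaling.
split; first exact: subordK_levy_mainardi.
split; first exact: subordK_levy_levy.
split; first exact: subordK_mainardi_mainardi.
split; first by move=> _; exact: subordK_closed_form.
exact: subordK_levy_subordK.
Qed.
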